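(* Let $\alpha>1$, $0<\beta<\infty$, $u\in H(\mathbb{D})$, $\varphi\in S(\mathbb{D})$, and suppose $uC_\varphi:\mathcal{B}^\alpha\to\mathcal{Z}_\beta$ is bounded. Then $$\|uC_\varphi\|_{e,\mathcal{B}^\alpha\to\mathcal{Z}_\beta}\asymp\max\Big\{\limsup_{n\to\infty}(n+1)^\alpha\|(2u'\varphi'+u\varphi'')\varphi^n\|_{\nu_\beta},\ \limsup_{n\to\infty}(n+1)^{\alpha+1}\|u(\varphi')^2\varphi^n\|_{\nu_\beta},\ \limsup_{n\to\infty}(n+1)^{\alpha-1}\|u''\varphi^n\|_{\nu_\beta}\Big\}.$$
   Context: $\mathbb{D}$ is the open unit disk, $H(\mathbb{D})$ the holomorphic functions on $\mathbb{D}$, $S(\mathbb{D})$ the holomorphic self-maps of $\mathbb{D}$; $uC_\varphi f(z)=u(z)f(\varphi(z))$, and $\varphi^n$ is the $n$-th power of $\varphi$. $\mathcal{B}^\alpha$ is the space of $f\in H(\mathbb{D})$ with $\sup_z(1-|z|^2)^\alpha|f'(z)|<\infty$, normed by $|f(0)|+\sup_z(1-|z|^2)^\alpha|f'(z)|$. $\mathcal{Z}_\beta$ is the space of $f\in H(\mathbb{D})$ with $\sup_z(1-|z|^2)^\beta|f''(z)|<\infty$, normed by $|f(0)|+|f'(0)|+\sup_z(1-|z|^2)^\beta|f''(z)|$. For $g\in H(\mathbb{D})$, $\|g\|_{\nu_\beta}=\sup_z(1-|z|^2)^\beta|g(z)|$. The essential norm of a bounded operator $T:X\to Y$ is $\inf\{\|T-K\|:K:X\to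 Y\text{ compact}\}$. $A\asymp B$ means $B/C\le A\le CB$ for a positive constant $C$ independent of $u,\varphi$. *)

(* Defs.v *)
From mathcomp Require Import all_boot all_order all_algebra.
From mathcomp Require Import complex.
From mathcomp Require Import all_classical all_reals all_analysis.
Import Order.TTheory GRing.Theory Num.Theory.
Set Implicit Arguments. Unset Strict Implicit. Unset Printing Implicit Defensive.
Local Open Scope ring_scope.
Local Open Scope classical_set_scope.

Definition CC (R : realType) : numFieldType := complex R.

(* Complex functions; the ^o makes C a normed C-module, so [derivable f z 1]
   is complex differentiability and [derive1 f] is the complex derivative. *)
Definition cfun (R : realType) := (CC R)^o -> (CC R)^o.

Definition cabs (R : realType) (z : CC R) : R := complex.Re (`|z| : complex R).

Definition disk (R : realType) : set (CC R) := [set z | cabs z < 1].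

Definition holo (R : realType) (f : cfun R) : Prop :=
  forall z : CC R, disk z -> derivable f z 1.

Definition cder (R : realType) (f : cfun R) : cfun R := fun z => derive1 f z.

Definition selfmap (R : realType) (phi : cfun R) : Prop :=
  holo phi /\ forall z : CC R, disk z -> disk (phi z).

Definition wt (R : realType) (a : R) (z : CC R) : R := (1 - cabs z ^+ 2) `^ a.

Definition wsup (R : realType) (a : R) (g : cfun R) : \bar R :=
  ereal_sup [set ((wt a z * cabs (g z))%:E) | z in @disk R].

Definition inB (R : realType) (al : R) (f : cfun R) : Prop :=
  holo f /\ (wsup al (cder f) < +oo)%E.
Definition normB (R : realType) (al : R) (f : cfun R) : \bar R :=
  ((cabs (f 0))%:E + wsup al (cder f))%E.

Definition inZ (R : realType) (be : R) (f : cfun R) : Prop :=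
  holo f /\ (wsup be (cder (cder f)) < +oo)%E.
Definition normZ (R : realType) (be : R) (f : cfun R) : \bar R :=
  ((cabs (f 0))%:E + (cabs (cder f 0))%:E + wsup be (cder (cder f)))%E.

Definition wco (R : realType) (u phi : cfun R) : cfun R -> cfun R :=
  fun f z => u z * f (phi z).

Definition bounded_op (R : realType) (al be : R) (T : cfun R -> cfun R) : Prop :=
  (forall f, inB al f -> inZ be (T f)) /\
  exists M : R, forall f, inB al f -> (normZ be (T f) <= M%:E * normB al f)%E.

Definition linear_on (R : realType) (al : R) (T : cfun R -> cfun R) : Prop :=
  forall (f g : cfun R) (a : CC R), inB al f -> inB al g ->
    forall z, disk z -> T (fun w => f w + a * g w) z = T f z + a * T g z.

(* K : B^alpha -> Z_beta is a compact (linear) operator: it maps B^alpha to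
   Z_beta and the image of the closed unit ball is relatively compact in
   Z_beta, i.e. (metric space) every sequence in the unit ball has a
   subsequence whose image converges in the Z_beta norm. *)
Definition compact_op (R : realType) (al be : R) (K : cfun R -> cfun R) : Prop :=
  linear_on al K /\ (forall f, inB al f -> inZ be (K f)) /\
  forall fs : nat -> cfun R,
    (forall n, inB al (fs n) /\ (normB al (fs n) <= 1)%E) ->
    exists (sg : nat -> nat) (g : cfun R),
      {homo sg : m n / (m < n)%N >-> (m < n)%N} /\ inZ be g /\
      (fun n => normZ be (fun z => K (fs (sg n)) z - g z)) @ \oo --> 0%E.

Definition opnorm (R : realType) (al be : R) (T : cfun R -> cfun R) : \bar R :=
  ereal_sup [set normZ be (T f) | f in [set f | inB al f /\ (normB al f <= 1)%E]].

Definition essnorm (R : realType) (al be : R) (T : cfun R -> cfun R) : \bar R :=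
  ereal_inf [set opnorm al be (fun f z => T f z - K f z) | K in compact_op al be].

(* Main.v *)
(* Upper bound. Composing with the truncation f -> (a dyadic quadrature of the
   Cauchy integral of f(tau .), evaluated at tau z) gives operators K of finite
   rank, and the remainders f - (truncation of f) stay bounded in B^alpha and are
   uniformly small on compact subsets of the disk. Hence only the points where
   |phi(z)| is close to 1 matter in
     (u f(phi))'' = u'' f(phi) + (2 u' phi' + u phi'') f'(phi) + u phi'^2 f''(phi),
   and there the growth of f, f', f'' against (1 - |phi|)^(alpha - 1 + i) is
   compensated by the limsup of the powers phi^n.
   Lower bound. With m ~ 1 / (2 (1 - |a|)) and a = phi(z), the polynomials
   m^(alpha - 1) (d1 (z/a)^m + d2 (z/a)^(2m) + d3 (z/a)^(3m)) are bounded in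
   B^alpha, and d1, d2, d3 can be chosen to isolate f(a), f'(a) or f''(a). Along a
   sequence with m doubling at least at each step their partial sums remain
   bounded, so that a compact K sends them to 0 along a subsequence.
   Goursat's theorem and the Cauchy estimates are proved with trapezoid sums in
   place of contour integrals. *)
Require Import Defs.
From mathcomp Require Import all_boot all_order all_algebra.
From mathcomp Require Import complex.
From mathcomp Require Import all_classical all_reals all_analysis.
From mathcomp Require Import ring lra.
Import Order.TTheory GRing.Theory Num.Theory.
Local Open Scope ring_scope.

Import numFieldNormedType.Exports.
Set Implicit Arguments.
Unset Strict Implicit.
Unset Printing Implicit Defensive.

(** Both inequalities pass through one pointwise condition, [near_boundary]: the weighted
    coefficient is at most [lam] (1 - |phi|)^a wherever |phi| exceeds some s < 1. For a bounded
    weighted coefficient this amounts, up to constants depending on a alone, to a bound on the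
    limsup for that coefficient, because (n+1)^a t^a (1-t)^n is bounded in n and t, and bounded
    below when n is comparable to 1/t. The operator is thereby separated from the powers of phi. The
    obstacle in the upper bound is the order of quantifiers: K is fixed before f. Convergence of the
    discrete Cauchy formula for each single f is not enough, so its error is bounded by a multiple
    of 2^-n that is common to the unit ball. The lower bound uses neither duality nor weak
    convergence: if all K F_j are close to one g, then K of a sum of J+1 of them is close to (J+1)
    g, while it stays bounded, which forces g'' to be small. The hypothesis alpha > 1 enters through
    |f(z)| <= C (1-|z|)^(1-alpha), the origin of the exponent alpha - 1 in the term with u''. *)

Section Modulus.
Context {R : realType}.
Implicit Types z w : CC R.

Lemma normE z : `|z| = ((cabs z)%:C)%C :> CC R.
Proof. by rewrite /cabs; case: z => a b; rewrite normc_def. Qed.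

Lemma cabsE z : cabs z = Num.sqrt (complex.Re z ^+ 2 + complex.Im z ^+ 2).
Proof. by case: z => a b; rewrite /cabs normc_def. Qed.

Lemma cabs_ge0 z : 0 <= cabs z.
Proof. by rewrite cabsE sqrtr_ge0. Qed.

Lemma cabsM z w : cabs (z * w) = cabs z * cabs w.
Proof. by apply: (@complexI R); rewrite -normE normrM !normE rmorphM. Qed.

Lemma cabsD z w : cabs (z + w) <= cabs z + cabs w.
Proof.
have := ler_normD z w; rewrite !normE -rmorphD /=.
by rewrite (_ : ((_ : CC R) <= _) = (cabs (z + w) <= cabs z + cabs w)) // -lecR.
Qed.

Lemma cabsN z : cabs (- z) = cabs z.
Proof. by rewrite /cabs normrN. Qed.

Lemma cabs_distrC z w : cabs (z - w) = cabs (w - z).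
Proof. by rewrite /cabs distrC. Qed.

Lemma cabs0 : cabs (0 : CC R) = 0.
Proof. by rewrite /cabs normr0. Qed.

Lemma cabs1 : cabs (1 : CC R) = 1.
Proof. by rewrite /cabs normr1. Qed.

Lemma cabsX z n : cabs (z ^+ n) = cabs z ^+ n.
Proof. by elim: n => [|n IH]; rewrite ?expr0 ?cabs1 // !exprS cabsM IH. Qed.

Lemma cabs_eq0 z : (cabs z == 0) = (z == 0).
Proof.
rewrite -[z == 0]normr_eq0 normE.
by apply/eqP/eqP => [->//|]; move=> /(@complexI R _ 0).
Qed.

Lemma cabs_gt0 z : (0 < cabs z) = (z != 0).
Proof. by rewrite lt_neqAle cabs_ge0 andbT eq_sym cabs_eq0. Qed.

Lemma cabsV z : cabs z^-1 = (cabs z)^-1.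
Proof.
have [->|z0] := eqVneq z 0; first by rewrite invr0 cabs0 invr0.
have h : cabs z != 0 by rewrite cabs_eq0.
by apply: (mulfI h); rewrite -cabsM !mulfV // cabs1.
Qed.

Lemma cabsB z w : cabs z - cabs w <= cabs (z - w).
Proof. by have := cabsD (z - w) w; rewrite subrK; lra. Qed.

Lemma cabs_subl z w : cabs (z - w) <= cabs z + cabs w.
Proof. by have := cabsD z (- w); rewrite cabsN. Qed.

Lemma cabs_real (x : R) : cabs ((x%:C)%C : CC R) = `|x|.
Proof. by rewrite cabsE /= expr0n /= addr0 sqrtr_sqr. Qed.

Lemma cabs_nat n : cabs (n%:R : CC R) = n%:R.
Proof.
rewrite /cabs normr_nat.
by rewrite (_ : (n%:R : complex R) = (n%:R)%:C%C) // rmorph_nat.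
Qed.

Lemma cabs_Re z : `|complex.Re z| <= cabs z.
Proof.
rewrite cabsE -sqrtr_sqr ler_wsqrtr //.
by rewrite lerDl sqr_ge0.
Qed.

Lemma cabs_Im z : `|complex.Im z| <= cabs z.
Proof.
rewrite cabsE -sqrtr_sqr ler_wsqrtr //.
by rewrite lerDr sqr_ge0.
Qed.

Lemma cabs_ReIm z : cabs z <= `|complex.Re z| + `|complex.Im z|.
Proof.
have e : z = (complex.Re z)%:C%C + (0 +i* 1)%C * (complex.Im z)%:C%C by case: z => a b; rewrite [LHS]complexE.
rewrite {1}e; apply: le_trans (cabsD _ _) _; rewrite cabsM !cabs_real.
by rewrite (cabsE (0 +i* 1)%C) /= expr0n expr1n add0r sqrtr1 mul1r.
Qed.

Lemma cabs_sum (I : Type) (r : seq I) (P : pred I) (F : I -> CC R) :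
  cabs (\sum_(i <- r | P i) F i) <= \sum_(i <- r | P i) cabs (F i).
Proof.
elim/big_rec2: _ => [|i y x _ h]; first by rewrite cabs0.
by apply: le_trans (cabsD _ _) _; rewrite lerD2l.
Qed.

End Modulus.

(** * Complex differentiability in epsilon-delta form *)

Section ComplexDerivative.
Context {R : realType}.
Implicit Types (z w d : CC R) (f g : cfun R).

(** Multiplying through by w - z, with real moduli and a non-strict bound, removes the quotient and
    the punctured neighbourhood: w = z is no special case, and estimates become real
    inequalities. *)
Definition cdiff f z d := forall e : R, 0 < e -> exists2 dl : R, 0 < dl &
  forall w, cabs (w - z) < dl -> cabs (f w - f z - d * (w - z)) <= e * cabs (w - z).

Lemma cdiff_quad f z d (B r : R) : 0 < r ->
  (forall w, cabs (w - z) < r ->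
    cabs (f w - f z - d * (w - z)) <= B * cabs (w - z) ^+ 2) -> cdiff f z d.
Proof.
move=> r0 H e e0.
have B0 : 0 < `|B| + 1 by have := normr_ge0 B; lra.
exists (Num.min r (e / (`|B| + 1))); first by rewrite lt_min r0 divr_gt0.
move=> w; rewrite lt_min => /andP[h1]; rewrite ltr_pdivlMr // => h2.
apply: le_trans (H _ h1) _; rewrite expr2 mulrA.
apply: ler_wpM2r; first exact: cabs_ge0.
have := cabs_ge0 (w - z); have := ler_norm B; nra.
Qed.

Lemma cdiff_cont f z d : cdiff f z d -> forall e : R, 0 < e ->
  exists2 dl : R, 0 < dl & forall w, cabs (w - z) < dl -> cabs (f w - f z) < e.
Proof.
move=> H e e0; have [dl dl0 h] := H 1 ltr01.
have k0 : 0 < cabs d + 1 by have := cabs_ge0 d; lra.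
exists (Num.min dl (e / (cabs d + 1))); first by rewrite lt_min dl0 divr_gt0.
move=> w; rewrite lt_min => /andP[h1]; rewrite ltr_pdivlMr // => h2.
have := h _ h1; have := cabsD (f w - f z - d * (w - z)) (d * (w - z)).
rewrite subrK cabsM; lra.
Qed.

Lemma cdiff_lip f z d : cdiff f z d -> exists2 dl : R, 0 < dl &
  forall w, cabs (w - z) < dl -> cabs (f w - f z) <= (cabs d + 1) * cabs (w - z).
Proof.
move=> H; have [dl dl0 h] := H 1 ltr01; exists dl => // w /h.
have := cabsD (f w - f z - d * (w - z)) (d * (w - z)).
rewrite subrK cabsM; lra.
Qed.

Lemma cdiff_ext f g z d (r : R) : 0 < r ->
  (forall w, cabs (w - z) < r -> f w = g w) -> cdiff f z d -> cdiff g z d.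
Proof.
move=> r0 E H e e0; have [dl dl0 h] := H e e0.
exists (Num.min r dl); first by rewrite lt_min r0.
move=> w; rewrite lt_min => /andP[h1 h2].
by rewrite -E // -(E z) ?subrr ?cabs0 //; apply: h.
Qed.

Lemma cdiff_cst c z : cdiff (fun=> c) z 0.
Proof.
apply: (@cdiff_quad _ _ _ 0 1) => // w _.
by rewrite !(subrr, mul0r) cabs0.
Qed.

Lemma cdiff_id z : cdiff (fun w => w) z 1.
Proof.
apply: (@cdiff_quad _ _ _ 0 1) => // w _.
by rewrite !(subrr, mul0r, mul1r) cabs0.
Qed.

Lemma cdiffD f g z d d' : cdiff f z d -> cdiff g z d' ->
  cdiff (fun w => f w + g w) z (d + d').
Proof.
move=> H H' e e0; have e20 : 0 < e / 2 by lra.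
have [dl dl0 h] := H _ e20; have [dl' dl'0 h'] := H' _ e20.
exists (Num.min dl dl'); first by rewrite lt_min dl0.
move=> w; rewrite lt_min => /andP[/h h1 /h' h2].
rewrite (_ : _ - _ - _ = (f w - f z - d * (w - z)) + (g w - g z - d' * (w - z))).
  by apply: le_trans (cabsD _ _) _; lra.
by ring.
Qed.

Lemma cdiffM f g z d d' : cdiff f z d -> cdiff g z d' ->
  cdiff (fun w => f w * g w) z (d * g z + f z * d').
Proof.
move=> H H' e e0.
pose k := 1 + cabs (f z) + cabs (g z) + cabs d + cabs d'.
have [fz gz d0 d'0] : [/\ 0 <= cabs (f z), 0 <= cabs (g z), 0 <= cabs d & 0 <= cabs d'].
  by split; exact: cabs_ge0.
have k0 : 0 < k by rewrite /k; lra.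
have k1 : 1 <= k by rewrite /k; lra.
(* Each of the three terms of the split remainder below is at most k e' |w - z|. *)
pose e' := e / (4 * k).
have kE : 4 * (k * e') = e by rewrite /e'; field; lra.
have e'0 : 0 < e' by rewrite /e' divr_gt0 //; lra.
have [dl1 dl10 h1] := H _ e'0.
have [dl2 dl20 h2] := H' _ e'0.
have [dl3 dl30 h3] := cdiff_cont H' ltr01.
have [dl4 dl40 h4] := cdiff_cont H' e'0.
exists (Num.min (Num.min dl1 dl2) (Num.min dl3 dl4)).
  by rewrite !lt_min dl10 dl20 dl30.
move=> w; rewrite !lt_min => /andP[/andP[/h1 a1 /h2 a2] /andP[/h3 a3 /h4 a4]].
rewrite (_ : _ - _ - _ = (f w - f z - d * (w - z)) * g w +
  (f z * (g w - g z - d' * (w - z)) + d * (w - z) * (g w - g z))); last by ring.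
have gw : cabs (g w) <= k.
  have := cabsD (g w - g z) (g z); rewrite subrK /k; lra.
apply: le_trans (cabsD _ _) _; apply: le_trans (lerD (lexx _) (cabsD _ _)) _.
rewrite !cabsM.
have wz := cabs_ge0 (w - z).
have b1 : cabs (f w - f z - d * (w - z)) * cabs (g w) <= e' * cabs (w - z) * k.
  by apply: ler_pM => //; exact: cabs_ge0.
have b2 : cabs (f z) * cabs (g w - g z - d' * (w - z)) <= k * (e' * cabs (w - z)).
  by apply: ler_pM => //; [exact: cabs_ge0 | rewrite /k; lra].
have b3 : cabs d * cabs (w - z) * cabs (g w - g z) <= k * cabs (w - z) * e'.
  apply: ler_pM => //; rewrite ?mulr_ge0 ?cabs_ge0 ?(ltW a4) //.
  by apply: ler_wpM2r => //; rewrite /k; lra.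
have : 0 <= k * e' * cabs (w - z) by apply: mulr_ge0 => //; apply: mulr_ge0; exact: ltW.
rewrite -kE; lra.
Qed.

Lemma cdiffZ c f z d : cdiff f z d -> cdiff (fun w => c * f w) z (c * d).
Proof.
move=> H; have := cdiffM (cdiff_cst c z) H.
by rewrite (_ : 0 * f z + _ = c * d) // mul0r add0r.
Qed.

Lemma cdiffB f g z d d' : cdiff f z d -> cdiff g z d' ->
  cdiff (fun w => f w - g w) z (d - d').
Proof.
move=> H H'; have := cdiffD H (cdiffZ (-1) H'); rewrite mulN1r.
by apply: (@cdiff_ext _ _ _ _ 1) => // w _; rewrite mulN1r.
Qed.

Lemma cdiff_sum (I : Type) (r : seq I) (F : I -> cfun R) (D : I -> CC R) z :
  (forall i, cdiff (F i) z (D i)) ->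
  cdiff (fun w => \sum_(i <- r) F i w) z (\sum_(i <- r) D i).
Proof.
move=> H; elim: r => [|i r IH].
  rewrite big_nil; apply: (@cdiff_ext (fun=> 0) _ _ _ 1) (cdiff_cst _ _) => // w _.
  by rewrite big_nil.
rewrite big_cons; apply: (@cdiff_ext _ _ _ _ 1) (cdiffD (H i) IH) => // w _.
by rewrite big_cons.
Qed.

Lemma cdiff_comp f g z d d' : cdiff f z d -> cdiff g (f z) d' ->
  cdiff (fun w => g (f w)) z (d' * d).
Proof.
move=> H H' e e0.
have d0 := cabs_ge0 d; have d'0 := cabs_ge0 d'.
pose k := 1 + cabs d + cabs d'.
have k0 : 0 < k by rewrite /k; lra.
pose e' := e / (2 * k).
have kE : 2 * (k * e') = e by rewrite /e'; field; lra.
have e'0 : 0 < e' by rewrite /e' divr_gt0 //; lra.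
have [dl1 dl10 h1] := H _ e'0.
have [dl2 dl20 h2] := H' _ e'0.
have [dl3 dl30 h3] := cdiff_lip H.
have [dl4 dl40 h4] := cdiff_cont H dl20.
exists (Num.min dl1 (Num.min dl3 dl4)); first by rewrite !lt_min dl10 dl30.
move=> w; rewrite !lt_min => /andP[/h1 a1 /andP[/h3 a3 /h4 /h2 a4]].
rewrite (_ : _ - _ - _ = (g (f w) - g (f z) - d' * (f w - f z)) +
  d' * (f w - f z - d * (w - z))); last by ring.
apply: le_trans (cabsD _ _) _; rewrite cabsM -kE.
have wz := cabs_ge0 (w - z).
have b1 : e' * cabs (f w - f z) <= e' * (k * cabs (w - z)).
  apply: ler_wpM2l; first exact: ltW.
  by apply: le_trans a3 _; apply: ler_wpM2r => //; rewrite /k; lra.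
have b2 : cabs d' * cabs (f w - f z - d * (w - z)) <= k * (e' * cabs (w - z)).
  by apply: ler_pM => //; [exact: cabs_ge0 | rewrite /k; lra].
lra.
Qed.

(** The remainder is exactly (w - z)^2 / (z^2 w); on the ball of radius |z|/2 one has |w| >= |z|/2,
    whence the quadratic constant 2 / |z|^3. *)
Lemma cdiff_inv z : z != 0 -> cdiff (fun w => w^-1) z (- z ^- 2).
Proof.
move=> z0; have cz : 0 < cabs z by rewrite cabs_gt0.
apply: (@cdiff_quad _ _ _ (2 / cabs z ^+ 3) (cabs z / 2)); first lra.
move=> w h.
have cw : cabs z / 2 <= cabs w by have := cabsB z w; rewrite cabs_distrC; lra.
have w0 : w != 0 by rewrite -cabs_gt0; lra.
rewrite (_ : _ - _ - _ = (w - z) ^+ 2 / (z ^+ 2 * w)); last by field; rewrite ?z0 ?w0.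
rewrite !cabsM cabsV cabsM !cabsX [leLHS]mulrC.
apply: ler_wpM2r; first by rewrite mulr_ge0 ?cabs_ge0.
have wp : 0 < cabs w by lra.
rewrite -(invf_div (cabs z ^+ 3) 2) lef_pV2 ?posrE ?mulr_gt0 ?exprn_gt0 ?divr_gt0 ?exprn_gt0 //.
rewrite exprSr -mulrA ler_wpM2l // ?exprn_ge0 ?(ltW cz) //; lra.
Qed.

Lemma cdiff_pow n z : cdiff (fun w => w ^+ n) z (n%:R * z ^+ n.-1).
Proof.
elim: n => [|n IH].
  rewrite mul0r; exact: (@cdiff_ext _ _ _ _ 1 _ _ (cdiff_cst 1 z)).
have := cdiffM (cdiff_id z) IH.
rewrite (_ : 1 * _ + _ = n.+1%:R * z ^+ n).
  by apply: (@cdiff_ext _ _ _ _ 1) => // w _; rewrite exprS.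
case: n {IH} => [|n]; first by rewrite mul0r mulr0 addr0 !expr0.
by rewrite /= [z ^+ n.+1]exprS -[in RHS]natr1; ring.
Qed.

End ComplexDerivative.

(** * Agreement with the library derivative *)

Section Bridge.
Context {R : realType}.
Implicit Types (z w d : CC R) (f g : cfun R).
Local Open Scope classical_set_scope.

Lemma CC_gt0 (e : CC R) : 0 < e -> e = ((complex.Re e)%:C)%C /\ 0 < complex.Re e.
Proof.
case: e => a b; rewrite (ltcE (0 : R[i]%C)) /= => /andP[/eqP -> h]; split => //.
Qed.

Lemma CC_ltP (x : CC R) (e : R) : (`|x| < ((e%:C)%C : CC R)) = (cabs x < e).
Proof. by rewrite normE (ltcR (cabs x) e). Qed.

Lemma cdiffP f z d : cdiff f z d <->
  (h^-1 *: (f (h + z) - f z) @[h --> (0 : CC R)^'] --> (d : (CC R)^o)).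
Proof.
split.
- move=> H; apply/cvgrPdist_le => e e0.
  have [E r0] := CC_gt0 e0.
  have [dl dl0 h] := H _ r0.
  have dlc : 0 < (dl%:C)%C :> CC R by rewrite (ltcR 0 dl).
  near=> t.
  have t0 : t != 0 by near: t; exact: nbhs_dnbhs_neq.
  have tl : cabs t < dl.
    by rewrite -CC_ltP; near: t; exact: dnbhs0_lt.
  have := h (t + z); rewrite addrK => /(_ tl) h1.
  rewrite E normE (lecR (cabs _) (complex.Re e)).
  rewrite (_ : d - _ = - (t^-1 * (f (t + z) - f z - d * t))); last first.
    by rewrite /GRing.scale /=; field.
  by rewrite cabsN cabsM cabsV ler_pdivrMl ?cabs_gt0 // [leRHS]mulrC.
- move=> /cvgrPdist_le H e e0.
  have ec : 0 < (e%:C)%C :> CC R by rewrite (ltcR 0 e).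
  have [/= D D0 h] := H _ ec.
  have [E r0] := CC_gt0 D0.
  exists (complex.Re D) => // w wl.
  have [->|wz] := eqVneq w z; first by rewrite !subrr mulr0 subrr cabs0 mulr0.
  have t0 : w - z != 0 by rewrite subr_eq0.
  have := h (w - z); rewrite /ball_ /= sub0r normrN subrK.
  rewrite E CC_ltP wl => /(_ isT t0).
  rewrite normE (lecR (cabs _) e).
  rewrite (_ : d - _ = - ((w - z)^-1 * (f w - f z - d * (w - z)))); last first.
    by rewrite /GRing.scale /=; field.
  by rewrite cabsN cabsM cabsV ler_pdivrMl ?cabs_gt0 // [leRHS]mulrC.
Unshelve. all: by end_near.
Qed.

Lemma cdiff_cder f z d : cdiff f z d -> cder f z = d.
Proof. by move=> /cdiffP H; exact: (cvg_lim _ H). Qed.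

Lemma derivableP_cdiff f z : derivable f z 1 <-> exists d, cdiff f z d.
Proof.
rewrite /derivable (_ : (fun h => _) = (fun h : CC R => h^-1 *: (f (h + z) - f z))).
  split=> [H|[d /cdiffP H]]; last by apply/cvg_ex; exists d.
  by exists (cder f z); apply/cdiffP.
by apply/funext => h; rewrite /= [h *: 1]mulr1.
Qed.

Lemma cdiff_derivable f z d : cdiff f z d -> derivable f z 1.
Proof. by move=> H; apply/derivableP_cdiff; exists d. Qed.

Lemma derivable_cdiff f z : derivable f z 1 -> cdiff f z (cder f z).
Proof. by case/derivableP_cdiff => d H; rewrite (cdiff_cder H). Qed.

End Bridge.

(** * Goursat's theorem for trapezoid sums *)

Section Goursat.
Context {R : realType}.
Local Notation C := (CC R).
Implicit Types (f g : C -> C) (p q : C) (y : R -> C).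

(* Trapezoid sums over dyadic subdivisions play the role of contour integrals:
   the trapezoid rule is exact on affine functions, and closed sums telescope. *)
Definition trap f p q : C := (f p + f q) / 2 * (q - p).

(** Halving at the root makes a sum of depth n + 1 over an edge the sum of two sums of depth n over
    its halves, the identity on which the bisection of squares rests. *)
Fixpoint seg n f y (a l : R) : C :=
  if n is k.+1 then seg k f y a (l / 2) + seg k f y (a + l / 2) (l / 2)
  else trap f (y a) (y (a + l)).

Lemma half_add (a l : R) : a + l / 2 + l / 2 = a + l.
Proof. by field. Qed.

Lemma segD n f g y a l : seg n (fun w => f w + g w) y a l = seg n f y a l + seg n g y a l.
Proof.
elim: n a l => [|n IH] a l /=; first by rewrite /trap; ring.
by rewrite !IH; ring.
Qed.

Lemma segZ n c f y a l : seg n (fun w => c * f w) y a l = c * seg n f y a l.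
Proof.
elim: n a l => [|n IH] a l /=; first by rewrite /trap; ring.
by rewrite !IH; ring.
Qed.

Lemma segB n f g y a l : seg n (fun w => f w - g w) y a l = seg n f y a l - seg n g y a l.
Proof.
elim: n a l => [|n IH] a l /=; first by rewrite /trap; ring.
by rewrite !IH; ring.
Qed.

Lemma eq_seg n f g y y' a l : 0 <= l ->
  (forall t, a <= t <= a + l -> y t = y' t) ->
  (forall t, a <= t <= a + l -> f (y t) = g (y t)) ->
  seg n f y a l = seg n g y' a l.
Proof.
elim: n a l => [|n IH] a l l0 H H'.
  by rewrite /= /trap !H' -?H //; lra.
by rewrite /=; congr (_ + _); apply: IH => [|t ht|t ht]; [lra|apply: H|apply: H'|lra|apply: H|apply: H']; lra.
Qed.

(** At every depth the sum telescopes to the increment of the primitive c0 w + c1 (w - p)^2 / 2. *)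
Lemma seg_affine n (c0 c1 p : C) y a l :
  seg n (fun w => c0 + c1 * (w - p)) y a l =
  (c0 * y (a + l) + c1 * (y (a + l) - p) ^+ 2 / 2) -
  (c0 * y a + c1 * (y a - p) ^+ 2 / 2).
Proof.
elim: n a l => [|n IH] a l /=; first by rewrite /trap; field.
by rewrite !IH half_add; ring.
Qed.

Lemma seg_bound n f y a l (M L : R) : 0 <= l -> 0 <= M ->
  (forall t, a <= t <= a + l -> cabs (f (y t)) <= M) ->
  (forall s t, a <= s <= a + l -> a <= t <= a + l -> cabs (y s - y t) <= L * `|s - t|) ->
  cabs (seg n f y a l) <= M * (L * l).
Proof.
elim: n a l => [|n IH] a l l0 M0 HM HL.
  rewrite /= /trap cabsM; apply: ler_pM; rewrite ?cabs_ge0 //.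
    rewrite cabsM cabsV cabs_nat.
    have := cabsD (f (y a)) (f (y (a + l))).
    have h1 : cabs (f (y a)) <= M by apply: HM; lra.
    have h2 : cabs (f (y (a + l))) <= M by apply: HM; lra.
    lra.
  have := HL (a + l) a; rewrite (_ : a + l - a = l); last by ring.
  by rewrite (ger0_norm l0); apply; lra.
rewrite /=; apply: le_trans (cabsD _ _) _.
have -> : M * (L * l) = M * (L * (l / 2)) + M * (L * (l / 2)) by field.
apply: lerD; apply: IH => //; try lra.
- by move=> t ht; apply: HM; lra.
- by move=> s t hs ht; apply: HL; lra.
- by move=> t ht; apply: HM; lra.
- by move=> s t hs ht; apply: HL; lra.
Qed.

(** The boundary of the image under [G] of the square with corner (s, t) and side l: bottom, right,
    top reversed, left reversed. *)
Definition bsum n f (G : R -> R -> C) (s t l : R) : C :=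
  seg n f (fun x => G x t) s l + seg n f (fun x => G (s + l) x) t l
  - seg n f (fun x => G x (t + l)) s l - seg n f (fun x => G s x) t l.

(** The inner edges occur twice with opposite signs and cancel exactly, already in the finite
    sums. *)
Lemma bsumS n f G s t l : bsum n.+1 f G s t l =
  bsum n f G s t (l / 2) + bsum n f G (s + l / 2) t (l / 2) +
  (bsum n f G s (t + l / 2) (l / 2) + bsum n f G (s + l / 2) (t + l / 2) (l / 2)).
Proof. by rewrite /bsum /= !half_add; ring. Qed.

Definition sqr2 (s t l x x' : R) := (s <= x <= s + l) && (t <= x' <= t + l).

Definition lip2 (L : R) (G : R -> R -> C) := forall s t s' t',
  sqr2 0 0 1 s t -> sqr2 0 0 1 s' t' ->
  cabs (G s t - G s' t') <= L * (`|s - s'| + `|t - t'|).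

Definition inside (s t l : R) := [&& 0 <= s, 0 <= t, 0 <= l, s + l <= 1 & t + l <= 1].

Lemma inside_sqr2 s t l x x' : inside s t l -> sqr2 s t l x x' -> sqr2 0 0 1 x x'.
Proof. by move=> /and5P[? ? ? ? ?] /andP[/andP[? ?] /andP[? ?]]; rewrite /sqr2; lra. Qed.

(** The affine part of [f] contributes nothing around a closed boundary. The rest is at most 2 e L l
    in modulus on four sides whose images have length at most L l. The bound does not depend on the
    depth n. *)
Lemma bsum_local n f (G : R -> R -> C) (L e s t l s0 t0 : R) (d : C) :
  0 <= L -> 0 <= e -> lip2 L G -> inside s t l -> sqr2 s t l s0 t0 ->
  (forall x x', sqr2 s t l x x' ->
     cabs (f (G x x') - f (G s0 t0) - d * (G x x' - G s0 t0))
     <= e * cabs (G x x' - G s0 t0)) ->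
  cabs (bsum n f G s t l) <= 8 * e * L ^+ 2 * l ^+ 2.
Proof.
move=> L0 e0 HL hi hs0 H.
set p := G s0 t0.
pose a w := f p + d * (w - p); pose r w := f w - a w.
have fE : f = (fun w => a w + r w) by apply/funext => w; rewrite /r addrC subrK.
have l0 : 0 <= l by case/and5P: hi.
have hl (x y : R) : s <= x <= s + l -> `|x - s0| <= l.
  by case/andP: hs0 => ? ? ?; rewrite ler_norml; lra.
have hl' (x y : R) : t <= x <= t + l -> `|x - t0| <= l.
  by case/andP: hs0 => ? ? ?; rewrite ler_norml; lra.
have Hr x x' : sqr2 s t l x x' -> cabs (r (G x x')) <= e * (2 * L * l).
  move=> hx; have := H _ _ hx; rewrite -/p.
  rewrite (_ : _ - _ - _ = r (G x x')); last by rewrite /r /a; ring.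
  move=> h; apply: le_trans h _; apply: ler_wpM2l => //.
  apply: le_trans (HL _ _ _ _ _ _) _; try exact: inside_sqr2 hi _.
  have /andP[hx1 hx2] := hx.
  have := hl _ 0 hx1; have := hl' _ 0 hx2 => h1 h2.
  rewrite (_ : 2 * L * l = L * (l + l)); last by ring.
  by apply: ler_wpM2l => //; exact: lerD.
have side n' y a0 : 0 <= e * (2 * L * l) ->
   (forall x, a0 <= x <= a0 + l -> exists u v, y x = G u v /\ sqr2 s t l u v) ->
   (forall x x', a0 <= x <= a0 + l -> a0 <= x' <= a0 + l -> cabs (y x - y x') <= L * `|x - x'|) ->
   cabs (seg n' r y a0 l) <= 2 * e * L ^+ 2 * l ^+ 2.
  move=> m0 hy hy'.
  rewrite (_ : _ * l ^+ 2 = e * (2 * L * l) * (L * l)); last by ring.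
  by apply: seg_bound => // x /hy[u [v [-> /Hr]]].
have m0 : 0 <= e * (2 * L * l) by rewrite !mulr_ge0.
have bE : bsum n f G s t l = bsum n r G s t l.
  have sE y u v : seg n f y u v = (f p * y (u + v) + d * (y (u + v) - p) ^+ 2 / 2) -
      (f p * y u + d * (y u - p) ^+ 2 / 2) + seg n r y u v.
    by rewrite -(seg_affine n) -segD; congr seg; rewrite {1}fE.
  by rewrite /bsum !sE; ring.
rewrite bE /bsum.
have hG u v u' v' : sqr2 s t l u v -> sqr2 s t l u' v' ->
   cabs (G u v - G u' v') <= L * (`|u - u'| + `|v - v'|).
  by move=> h1 h2; apply: HL; exact: inside_sqr2 hi _.
have b1 : cabs (seg n r (fun x => G x t) s l) <= 2 * e * L ^+ 2 * l ^+ 2.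
  apply: side => // [x hx|x x' hx hx'].
    by exists x, t; split => //; rewrite /sqr2; lra.
  have := hG x t x' t; rewrite subrr normr0 addr0.
  by apply; rewrite /sqr2; lra.
have b2 : cabs (seg n r (fun x => G (s + l) x) t l) <= 2 * e * L ^+ 2 * l ^+ 2.
  apply: side => // [x hx|x x' hx hx'].
    by exists (s + l), x; split => //; rewrite /sqr2; lra.
  have := hG (s + l) x (s + l) x'; rewrite subrr normr0 add0r.
  by apply; rewrite /sqr2; lra.
have b3 : cabs (seg n r (fun x => G x (t + l)) s l) <= 2 * e * L ^+ 2 * l ^+ 2.
  apply: side => // [x hx|x x' hx hx'].
    by exists x, (t + l); split => //; rewrite /sqr2; lra.
  have := hG x (t + l) x' (t + l); rewrite subrr normr0 addr0.
  by apply; rewrite /sqr2; lra.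
have b4 : cabs (seg n r (fun x => G s x) t l) <= 2 * e * L ^+ 2 * l ^+ 2.
  apply: side => // [x hx|x x' hx hx'].
    by exists s, x; split => //; rewrite /sqr2; lra.
  have := hG s x s x'; rewrite subrr normr0 add0r.
  by apply; rewrite /sqr2; lra.
apply: le_trans (cabs_subl _ _) _.
apply: le_trans (lerD (cabs_subl _ _) (lexx _)) _.
apply: le_trans (lerD (lerD (cabsD _ _) (lexx _)) (lexx _)) _.
lra.
Qed.

(** The bound is proportional to the area, so it adds up over quarters; it is asked only from some
    depth on, and the four quarters may need different depths. *)
Definition flat f G (dl : R) (s t l : R) :=
  exists N, forall n, (N <= n)%N -> cabs (bsum n f G s t l) <= dl * l ^+ 2.

Lemma flat4 f G dl s t l :
  flat f G dl s t (l / 2) -> flat f G dl (s + l / 2) t (l / 2) ->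
  flat f G dl s (t + l / 2) (l / 2) -> flat f G dl (s + l / 2) (t + l / 2) (l / 2) ->
  flat f G dl s t l.
Proof.
move=> [N1 h1] [N2 h2] [N3 h3] [N4 h4].
exists (maxn (maxn N1 N2) (maxn N3 N4)).+1 => -[//|n]; rewrite ltnS !geq_max.
move=> /andP[/andP[/h1 g1 /h2 g2] /andP[/h3 g3 /h4 g4]]; rewrite bsumS.
rewrite (_ : dl * l ^+ 2 = dl * (l / 2) ^+ 2 + dl * (l / 2) ^+ 2 +
  (dl * (l / 2) ^+ 2 + dl * (l / 2) ^+ 2)); last by field.
apply: le_trans (cabsD _ _) _; apply: lerD; apply: le_trans (cabsD _ _) _; exact: lerD.
Qed.

Lemma nested_halving (u : nat -> R) (l : nat -> R) :
  (forall k, u k <= u k.+1) -> (forall k, u k.+1 + l k.+1 <= u k + l k) ->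
  (forall k, 0 <= l k) -> exists x, forall k, u k <= x <= u k + l k.
Proof.
move=> mu ml l0.
have mu' k m : u k <= u (k + m)%N.
  by elim: m => [|m IH]; rewrite ?addn0 // addnS; apply: le_trans IH _.
have ml' k m : u (k + m)%N + l (k + m)%N <= u k + l k.
  by elim: m => [|m IH]; rewrite ?addn0 // addnS; apply: le_trans IH.
have ub k m : u m <= u k + l k.
  have h1 := mu' m k; have h2 := ml' k m; have h3 := l0 (m + k)%N.
  by rewrite addnC in h2; lra.
exists (sup (range u)) => k; apply/andP; split.
  apply: ub_le_sup; last by exists k.
  by exists (u 0%N + l 0%N) => _ [m _ <-].
by apply: ge_sup; [exists (u 0%N), 0%N | move=> _ [m _ <-]].
Qed.

(** A square that is not [flat] has a quarter that is not. The nested bad squares close in on one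
    parameter point, where differentiability lets [bsum_local] contradict badness. *)
Theorem goursat f (G : R -> R -> C) (L : R) : 0 <= L -> lip2 L G ->
  (forall s t, sqr2 0 0 1 s t -> exists d, cdiff f (G s t) d) ->
  forall dl : R, 0 < dl ->
  exists N, forall n, (N <= n)%N -> cabs (bsum n f G 0 0 1) <= dl.
Proof.
move=> L0 HL Hd dl dl0; apply: contrapT => bad0.
have {}bad0 : ~ flat f G dl 0 0 1 by rewrite /flat expr1n mulr1.
pose Bad (x : R * R * R) := inside x.1.1 x.1.2 x.2 /\ ~ flat f G dl x.1.1 x.1.2 x.2.
have step (x : R * R * R) : exists x' : R * R * R, Bad x ->
   Bad x' /\ [/\ x'.2 = x.2 / 2, x.1.1 <= x'.1.1 <= x.1.1 + x.2 / 2 &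
      x.1.2 <= x'.1.2 <= x.1.2 + x.2 / 2].
  case: x => [[s t] l]; rewrite /Bad /=.
  have [[hi hb]|nB] := pselect (inside s t l /\ ~ flat f G dl s t l); last by exists (s, t, l).
  have [h1|h1] := pselect (flat f G dl s t (l / 2)); last first.
    exists (s, t, l / 2) => _ /=; split; first split => //.
      by move: hi; rewrite /inside => /and5P[? ? ? ? ?]; lra.
    by move: hi; rewrite /inside => /and5P[? ? ? ? ?]; split => //; lra.
  have [h2|h2] := pselect (flat f G dl (s + l / 2) t (l / 2)); last first.
    exists (s + l / 2, t, l / 2) => _ /=; split; first split => //.
      by move: hi; rewrite /inside => /and5P[? ? ? ? ?]; lra.
    by move: hi; rewrite /inside => /and5P[? ? ? ? ?]; split => //; lra.
  have [h3|h3] := pselect (flat f G dl s (t + l / 2) (l / 2)); last first.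
    exists (s, t + l / 2, l / 2) => _ /=; split; first split => //.
      by move: hi; rewrite /inside => /and5P[? ? ? ? ?]; lra.
    by move: hi; rewrite /inside => /and5P[? ? ? ? ?]; split => //; lra.
  have [h4|h4] := pselect (flat f G dl (s + l / 2) (t + l / 2) (l / 2)); last first.
    exists (s + l / 2, t + l / 2, l / 2) => _ /=; split; first split => //.
      by move: hi; rewrite /inside => /and5P[? ? ? ? ?]; lra.
    by move: hi; rewrite /inside => /and5P[? ? ? ? ?]; split => //; lra.
  by case: hb; exact: flat4.
have [nx Hnx] := choice step.
pose X k := iter k nx (0, 0, 1).
have XB k : Bad (X k).
  elim: k => [|k IH]; first by split => //; rewrite /inside /=; lra.
  by have [] := Hnx _ IH.
have X2 k : (X k).2 = 2^-1 ^+ k.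
  elim: k => [|k IH]; first by rewrite expr0.
  by have [_ [->]] := Hnx _ (XB k); rewrite IH exprSr.
have l0 k : 0 <= (X k).2 by rewrite X2 exprn_ge0.
have Xs k : (X k).1.1 <= (X k.+1).1.1 /\ (X k.+1).1.1 + (X k.+1).2 <= (X k).1.1 + (X k).2.
  by have [_ [/= -> ]] := Hnx _ (XB k); lra.
have Xt k : (X k).1.2 <= (X k.+1).1.2 /\ (X k.+1).1.2 + (X k.+1).2 <= (X k).1.2 + (X k).2.
  by have [_ [/= -> ]] := Hnx _ (XB k); lra.
have [s0 hs0] := nested_halving (fun k => (Xs k).1) (fun k => (Xs k).2) l0.
have [t0 ht0] := nested_halving (fun k => (Xt k).1) (fun k => (Xt k).2) l0.
have [d hd] := Hd s0 t0 (inside_sqr2 (XB 0%N).1 (introT andP (conj (hs0 0%N) (ht0 0%N)))).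
(* Makes 8 e L^2 <= [dl]; the + 1 covers L = 0. *)
pose e := dl / (8 * (L ^+ 2 + 1)).
have L2 : 0 <= L ^+ 2 by rewrite exprn_ge0.
have e0 : 0 < e by rewrite divr_gt0 //; lra.
have [r r0 hr] := hd e e0.
(* From this k on, [G] maps the whole bad square into the ball of radius r around [G s0 t0]. *)
have [k hk] : exists k, 2^-1 ^+ k < r / (2 * L + 1) :> R.
  have q0 : 0 < r / (2 * L + 1) by rewrite divr_gt0 //; lra.
  have : ((fun k => 2^-1 ^+ k : R) @ \oo --> (0 : R))%classic.
    by apply: cvg_expr; rewrite gtr0_norm; lra.
  move=> /cvgrPdist_lt /(_ _ q0)[k _ hk]; exists k.
  by have := hk k (leqnn k); rewrite /= sub0r normrN ger0_norm // exprn_ge0.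
have [hi] := XB k; apply; exists 0%N => n _.
have hst : sqr2 (X k).1.1 (X k).1.2 (X k).2 s0 t0 by rewrite /sqr2 hs0 ht0.
apply: le_trans (@bsum_local n f G L e _ _ _ s0 t0 d L0 (ltW e0) HL hi hst _) _.
  move=> x x' hx; apply: hr.
  apply: le_lt_trans (HL _ _ _ _ (inside_sqr2 hi hx) (inside_sqr2 hi hst)) _.
  move: hst hx; rewrite /sqr2 X2 => /andP[? ?] /andP[? ?].
  have h1 : `|x - s0| <= 2^-1 ^+ k by rewrite ler_norml; lra.
  have h2 : `|x' - t0| <= 2^-1 ^+ k by rewrite ler_norml; lra.
  move: hk; rewrite ltr_pdivlMr; last lra.
  have p0 : 0 <= 2^-1 ^+ k :> R by rewrite exprn_ge0.
  have : L * (`|x - s0| + `|x' - t0|) <= L * (2^-1 ^+ k + 2^-1 ^+ k).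
    by apply: ler_wpM2l => //; exact: lerD.
  lra.
apply: ler_wpM2r; first by rewrite exprn_ge0.
rewrite /e (_ : 8 * _ * _ = dl * (L ^+ 2 / (L ^+ 2 + 1))); last by field; lra.
rewrite -[leRHS]mulr1; apply: ler_wpM2l; first exact: ltW.
by rewrite ler_pdivrMr; lra.
Qed.

End Goursat.

(** * Null sequences, Bolzano-Weierstrass, and differentiability of limits *)

Section Sequences.
Context {R : realType}.
Local Notation C := (CC R).
Implicit Types (x y : nat -> C).

Definition vanishes x := forall e : R, 0 < e ->
  exists N, forall n, (N <= n)%N -> cabs (x n) <= e.

Lemma vanishesD x y : vanishes x -> vanishes y -> vanishes (fun n => x n + y n).
Proof.
move=> hx hy e e0; have e2 : 0 < e / 2 by lra.
have [N h] := hx _ e2; have [N' h'] := hy _ e2.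
exists (maxn N N') => n; rewrite geq_max => /andP[/h a /h' b].
by apply: le_trans (cabsD _ _) _; lra.
Qed.

Lemma vanishes_le x (u : nat -> C) (M : R) N : vanishes x ->
  (forall n, (N <= n)%N -> cabs (u n) <= M * cabs (x n)) -> vanishes u.
Proof.
move=> hx hu e e0.
have M0 : 0 < `|M| + 1 by have := normr_ge0 M; lra.
have e2 : 0 < e / (`|M| + 1) by rewrite divr_gt0.
have [N' h] := hx _ e2.
exists (maxn N N') => n; rewrite geq_max => /andP[/hu a /h].
rewrite ler_pdivlMr // => b; apply: le_trans a _.
by have := cabs_ge0 (x n); have := ler_norm M; nra.
Qed.

Lemma vanishes_subseq x (sg : nat -> nat) : {homo sg : m n / (m < n)%N >-> (m < n)%N} ->
  vanishes x -> vanishes (x \o sg).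
Proof.
move=> hsg hx e e0; have [N h] := hx e e0; exists N => n Nn; apply: h.
apply: leq_trans Nn _; elim: n => // n IH.
by apply: leq_ltn_trans IH _; exact: hsg.
Qed.

Lemma real_bolzano_weierstrass (u : nat -> R) (M : R) : (forall n, `|u n| <= M) ->
  exists sg : nat -> nat, exists l : R, {homo sg : m n / (m < n)%N >-> (m < n)%N} /\
  forall e, 0 < e -> exists N, forall n, (N <= n)%N -> `|u (sg n) - l| <= e.
Proof.
move=> uM.
have bu : bounded_fun u by exists M; split => [|y My n _]; [rewrite num_real|exact: le_trans (uM n) (ltW My)].
have [sg sgi cu] := bolzano_weierstrass bu.
exists sg, (limn (u \o sg)); split.
  move=> m n mn; have := sgi n m; rewrite !leEnat => E.
  by rewrite ltnNge E -ltnNge.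
move=> e e0; have /cvgrPdist_le /(_ e e0)[N _ h] := cu.
by exists N => n Nn; rewrite distrC; exact: h.
Qed.

Lemma complex_bolzano_weierstrass x (M : R) : (forall n, cabs (x n) <= M) ->
  exists sg : nat -> nat, exists l : C, {homo sg : m n / (m < n)%N >-> (m < n)%N} /\
  vanishes (fun n => x (sg n) - l).
Proof.
move=> xM.
have h1 n : `|complex.Re (x n)| <= M by apply: le_trans (cabs_Re _) _.
have [s1 [a [s1i ha]]] := real_bolzano_weierstrass h1.
have h2 n : `|complex.Im (x (s1 n))| <= M by apply: le_trans (cabs_Im _) _.
have [s2 [b [s2i hb]]] := real_bolzano_weierstrass h2.
exists (s1 \o s2), (a +i* b)%C; split; first by move=> m n /s2i /s1i.
move=> e e0; have e2 : 0 < e / 2 by lra.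
have [N hN] := ha _ e2; have [N' hN'] := hb _ e2.
exists (maxn N N') => n; rewrite geq_max => /andP[Nn N'n].
apply: le_trans (cabs_ReIm _) _.
have := hN' _ N'n.
have := hN (s2 n); rewrite (leq_trans Nn) => [/(_ isT)|]; last first.
  by elim: (n) => // k IH; apply: leq_ltn_trans IH _; exact: s2i.
by rewrite /=; case: (x _) => u v /=; lra.
Qed.

Lemma bolzano_weierstrass_seq (T : eqType) (s : seq T) (x : nat -> T -> C) (M : R) :
  (forall n i, i \in s -> cabs (x n i) <= M) ->
  exists sg : nat -> nat, exists l : T -> C, {homo sg : m n / (m < n)%N >-> (m < n)%N} /\
  forall i, i \in s -> vanishes (fun n => x (sg n) i - l i).
Proof.
elim: s x => [|i0 s IH] x H; first by exists id, (fun=> 0); split => // i; rewrite in_nil.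
have H' n i : i \in s -> cabs (x n i) <= M by move=> hi; apply: H; rewrite inE hi orbT.
have [s1 [l [s1i h1]]] := IH x H'.
have [s2 [l0 [s2i h2]]] := complex_bolzano_weierstrass (fun n => H (s1 n) i0 (mem_head _ _)).
exists (s1 \o s2), (fun i => if i == i0 then l0 else l i); split; first by move=> m n /s2i /s1i.
move=> i; rewrite inE; case: eqVneq => [-> _ //|_ /= his].
exact: (vanishes_subseq s2i (h1 _ his)).
Qed.

(** A quadratic remainder that is uniform in n survives the pointwise limit. A convergent
    subsequence of the [D n] provides [d]; the full sequence follows because the values at z and at
    one nearby point determine the slope up to e. *)
Lemma cdiff_limit (Phi : nat -> C -> C) (F : C -> C) (D : nat -> C) (z : C) (r B M : R) N0 :
  0 < r -> 0 <= B ->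
  (forall w, cabs (w - z) < r -> vanishes (fun n => Phi n w - F w)) ->
  (forall n w, (N0 <= n)%N -> cabs (w - z) < r ->
    cabs (Phi n w - Phi n z - D n * (w - z)) <= B * cabs (w - z) ^+ 2) ->
  (forall n, (N0 <= n)%N -> cabs (D n) <= M) ->
  exists d, [/\ cdiff F z d, cabs d <= M & vanishes (fun n => D n - d)].
Proof.
move=> r0 B0 hP hB hM.
have zz : cabs (z - z) < r by rewrite subrr cabs0.
have [sg [d [sgi hd]]] := complex_bolzano_weierstrass (fun n => hM (N0 + n)%N (leq_addr _ _)).
have sgN n : (n <= sg n)%N by elim: n => // k IH; apply: leq_ltn_trans IH _; exact: sgi.
have q w : cabs (w - z) < r -> cabs (F w - F z - d * (w - z)) <= B * cabs (w - z) ^+ 2.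
  move=> wr; apply/ler_addgt0Pl => e e0.
  have e3 : 0 < e / (3 * (r + 1)) by rewrite divr_gt0 //; lra.
  have e3' : 0 < e / 3 by lra.
  have [N1 h1] := hP _ wr _ e3'; have [N2 h2] := hP _ zz _ e3'; have [N3 h3] := hd _ e3.
  pose n := maxn (maxn N1 N2) N3.
  pose k := (N0 + sg n)%N.
  have kn : (n <= k)%N by apply: leq_trans (sgN n) _; exact: leq_addl.
  have := h1 k (leq_trans (leq_trans (leq_maxl _ _) (leq_maxl _ _)) kn).
  have := h2 k (leq_trans (leq_trans (leq_maxr _ _) (leq_maxl _ _)) kn).
  have := h3 n (leq_maxr _ _); rewrite -/k => g3 g2 g1.
  have := hB k w (leq_addr _ _) wr.
  have -> : F w - F z - d * (w - z) = (Phi k w - Phi k z - D k * (w - z)) +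
     ((D k - d) * (w - z) + ((Phi k z - F z) - (Phi k w - F w))) by ring.
  move=> g4; apply: le_trans (cabsD _ _) _.
  apply: le_trans (lerD (lexx _) (cabsD _ _)) _.
  apply: le_trans (lerD (lexx _) (lerD (lexx _) (cabs_subl _ _))) _.
  have : cabs ((D k - d) * (w - z)) <= e / 3.
    rewrite cabsM (_ : e / 3 = e / (3 * (r + 1)) * (r + 1)); last by field; lra.
    by apply: ler_pM => //; rewrite ?cabs_ge0 //; lra.
  lra.
exists d; split; first exact: cdiff_quad r0 q.
  apply/ler_addgt0Pl => e e0; have [N hN] := hd _ e0.
  have := hN N (leqnn _); have := hM (N0 + sg N)%N (leq_addr _ _).
  have := cabs_subl (D (N0 + sg N)%N) (D (N0 + sg N)%N - d).
  by rewrite opprB addrC subrK; lra.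
move=> e e0.
(* At distance t each of the two quadratic remainders is at most e t / 4, which leaves e t / 2 for
   the pointwise errors. *)
pose t := Num.min (r / 2) (e / (4 * (B + 1))).
have t0 : 0 < t by rewrite lt_min; apply/andP; split; [lra|rewrite divr_gt0 //; lra].
have tr : t <= r / 2 by rewrite ge_min lexx.
have te : t <= e / (4 * (B + 1)) by rewrite ge_min lexx orbT.
pose w : C := z + (t%:C)%C.
have wz : w - z = (t%:C)%C by rewrite /w addrC addKr.
have cw : cabs (w - z) = t by rewrite wz cabs_real gtr0_norm.
have wr : cabs (w - z) < r by rewrite cw; lra.
have et : 0 < e * t / 4 by rewrite divr_gt0 // mulr_gt0.
have [N1 h1] := hP _ wr _ et; have [N2 h2] := hP _ zz _ et.
exists (maxn N0 (maxn N1 N2)) => n; rewrite !geq_max => /andP[n0 /andP[/h1 g1 /h2 g2]].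
have g3 := hB _ _ n0 wr; have g4 := q _ wr.
have : cabs ((D n - d) * (w - z)) <= e * t.
  have -> : (D n - d) * (w - z) = (F w - F z - d * (w - z)) - (Phi n w - Phi n z - D n * (w - z))
    + ((Phi n w - F w) - (Phi n z - F z)) by ring.
  apply: le_trans (cabsD _ _) _.
  apply: le_trans (lerD (cabs_subl _ _) (cabs_subl _ _)) _.
  move: te; rewrite ler_pdivlMr; last lra.
  move=> te; rewrite cw in g3 g4.
  have : B * t ^+ 2 <= e * t / 4 by rewrite expr2; nra.
  lra.
by rewrite cabsM cw ler_pM2r.
Qed.

End Sequences.

(** * Trapezoid sums over the unit circle *)

Section Circle.
Context {R : realType}.
Local Notation C := (CC R).
Implicit Types (f g h F : C -> C) (z w : C).

Definition ee (t : R) : C := (cos (2 * pi * t) +i* sin (2 * pi * t))%C.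

Lemma cabs_ee t : cabs (ee t) = 1.
Proof. by rewrite cabsE /= cos2Dsin2 sqrtr1. Qed.

Lemma ee01 : ee 0 = ee 1.
Proof.
rewrite /ee !mulr0 mulr1 cos0 sin0.
by rewrite (_ : 2 * pi = pi *+ 2 :> R) ?cos2pi ?sin2pi // mulr_natl.
Qed.

Lemma MVT_lip (f df : R -> R) : (forall x : R, is_derive x 1 f (df x)) ->
  (forall x, `|df x| <= 1) -> forall x y : R, `|f x - f y| <= `|x - y|.
Proof.
move=> D B x y.
wlog xy : x y / x <= y.
  by move=> H; case: (leP x y) => [/H//|/ltW /H]; rewrite distrC [leRHS]distrC.
have [|c _ h] := @MVT_segment _ f df x y xy (fun x _ => D x).
  apply: continuous_subspaceT => t.
  by have [d _] := D t; apply: differentiable_continuous; apply/derivable1_diffP.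
by rewrite distrC h normrM [`|x - y|]distrC -[leRHS]mul1r ler_wpM2r.
Qed.

(** Each coordinate of [ee] is Lipschitz with constant 2 pi, and the modulus is bounded by the sum
    of the two. *)
Definition eelip : R := 4 * pi.

Lemma eelip_gt0 : 0 < eelip.
Proof. by rewrite mulr_gt0 ?pi_gt0. Qed.

Lemma ee_lip s t : cabs (ee s - ee t) <= eelip * `|s - t|.
Proof.
apply: le_trans (cabs_ReIm _) _; rewrite /=.
have h1 := @MVT_lip cos _ (@is_derive_cos R) (fun x => _) (2 * pi * s) (2 * pi * t).
have h2 := @MVT_lip sin _ (@is_derive_sin R) (@cos_max R) (2 * pi * s) (2 * pi * t).
have {}h1 := h1 ltac:(by move=> x; rewrite normrN sin_max).
move: h1 h2; rewrite -mulrBr normrM ger0_norm; last by rewrite mulr_ge0 ?pi_ge0.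
by rewrite /eelip; lra.
Qed.

Definition cint n h := seg n h ee 0 1.

Lemma cint_bound n h (M : R) : 0 <= M -> (forall w, cabs w = 1 -> cabs (h w) <= M) ->
  cabs (cint n h) <= M * eelip.
Proof.
move=> M0 H; rewrite -[eelip]mulr1; apply: seg_bound => // [t _|s t _ _].
  by apply: H; exact: cabs_ee.
exact: ee_lip.
Qed.

Lemma eq_cint n h h' : (forall w, cabs w = 1 -> h w = h' w) -> cint n h = cint n h'.
Proof. by move=> H; apply: eq_seg => // t _; apply: H; exact: cabs_ee. Qed.

Lemma cintZ n c h : cint n (fun w => c * h w) = c * cint n h.
Proof. exact: segZ. Qed.

Lemma cintB n h h' : cint n (fun w => h w - h' w) = cint n h - cint n h'.
Proof. exact: segB. Qed.

Lemma cintD n h h' : cint n (fun w => h w + h' w) = cint n h + cint n h'.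
Proof. exact: segD. Qed.

Lemma bsum_loop n f (G : R -> R -> C) : (forall s, G s 0 = G s 1) ->
  bsum n f G 0 0 1 = seg n f (G 1) 0 1 - seg n f (G 0) 0 1.
Proof.
move=> H; rewrite /bsum !add0r.
by rewrite (@eq_seg _ n f f (fun x => G x 1) (fun x => G x 0) 0 1) //; ring.
Qed.

(* Goursat for the contraction of the unit circle onto a small circle around z. *)
Lemma cint_punctured g z (B r : R) : cabs z < 1 -> 0 < r -> 0 <= B ->
  (forall w, cabs w <= 1 -> w != z -> exists d, cdiff g w d) ->
  (forall w, w != z -> cabs (w - z) < r -> cabs (g w) <= B) ->
  vanishes (fun n => cint n g).
Proof.
move=> z1 r0 B0 Hd Hb e e0.
have L0 := eelip_gt0.
(* The inner circle lies where [Hb] applies, stays inside the unit disk, and contributes at most e /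
   2, in this order. *)
pose eta := Num.min (Num.min (r / 2) (1 - cabs z)) (e / (2 * ((B + 1) * eelip))).
have Q0 : 0 < 2 * ((B + 1) * eelip) by apply: mulr_gt0 => //; apply: mulr_gt0 => //; lra.
have eta0 : 0 < eta.
  by rewrite !lt_min; apply/andP; split; [apply/andP; split; lra|exact: divr_gt0].
have etar : eta <= r / 2 by rewrite !ge_min lexx.
have etaz : eta <= 1 - cabs z by rewrite !ge_min lexx orbT.
have etae : eta <= e / (2 * ((B + 1) * eelip)) by rewrite !ge_min lexx !orbT.
(* [G s] is the circle with centre (1 - s) z and radius [a s]. It stays in the closed disk since |z|
   + [eta] <= 1, and it avoids z since [a s] > s |z|. *)
pose a (s : R) : R := (1 - s) * eta + s.
pose G (s t : R) : C := ((1 - s)%:C)%C * z + ((a s)%:C)%C * ee t.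
have z0 := cabs_ge0 z.
have Glip : lip2 (2 + eelip) G.
  move=> s t s' t' /andP[hs ht] /andP[hs' ht'].
  have -> : G s t - G s' t' = ((s' - s)%:C)%C * z + (((a s - a s')%:C)%C * ee t
     + ((a s')%:C)%C * (ee t - ee t')) by rewrite /G !rmorphB /=; ring.
  apply: le_trans (cabsD _ _) _; apply: le_trans (lerD (lexx _) (cabsD _ _)) _.
  rewrite !cabsM !cabs_real cabs_ee mulr1.
  have -> : a s - a s' = (s - s') * (1 - eta) by rewrite /a; ring.
  rewrite normrM [`|s' - s|]distrC.
  have h1 : `|s - s'| * cabs z <= `|s - s'| * 1 by apply: ler_wpM2l => //; lra.
  have h2 : `|s - s'| * `|1 - eta| <= `|s - s'| * 1.
    by apply: ler_wpM2l => //; rewrite ler_norml; lra.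
  have h3 : `|a s'| * cabs (ee t - ee t') <= 1 * (eelip * `|t - t'|).
    apply: ler_pM; rewrite ?normr_ge0 ?cabs_ge0 //; last exact: ee_lip.
    by rewrite /a ler_norml; apply/andP; split; nra.
  have := normr_ge0 (s - s'); have := normr_ge0 (t - t'); nra.
have Gin s t : sqr2 0 0 1 s t -> cabs (G s t) <= 1 /\ G s t != z.
  move=> /andP[hs ht]; split.
    apply: le_trans (cabsD _ _) _; rewrite !cabsM !cabs_real cabs_ee mulr1.
    have a0 : 0 <= a s by rewrite /a; nra.
    have h : (1 - s) * (cabs z + eta) <= (1 - s) * 1 by apply: ler_wpM2l; lra.
    by rewrite (ger0_norm a0) ger0_norm /a; lra.
  rewrite -subr_eq0 -cabs_gt0.
  have -> : G s t - z = ((a s)%:C)%C * ee t - (s%:C)%C * z.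
    by rewrite /G rmorphB /= rmorph1; ring.
  have := cabsB (((a s)%:C)%C * ee t) ((s%:C)%C * z).
  rewrite !cabsM !cabs_real cabs_ee mulr1.
  have a0 : 0 <= a s by rewrite /a; nra.
  by rewrite (ger0_norm a0) ger0_norm /a; [nra|lra].
have L2 : 0 <= 2 + eelip by lra.
have e2 : 0 < e / 2 by lra.
have Gd s t : sqr2 0 0 1 s t -> exists d, cdiff g (G s t) d.
  by case/Gin => *; exact: Hd.
have [N hN] := goursat L2 Glip Gd e2.
exists N => n /hN; rewrite bsum_loop; last by move=> s; rewrite /G ee01.
rewrite (@eq_seg _ n g g (G 1) ee 0 1) //; last first.
  by move=> t _; rewrite /G /a subrr !mul0r !add0r mul1r.
have : cabs (seg n g (G 0) 0 1) <= B * (eta * eelip * 1).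
  have GE t : G 0 t = z + (eta%:C)%C * ee t.
    by rewrite /G /a subr0 rmorph1 !mul1r addr0.
  apply: seg_bound => // [t ht|s t hs ht].
    have [_ h] := Gin 0 t ltac:(rewrite /sqr2; lra).
    apply: Hb => //; rewrite GE addrC addKr cabsM cabs_ee cabs_real mulr1 gtr0_norm //; lra.
  rewrite !GE (_ : _ - _ = (eta%:C)%C * (ee s - ee t)); last by ring.
  by rewrite cabsM cabs_real gtr0_norm // -mulrA ler_pM2l // ee_lip.
move: etae; rewrite ler_pdivlMr // /cint => he h1 h2.
have := cabsD (seg n g ee 0 1 - seg n g (G 0) 0 1) (seg n g (G 0) 0 1).
rewrite subrK.
have : eta * eelip >= 0 by rewrite mulr_ge0 // ltW.
lra.
Qed.

(** The discrete integral of dw / w. Dividing by it rather than by 2 pi i spares the computation of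
    its limit: a lower bound on its modulus is enough. *)
Definition cc n : C := cint n (fun w => w^-1).

(** The homotopy translates the unit circle to the one centred at z, on which the sum for 1 / (w -
    z) is exactly [cc n]. *)
Lemma cint_kernel z : cabs z < 1 ->
  vanishes (fun n => cint n (fun w => (w - z)^-1) - cc n).
Proof.
move=> z1 e e0.
pose G (s t : R) : C := (s%:C)%C * z + ee t.
have L0 := eelip_gt0.
have Glip : lip2 (1 + eelip) G.
  move=> s t s' t' _ _.
  have -> : G s t - G s' t' = ((s - s')%:C)%C * z + (ee t - ee t').
    by rewrite /G rmorphB /=; ring.
  apply: le_trans (cabsD _ _) _; rewrite cabsM cabs_real.
  have h1 : `|s - s'| * cabs z <= `|s - s'| * 1 by apply: ler_wpM2l => //; lra.
  have := ee_lip t t'; have := normr_ge0 (s - s'); have := normr_ge0 (t - t'); nra.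
have Gd s t : sqr2 0 0 1 s t -> exists d, cdiff (fun w => (w - z)^-1) (G s t) d.
  move=> /andP[hs ht]; exists (- (G s t - z) ^- 2 * (1 - 0)).
  apply: cdiff_comp; first exact: cdiffB (cdiff_id _) (cdiff_cst _ _).
  apply: cdiff_inv; rewrite -cabs_gt0.
  have -> : G s t - z = ee t - ((1 - s)%:C)%C * z.
    by rewrite /G rmorphB /= rmorph1; ring.
  have := cabsB (ee t) (((1 - s)%:C)%C * z).
  have := cabs_ge0 z.
  by rewrite cabsM cabs_real cabs_ee ger0_norm; [nra|lra].
have L2 : 0 <= 1 + eelip by lra.
have [N hN] := goursat L2 Glip Gd e0.
exists N => n /hN; rewrite bsum_loop; last by move=> s; rewrite /G ee01.
suff -> : seg n (fun w => (w - z)^-1) (G 1) 0 1 = cc n.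
  rewrite cabs_distrC /cint (@eq_seg _ n _ (fun w => (w - z)^-1) (G 0) ee 0 1) // => t _.
  by rewrite /G mul0r add0r.
have shift m a l : seg m (fun w => (w - z)^-1) (G 1) a l = seg m (fun w => w^-1) ee a l.
  elim: m a l => [|m IH] a l /=; last by rewrite !IH.
  rewrite /trap /G mul1r.
  have E u : z + u - z = u by rewrite addrC addKr.
  by rewrite !E; ring.
exact: shift.
Qed.

(** For p and q on the circle, (1/p + 1/q)(q - p)/2 is i times the sine of the angle from p to q, so
    all 2^n terms are equal. *)
Lemma ccE n : cc n = 'i%C * (2 ^+ n * sin (2 * pi / 2 ^+ n))%:C%C.
Proof.
suff H m a l : seg m (fun w => w^-1) ee a l = 'i%C * (2 ^+ m * sin (2 * pi * l / 2 ^+ m))%:C%C.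
  by rewrite /cc /cint H mulr1.
elim: m a l => [|m IH] a l /=; last first.
  rewrite !IH -mulrDr -rmorphD /=; congr (_ * (_%:C)%C).
  rewrite exprS (_ : 2 * pi * (l / 2) / 2 ^+ m = 2 * pi * l / (2 * 2 ^+ m)); first by ring.
  by field; rewrite ?expf_neq0 //=; lra.
rewrite !expr0 mul1r divr1 /trap.
have inv t : (ee t)^-1 = (cos (2 * pi * t) -i* sin (2 * pi * t))%C.
  rewrite /ee (_ : (_ +i* _)%C^-1 = ((cos (2 * pi * t) / (cos (2 * pi * t) ^+ 2 + sin (2 * pi * t) ^+ 2)) -i* (sin (2 * pi * t) / (cos (2 * pi * t) ^+ 2 + sin (2 * pi * t) ^+ 2)))%C) //.
  by rewrite cos2Dsin2 !divr1.
have -> : 2 * pi * l = 2 * pi * (a + l) - 2 * pi * a by ring.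
rewrite sinB !inv /ee.
set x := 2 * pi * (a + l); set y := 2 * pi * a.
have hx := cos2Dsin2 x; have hy := cos2Dsin2 y.
have two0 : (2 : C) != 0 by rewrite pnatr_eq0.
rewrite mulrAC; apply: (mulIf two0); rewrite divfK // mulr_natr mulr2n.
apply/eqP; rewrite eq_complex; simpc => /=.
by apply/andP; split; apply/eqP; lra.
Qed.

(** The modulus does not decrease with n, since sin 2x <= 2 sin x when sin x >= 0, and at n = 2 it
    is 4 sin(pi/2). *)
Lemma cc_ge4 n : (2 <= n)%N -> 4 <= cabs (cc n).
Proof.
move=> n2; rewrite ccE cabsM cabs_real.
rewrite (_ : cabs _ = 1) ?mul1r; last by rewrite cabsE /= expr0n expr1n add0r sqrtr1.
apply: le_trans (ler_norm _).
have H k : 0 <= sin (2 * pi / 2 ^+ k.+2) :> R /\ 4 <= 2 ^+ k.+2 * sin (2 * pi / 2 ^+ k.+2) :> R.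
  have p0 := pi_gt0 R.
  elim: k => [|k [IH0 IH]].
    have E0 : 2 * pi / 2 ^+ 2 = pi / 2 :> R by field.
    by rewrite E0 sin_pihalf expr2; split; lra.
  have E : 2 * pi / 2 ^+ k.+2 = 2 * pi / 2 ^+ k.+3 + 2 * pi / 2 ^+ k.+3 :> R.
    by rewrite [2 ^+ k.+3]exprS; field; rewrite ?expf_neq0 //=; lra.
  have s0 : 0 <= sin (2 * pi / 2 ^+ k.+3) :> R.
    apply: sin_ge0_pi; apply/andP; split.
      by rewrite divr_ge0 ?exprn_ge0 // mulr_ge0 // ltW.
    rewrite ler_pdivrMr ?exprn_gt0 // mulrC; apply: ler_wpM2l; first exact: ltW.
    by rewrite exprS -[leLHS]mulr1 ler_wpM2l // exprn_ege1 //; lra.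
  split=> //; apply: le_trans IH _.
  rewrite E sinD; have e3 : 2 ^+ k.+3 = 2 * 2 ^+ k.+2 :> R by rewrite exprS.
  have := cos_le1 (2 * pi / 2 ^+ k.+3 : R).
  have : 0 <= 2 ^+ k.+2 :> R by rewrite exprn_ge0.
  move=> h1 h2.
  have : 2 ^+ k.+2 * (sin (2 * pi / 2 ^+ k.+3) * cos (2 * pi / 2 ^+ k.+3)) <= 2 ^+ k.+2 * (sin (2 * pi / 2 ^+ k.+3) * 1) :> R.
    by rewrite !ler_wpM2l.
  move=> h3; rewrite [leRHS](_ : _ = 2 * (2 ^+ k.+2 * sin (2 * pi / 2 ^+ k.+3))); [lra|by rewrite {1}e3 mulrA].
by case: n n2 => [|[|n]] // _; have [] := H n.
Qed.

End Circle.

Local Opaque cder.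

(** * Cauchy formula and estimates on the closed unit disk *)

Section CauchyFormula.
Context {R : realType}.
Local Notation C := (CC R).
Implicit Types (f g h F : C -> C) (z w : C).

Definition cdisk F := forall w, cabs w <= 1 -> exists d, cdiff F w d.

Definition approx F n z : C := cint n (fun w => F w * (w - z)^-1) / cc n.

Lemma circle_sub z w : cabs w = 1 -> 1 - cabs z <= cabs (w - z).
Proof. by move=> w1; have := cabsB w z; rewrite w1. Qed.

Lemma cc_neq0 n : (2 <= n)%N -> cc n != 0 :> C.
Proof. by move=> /(@cc_ge4 R); rewrite -cabs_gt0; lra. Qed.

(** The factor pi is the length bound 4 pi divided by the lower bound 4 for |[cc n]|. *)
Lemma cint_div_bound n h (M : R) : (2 <= n)%N -> 0 <= M ->
  (forall w, cabs w = 1 -> cabs (h w) <= M) -> cabs (cint n h / cc n) <= M * pi.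
Proof.
move=> n2 M0 H; rewrite cabsM cabsV ler_pdivrMr; last by have := @cc_ge4 R _ n2; lra.
apply: le_trans (cint_bound n M0 H) _; rewrite /eelip -mulrA; apply: ler_wpM2l => //.
by rewrite mulrC; apply: ler_wpM2l; rewrite ?pi_ge0 ?cc_ge4.
Qed.

Definition slope F z w : C := (F w - F z) * (w - z)^-1.

Lemma slope_cdiff F z w d : w != z -> cdiff F w d -> exists d', cdiff (slope F z) w d'.
Proof.
move=> wz H; eexists; apply: cdiffM; first exact: cdiffB H (cdiff_cst _ _).
apply: cdiff_comp; first exact: cdiffB (cdiff_id _) (cdiff_cst _ _).
by apply: cdiff_inv; rewrite subr_eq0.
Qed.

(** The singularity at z is removable: the quotient is bounded near z, which is all that
    [cint_punctured] asks there. *)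
Lemma cint_slope F z : cdisk F -> cabs z < 1 -> vanishes (fun n => cint n (slope F z)).
Proof.
move=> HF z1; have [d hd] := HF z (ltW z1).
have [r r0 hr] := cdiff_lip hd.
have d0 : 0 <= cabs d + 1 by have := cabs_ge0 d; lra.
apply: (@cint_punctured _ _ z (cabs d + 1) r) => // [w w1 wz|w wz wr].
  by have [d' hd'] := HF w w1; exact: slope_cdiff hd'.
rewrite cabsM cabsV ler_pdivrMr ?cabs_gt0 ?subr_eq0 //; exact: hr.
Qed.

Lemma approx_split F n z : cabs z < 1 -> (2 <= n)%N ->
  approx F n z - F z =
  (cint n (slope F z) + F z * (cint n (fun w => (w - z)^-1) - cc n)) / cc n.
Proof.
move=> z1 n2; have c0 := cc_neq0 n2.
rewrite /approx (@eq_cint _ _ _ (fun w => slope F z w + F z * (w - z)^-1)).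
  by rewrite cintD cintZ; field.
by move=> w _; rewrite /slope; ring.
Qed.

Lemma approx_cvg F z : cdisk F -> cabs z < 1 -> vanishes (fun n => approx F n z - F z).
Proof.
move=> HF z1.
have hv : vanishes (fun n => cint n (slope F z) + F z * (cint n (fun w => (w - z)^-1) - cc n)).
  apply: vanishesD; first exact: cint_slope.
  apply: (@vanishes_le _ _ _ (cabs (F z)) 0 (cint_kernel z1)) => n _.
  by rewrite cabsM.
apply: (@vanishes_le _ _ _ 1 2 hv) => n n2; rewrite approx_split // cabsM cabsV mulrC.
apply: ler_wpM2r; first exact: cabs_ge0.
by have := @cc_ge4 R _ n2 => c4; rewrite invf_le1; lra.
Qed.

(** For k = 1, 2, 3 these are the discrete Cauchy integrals for F, F' and F''/2. *)
Definition kernelint F k n z : C := cint n (fun w => F w * (w - z)^-1 ^+ k) / cc n.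

Lemma kernelint_bound F k n z (M q : R) : (2 <= n)%N -> 0 <= M -> 0 < q ->
  (forall w, cabs w = 1 -> cabs (F w) <= M) -> q <= 1 - cabs z ->
  cabs (kernelint F k n z) <= M / q ^+ k * pi.
Proof.
move=> n2 M0 q0 HM hq; apply: cint_div_bound => //.
  by rewrite divr_ge0 // exprn_ge0 // ltW.
move=> w w1; rewrite cabsM cabsX cabsV; apply: ler_pM; rewrite ?exprn_ge0 ?invr_ge0 ?cabs_ge0 ?HM //.
rewrite -exprVn; apply: lerXn2r; rewrite ?nnegrE ?invr_ge0 ?cabs_ge0 ?(ltW q0) //.
have := circle_sub z w1 => h; rewrite lef_pV2 ?posrE //; lra.
Qed.

(** The remainders are explicit, with kernels 1 / ((w - z)^2 (w - z')) and ((w - z) + 2 (w - z')) /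
    ((w - z)^3 (w - z')^2). All distances are at least q and the last numerator is at most 6, so the
    bounds are uniform in n, as [cdiff_limit] requires. *)
Lemma kernelint_taylor F n z z' (M q : R) : (2 <= n)%N -> 0 <= M -> 0 < q ->
  (forall w, cabs w = 1 -> cabs (F w) <= M) -> cabs z <= 1 - 2 * q -> cabs (z' - z) < q ->
  cabs (kernelint F 1 n z' - kernelint F 1 n z - kernelint F 2 n z * (z' - z))
     <= M / q ^+ 3 * pi * cabs (z' - z) ^+ 2 /\
  cabs (kernelint F 2 n z' - kernelint F 2 n z - 2 * kernelint F 3 n z * (z' - z))
     <= 6 * M / q ^+ 5 * pi * cabs (z' - z) ^+ 2.
Proof.
move=> n2 M0 q0 HM hz hz'.
have c0 := cc_neq0 n2.
have hz2 : cabs z' <= 1 - q by have := cabsD (z' - z) z; rewrite subrK; lra.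
have key w : cabs w = 1 -> [/\ q <= cabs (w - z), q <= cabs (w - z'), w - z != 0 & w - z' != 0].
  by move=> w1; have := circle_sub z w1; have := circle_sub z' w1 => h1 h2;
    rewrite -!cabs_gt0; split; lra.
have z0 := cabs_ge0 z; have z'0 := cabs_ge0 z'.
have q3 : 0 < q ^+ 3 by rewrite exprn_gt0.
have q5 : 0 < q ^+ 5 by rewrite exprn_gt0.
have inv_le (x : R) : q <= x -> 0 <= x^-1 <= q^-1.
  by move=> qx; rewrite invr_ge0 lef_pV2 ?posrE; lra.
split.
- have -> : kernelint F 1 n z' - kernelint F 1 n z - kernelint F 2 n z * (z' - z) =
    (z' - z) ^+ 2 * (cint n (fun w => F w * ((w - z)^-1 ^+ 2 * (w - z')^-1)) / cc n).
    rewrite /kernelint mulrA -cintZ -!mulrBl [_ / cc n * _]mulrAC -mulrBl; congr (_ / _).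
    rewrite [cint _ _ * _]mulrC -cintZ -!cintB; apply: eq_cint => w /key[_ _ h1 h2].
    by field; rewrite ?h1 ?h2.
  rewrite cabsM cabsX mulrC; apply: ler_wpM2r; first by rewrite exprn_ge0 ?cabs_ge0.
  apply: cint_div_bound => //; first by rewrite divr_ge0 // ltW.
  move=> w w1; have [h1 h2 _ _] := key w w1.
  rewrite 2!cabsM cabsX !cabsV; apply: ler_pM; rewrite ?HM ?cabs_ge0 //.
    by rewrite mulr_ge0 ?exprn_ge0 ?invr_ge0 ?cabs_ge0.
  rewrite -exprVn [q^-1 ^+ 3]exprSr; have /andP[g1 g2] := inv_le _ h1; have /andP[g3 g4] := inv_le _ h2.
  apply: ler_pM => //; first exact: exprn_ge0.
  by apply: lerXn2r; rewrite ?nnegrE // (le_trans g1).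
- have -> : kernelint F 2 n z' - kernelint F 2 n z - 2 * kernelint F 3 n z * (z' - z) =
    (z' - z) ^+ 2 * (cint n (fun w => F w * (((w - z) + 2 * (w - z')) * ((w - z)^-1 ^+ 3 * (w - z')^-1 ^+ 2))) / cc n).
    rewrite /kernelint mulrA -cintZ -!mulrBl mulrA -cintZ [_ / cc n * _]mulrAC -mulrBl; congr (_ / _).
    rewrite [cint _ _ * _]mulrC -cintZ -!cintB; apply: eq_cint => w /key[_ _ h1 h2].
    by field; rewrite ?h1 ?h2.
  rewrite cabsM cabsX mulrC; apply: ler_wpM2r; first by rewrite exprn_ge0 ?cabs_ge0.
  apply: cint_div_bound => //; first by rewrite divr_ge0 ?mulr_ge0 // ltW.
  move=> w w1; have [h1 h2 _ _] := key w w1.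
  rewrite 3!cabsM !cabsX !cabsV (_ : 6 * M / q ^+ 5 = M * (6 * q^-1 ^+ 5)); last by rewrite exprVn; ring.
  apply: ler_pM; rewrite ?HM ?cabs_ge0 //.
    by rewrite !mulr_ge0 ?exprn_ge0 ?invr_ge0 ?cabs_ge0.
  have /andP[g1 g2] := inv_le _ h1; have /andP[g3 g4] := inv_le _ h2.
  apply: ler_pM; rewrite ?cabs_ge0 ?mulr_ge0 ?exprn_ge0 //.
    apply: le_trans (cabsD _ _) _; rewrite cabsM cabs_nat.
    by have := cabs_subl w z; have := cabs_subl w z'; rewrite w1; lra.
  rewrite (_ : q^-1 ^+ 5 = q^-1 ^+ 3 * q^-1 ^+ 2); last by rewrite -exprD.
  apply: ler_pM; try exact: exprn_ge0.
    by apply: lerXn2r; rewrite ?nnegrE // (le_trans g1).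
  by apply: lerXn2r; rewrite ?nnegrE // (le_trans g3).
Qed.

Lemma approxE F n z : approx F n z = kernelint F 1 n z.
Proof. by rewrite /approx /kernelint; congr (_ / _); apply: eq_cint => w _; rewrite expr1. Qed.

(** Points with |F| > n would accumulate in the closed disk, against continuity at the limit. *)
Lemma cdisk_bounded F : cdisk F -> exists2 M : R, 0 <= M & forall w, cabs w <= 1 -> cabs (F w) <= M.
Proof.
move=> HF; apply: contrapT => H.
have /choice[x hx] : forall n : nat, exists w, cabs w <= 1 /\ n%:R < cabs (F w).
  move=> n; apply: contrapT => Hn; apply: H; exists n%:R => // w w1.
  by rewrite leNgt; apply/negP => h; apply: Hn; exists w.
have [sg [l [sgi hl]]] := complex_bolzano_weierstrass (fun n => (hx n).1).
have l1 : cabs l <= 1.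
  apply/ler_addgt0Pl => e e0; have [N hN] := hl _ e0.
  have := hN N (leqnn _); have := (hx (sg N)).1; have := cabs_subl (x (sg N)) (x (sg N) - l).
  by rewrite opprB addrC subrK; lra.
have [d hd] := HF l l1; have [r r0 hr] := cdiff_cont hd (@ltr01 R).
have r2 : 0 < r / 2 by lra.
have [N hN] := hl _ r2.
have [k hk] : exists k : nat, cabs (F l) + 1 <= k%:R.
  by exists (Num.bound (cabs (F l) + 1)); apply/ltW; apply: archi_boundP; have := cabs_ge0 (F l); lra.
pose n := maxn N k.
have sgN m : (m <= sg m)%N by elim: m => // j IH; apply: leq_ltn_trans IH _; exact: sgi.
have := hN n (leq_maxl _ _); have := (hx (sg n)).2.
have : k%:R <= (sg n)%:R :> R by rewrite ler_nat (leq_trans (leq_maxr _ _) (sgN n)).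
move=> h1 h2 h3; have := hr (x (sg n)) ltac:(lra).
by have := cabsB (F (x (sg n))) (F l); lra.
Qed.

(** [cdiff_limit] is applied twice: orders 1 and 2 of [kernelint] identify [cder F] as the limit of
    order 2, and orders 2 and 3 differentiate that limit again. *)
Theorem cdisk_cder F z : cdisk F -> cabs z < 1 -> exists d, cdiff (cder F) z d.
Proof.
move=> HF z1; have [M M0 HM] := cdisk_bounded HF.
have HM1 w : cabs w = 1 -> cabs (F w) <= M by move=> w1; apply: HM; rewrite w1.
have D1 z' : cabs z' < 1 -> vanishes (fun n => kernelint F 2 n z' - cder F z').
  move=> z'1; pose q := (1 - cabs z') / 2; have q0 : 0 < q by rewrite /q; lra.
  have q3 : 0 < q ^+ 3 by rewrite exprn_gt0.
  have [||w wr|n w n2 wr|n n2|d [h1 _ h2]] := @cdiff_limit _ (fun n => kernelint F 1 n) F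
    (fun n => kernelint F 2 n z') z' q (M / q ^+ 3 * pi) (M / q ^+ 2 * pi) 2 => //.
  - by rewrite mulr_ge0 ?pi_ge0 // divr_ge0 // ltW.
  - have w1 : cabs w < 1 by have := cabsD (w - z') z'; rewrite subrK /q in wr *; lra.
    apply: (@vanishes_le _ _ _ 1 0 (approx_cvg HF w1)) => n _.
    by rewrite approxE mul1r.
  - by have [] := @kernelint_taylor F n z' w M q n2 M0 q0 HM1 ltac:(rewrite /q; lra) wr.
  - by apply: kernelint_bound => //; rewrite /q; lra.
  by rewrite (cdiff_cder h1).
pose q := (1 - cabs z) / 2; have q0 : 0 < q by rewrite /q; lra.
have q5 : 0 < q ^+ 5 by rewrite exprn_gt0.
have [||w wr|n w n2 wr|n n2|d [h1 _ h2]] := @cdiff_limit _ (fun n => kernelint F 2 n) (cder F)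
    (fun n => 2 * kernelint F 3 n z) z q (6 * M / q ^+ 5 * pi) (2 * (M / q ^+ 3 * pi)) 2 => //.
- by rewrite !mulr_ge0 ?pi_ge0 // invr_ge0 ltW.
- by apply: D1; have := cabsD (w - z) z; rewrite subrK /q in wr *; lra.
- by have [] := @kernelint_taylor F n z w M q n2 M0 q0 HM1 ltac:(rewrite /q; lra) wr.
- rewrite cabsM cabs_nat; apply: ler_wpM2l => //.
  by apply: kernelint_bound => //; rewrite /q; lra.
by exists d.
Qed.

(** The constant 4 pi is pi / q^2 with q = 1/2; it is not sharp, but it is absolute. *)
Theorem cdisk_estimate F (M : R) : cdisk F -> (forall w, cabs w = 1 -> cabs (F w) <= M) ->
  cabs (cder F 0) <= M * (4 * pi).
Proof.
move=> HF HM.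
have M0 : 0 <= M by apply: le_trans (HM 1 _); rewrite ?cabs_ge0 ?cabs1.
pose q : R := 1 / 2; have q0 : 0 < q by rewrite /q; lra.
have z00 : cabs (0 : C) = 0 by rewrite cabs0.
have q3 : 0 < q ^+ 3 by rewrite exprn_gt0.
have [||w wr|n w n2 wr|n n2|d [h1 h2 _]] := @cdiff_limit _ (fun n => kernelint F 1 n) F
    (fun n => kernelint F 2 n 0) 0 q (M / q ^+ 3 * pi) (M / q ^+ 2 * pi) 2 => //.
- by rewrite mulr_ge0 ?pi_ge0 // divr_ge0 // ltW.
- have w1 : cabs w < 1 by rewrite subr0 /q in wr; lra.
  apply: (@vanishes_le _ _ _ 1 0 (approx_cvg HF w1)) => n _.
  by rewrite approxE mul1r.
- by have [] := @kernelint_taylor F n 0 w M q n2 M0 q0 HM ltac:(rewrite /q z00; lra) wr.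
- by apply: kernelint_bound => //; rewrite /q z00; lra.
rewrite (cdiff_cder h1); apply: le_trans h2 _.
by rewrite (_ : M / q ^+ 2 * pi = M * (4 * pi)) // /q; field.
Qed.

End CauchyFormula.

(** * Holomorphic functions on the open disk *)

Section Holomorphic.
Context {R : realType}.
Local Notation C := (CC R).
Implicit Types (f g h : cfun R) (z w : C).

Lemma holo_cdiff f z : holo f -> disk z -> cdiff f z (cder f z).
Proof. by move=> hf hz; apply: derivable_cdiff; exact: hf. Qed.

Lemma cdiff_holo f (d : C -> C) : (forall z, disk z -> cdiff f z (d z)) -> holo f.
Proof. by move=> H z /H; exact: cdiff_derivable. Qed.

Definition rescale f (z : C) (r : R) : C -> C := fun w => f (z + (r%:C)%C * w).

Lemma rescale_cdiff f z r w d : cdiff f (z + (r%:C)%C * w) d ->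
  cdiff (rescale f z r) w (d * (r%:C)%C).
Proof.
move=> H; apply: (@cdiff_comp _ (fun w => z + (r%:C)%C * w)) => //.
have := cdiffD (cdiff_cst z w) (cdiffZ (r%:C)%C (cdiff_id w)).
by rewrite add0r mulr1.
Qed.

Lemma rescale_disk z w (r : R) : 0 < r -> cabs w <= 1 -> cabs z + r < 1 ->
  disk (z + (r%:C)%C * w).
Proof.
move=> r0 w1 zr; rewrite /disk /=; apply: le_lt_trans (cabsD _ _) _.
by rewrite cabsM cabs_real gtr0_norm //; nra.
Qed.

Lemma rescale_cdisk f z r : holo f -> 0 < r -> cabs z + r < 1 -> cdisk (rescale f z r).
Proof.
move=> hf r0 zr w w1; eexists; apply: rescale_cdiff.
by apply: holo_cdiff => //; exact: rescale_disk.
Qed.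

Lemma cder_rescale f z r w : holo f -> 0 < r -> cabs z + r < 1 -> cabs w <= 1 ->
  cder (rescale f z r) w = cder f (z + (r%:C)%C * w) * (r%:C)%C.
Proof.
move=> hf r0 zr w1; apply: cdiff_cder; apply: rescale_cdiff.
by apply: holo_cdiff => //; exact: rescale_disk.
Qed.

(** Near z the derivative is, up to a constant factor, that of a rescaling to the closed unit disk
    composed with the inverse affine map [a], so [cdisk_cder] applies. *)
Theorem holo_cder f : holo f -> holo (cder f).
Proof.
move=> hf z hz; pose r := (1 - cabs z) / 2.
have hz' : cabs z < 1 by [].
have r0 : 0 < r by rewrite /r; lra.
have zr : cabs z + r < 1 by rewrite /r; lra.
have rc : (r%:C)%C != 0 :> C by rewrite -cabs_gt0 cabs_real gtr0_norm.
have z01 : cabs (0 : C) < 1 by rewrite cabs0.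
have [d hd] := cdisk_cder (rescale_cdisk hf r0 zr) z01.
pose a w : C := (w - z) / (r%:C)%C.
have ha : cdiff a z (r%:C)%C^-1.
  have := cdiffM (cdiffB (cdiff_id z) (cdiff_cst z z)) (cdiff_cst (r%:C)%C^-1 z).
  by rewrite mulr0 addr0 subr0 mul1r.
have a0 : a z = 0 by rewrite /a subrr mul0r.
have hd' : cdiff (cder (rescale f z r)) (a z) d by rewrite a0.
have := cdiffZ ((r%:C)%C^-1) (cdiff_comp ha hd').
move=> H; apply: (@cdiff_derivable _ _ _ ((r%:C)%C^-1 * (d * (r%:C)%C^-1))).
apply: (cdiff_ext r0 _ H) => w wr; rewrite cder_rescale //.
  by rewrite /a [_ * (_ / _)]mulrC divfK // addrC subrK mulrC mulfK.
rewrite /a cabsM cabsV cabs_real gtr0_norm // ler_pdivrMr //; lra.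
Qed.

Theorem cauchy_estimate f z (r M : R) : holo f -> 0 < r -> cabs z + r < 1 ->
  (forall w, cabs (w - z) <= r -> cabs (f w) <= M) -> cabs (cder f z) <= 4 * pi * M / r.
Proof.
move=> hf r0 zr HM; rewrite ler_pdivlMr //.
have := @cdisk_estimate _ (rescale f z r) M (rescale_cdisk hf r0 zr).
rewrite cder_rescale // ?cabs0 // mulr0 addr0 cabsM cabs_real gtr0_norm // [M * _]mulrC.
apply=> w w1; apply: HM; rewrite addrC addKr cabsM w1 mulr1 cabs_real gtr0_norm //.
Qed.

Lemma holoM f g : holo f -> holo g -> holo (fun w => f w * g w).
Proof. by move=> hf hg z hz; apply: cdiff_derivable; apply: cdiffM; exact: holo_cdiff. Qed.

Lemma holo_comp f (phi : cfun R) : holo f -> selfmap phi -> holo (fun w => f (phi w)).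
Proof.
move=> hf [hp hs] z hz; apply: cdiff_derivable; apply: cdiff_comp; first exact: holo_cdiff.
by apply: holo_cdiff => //; exact: hs.
Qed.

Lemma disk_open z : disk z -> exists2 r : R, 0 < r & forall w, cabs (w - z) < r -> disk w.
Proof.
rewrite /disk /= => hz; exists (1 - cabs z) => [|w hw]; first lra.
by have := cabsD (w - z) z; rewrite subrK /=; lra.
Qed.

(** Functions are total, but identities such as the linearity of a compact operator are known on the
    disk only; since the disk is open, derivatives do not see the values outside. *)
Lemma cder_ext f g z : disk z -> (forall w, disk w -> f w = g w) -> holo f -> cder g z = cder f z.
Proof.
move=> hz E hf; apply: cdiff_cder; have [r r0 h] := disk_open hz.
by apply: cdiff_ext r0 _ (holo_cdiff hf hz) => w /h; exact: E.
Qed.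

Lemma cder2_ext f g z : disk z -> (forall w, disk w -> f w = g w) -> holo f ->
  cder (cder g) z = cder (cder f) z.
Proof.
move=> hz E hf; apply: (@cder_ext (cder f) (cder g) z hz _ (holo_cder hf)).
by move=> w hw; rewrite (cder_ext hw E hf).
Qed.

Lemma cder_lin f g (a : C) z : holo f -> holo g -> disk z ->
  cder (fun w => f w + a * g w) z = cder f z + a * cder g z.
Proof.
move=> hf hg hz; apply: cdiff_cder; apply: cdiffD; first exact: holo_cdiff.
by apply: cdiffZ; exact: holo_cdiff.
Qed.

Lemma holo_lin f g (a : C) : holo f -> holo g -> holo (fun w => f w + a * g w).
Proof.
move=> hf hg z hz; apply: cdiff_derivable; apply: cdiffD; first exact: holo_cdiff.
by apply: cdiffZ; exact: holo_cdiff.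
Qed.

Lemma cder2_lin f g (a : C) z : holo f -> holo g -> disk z ->
  cder (cder (fun w => f w + a * g w)) z = cder (cder f) z + a * cder (cder g) z.
Proof.
move=> hf hg hz; have hf' := holo_cder hf; have hg' := holo_cder hg.
have E w : disk w -> (fun w => cder f w + a * cder g w) w = cder (fun w => f w + a * g w) w.
  by move=> hw; rewrite (cder_lin a hf hg hw).
apply: (etrans (cder_ext hz E (holo_lin (a := a) hf' hg'))).
exact: (cder_lin a hf' hg' hz).
Qed.

End Holomorphic.

(** * A mean value inequality along segments *)

Section MeanValue.
Context {R : realType}.
Local Notation C := (CC R).
Implicit Types (f : cfun R) (z w : C).

(** The mean value equality fails for complex values, so the inequality is bisected: if it fails
    with constant M + e' on an interval, it fails on a half, and the common point contradicts
    differentiability there. *)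
Lemma mean_value (f : C -> C) (a b : C) (M : R) :
  (forall t : R, 0 <= t <= 1 -> exists d, cdiff f (a + (t%:C)%C * (b - a)) d /\ cabs d <= M) ->
  cabs (f b - f a) <= M * cabs (b - a).
Proof.
move=> H; apply/ler_addgt0Pl => e e0.
pose D := cabs (b - a); have D0 : 0 <= D by exact: cabs_ge0.
pose e' := e / (D + 1); have e'0 : 0 < e' by rewrite divr_gt0 //; lra.
pose g (t : R) := a + (t%:C)%C * (b - a).
have gE t : a + (t%:C)%C * (b - a) = g t by [].
have g0 : g 0 = a by rewrite /g mul0r addr0.
have g1 : g 1 = b by rewrite /g mul1r addrC subrK.
have gB s t : g s - g t = ((s - t)%:C)%C * (b - a) by rewrite /g rmorphB /=; ring.
clearbody g.
have gD s t : cabs (g s - g t) = `|s - t| * D by rewrite gB cabsM cabs_real.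
pose good (t l : R) := cabs (f (g (t + l)) - f (g t)) <= (M + e') * (l * D).
suff : good 0 1.
  rewrite /good add0r g1 g0.
  have : e' * D <= e by rewrite /e' mulrAC ler_pdivrMr; [nra|lra].
  by rewrite -/D mul1r; lra.
apply: contrapT => bad0.
pose Bad (x : R * R) := [/\ 0 <= x.1, 0 <= x.2, x.1 + x.2 <= 1 & ~ good x.1 x.2].
have step (x : R * R) : exists x' : R * R, Bad x ->
   Bad x' /\ [/\ x'.2 = x.2 / 2 & x.1 <= x'.1 <= x.1 + x.2 / 2].
  case: x => t l; rewrite /Bad /=.
  have [[t0 l0 tl hb]|nB] := pselect [/\ 0 <= t, 0 <= l, t + l <= 1 & ~ good t l]; last by exists (t, l).
  have [h1|h1] := pselect (good t (l / 2)); last by exists (t, l / 2) => _ /=; split; split => //; lra.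
  have [h2|h2] := pselect (good (t + l / 2) (l / 2)); last first.
    by exists (t + l / 2, l / 2) => _ /=; split; split => //; lra.
  case: hb; move: h1 h2; rewrite /good half_add => h1 h2.
  have -> : f (g (t + l)) - f (g t) = (f (g (t + l)) - f (g (t + l / 2))) + (f (g (t + l / 2)) - f (g t)) by ring.
  by apply: le_trans (cabsD _ _) _; lra.
have [nx Hnx] := choice step.
pose X k := iter k nx (0, 1).
have XB k : Bad (X k).
  elim: k => [|k IH]; first by split => //=; lra.
  by have [] := Hnx _ IH.
have X2 k : (X k).2 = 2^-1 ^+ k.
  elim: k => [|k IH]; first by rewrite expr0.
  by have [_ [->]] := Hnx _ (XB k); rewrite IH exprSr.
have l0 k : 0 <= (X k).2 by rewrite X2 exprn_ge0.
have Xs k : (X k).1 <= (X k.+1).1 /\ (X k.+1).1 + (X k.+1).2 <= (X k).1 + (X k).2.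
  by have [_ [/= -> ]] := Hnx _ (XB k); lra.
have [s hs] := nested_halving (fun k => (Xs k).1) (fun k => (Xs k).2) l0.
have s01 : 0 <= s <= 1 by have := hs 0%N; rewrite /= add0r.
have [d [hd dM]] := H s s01; rewrite gE in hd.
have [r r0 hr] := hd e' e'0.
have [k hk] : exists k, 2^-1 ^+ k < r / (D + 1) :> R.
  have q0 : 0 < r / (D + 1) by rewrite divr_gt0 //; lra.
  have : ((fun k => 2^-1 ^+ k : R) @ \oo --> (0 : R))%classic.
    by apply: cvg_expr; rewrite gtr0_norm; lra.
  move=> /cvgrPdist_lt /(_ _ q0)[k _ hk]; exists k.
  by have := hk k (leqnn k); rewrite /= sub0r normrN ger0_norm // exprn_ge0.
have [t0 l00 tl] := XB k; apply; rewrite /good.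
set t := (X k).1 in t0 tl *; set l := (X k).2 in l00 tl *.
have hst : t <= s <= t + l := hs k.
have small x : t <= x <= t + l -> cabs (g x - g s) < r.
  move=> hx; rewrite gD.
  move: hk; rewrite ltr_pdivlMr; last lra.
  rewrite -X2 -/l => hk.
  have h1 : `|x - s| <= l by rewrite ler_norml; lra.
  have : `|x - s| * D <= l * D by apply: ler_wpM2r.
  lra.
have a1 := hr _ (small (t + l) ltac:(lra)); have a2 := hr _ (small t ltac:(lra)).
rewrite gD ger0_norm in a1; last lra.
rewrite gD distrC ger0_norm in a2; last lra.
have -> : f (g (t + l)) - f (g t) = (f (g (t + l)) - f (g s) - d * (g (t + l) - g s)) -
   (f (g t) - f (g s) - d * (g t - g s)) + d * (g (t + l) - g t) by ring.
apply: le_trans (cabsD _ _) _; apply: le_trans (lerD (cabs_subl _ _) (lexx _)) _.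
rewrite cabsM gD ger0_norm; last lra.
have : cabs d * ((t + l - t) * D) <= M * ((t + l - t) * D).
  by apply: ler_wpM2r => //; rewrite mulr_ge0 //; lra.
lra.
Qed.

Lemma mean_value_disk f (a b : C) (q M : R) : holo f -> q < 1 -> cabs a <= q -> cabs b <= q ->
  (forall w, cabs w <= q -> cabs (cder f w) <= M) -> cabs (f b - f a) <= M * cabs (b - a).
Proof.
move=> hf q1 ha hb HM; apply: mean_value => t ht.
have h : cabs (a + (t%:C)%C * (b - a)) <= q.
  have -> : a + (t%:C)%C * (b - a) = ((1 - t)%:C)%C * a + (t%:C)%C * b.
    by rewrite rmorphB /= rmorph1; ring.
  apply: le_trans (cabsD _ _) _; rewrite !cabsM !cabs_real !ger0_norm; try lra; nra.
exists (cder f (a + (t%:C)%C * (b - a))); split; last exact: HM.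
by apply: holo_cdiff => //; rewrite /disk /=; lra.
Qed.

End MeanValue.

(** * Weighted norms and growth in the unit ball of the Bloch-type space *)

Section Norms.
Context {R : realType}.
Local Notation C := (CC R).
Implicit Types (f g h u phi : cfun R) (z w : C).

Lemma disk0 : disk (0 : C). Proof. by rewrite /disk /= cabs0. Qed.

Lemma wsup_leP (a M : R) g :
  (wsup a g <= M%:E)%E <-> (forall z, disk z -> wt a z * cabs (g z) <= M).
Proof.
split=> [H z hz|H].
  by rewrite -lee_fin; apply: le_trans H; apply: ereal_sup_ubound; exists z.
by apply: ge_ereal_sup => _ [z hz <-]; rewrite lee_fin; exact: H.
Qed.

Lemma wt_ge0 (a : R) z : 0 <= wt a z. Proof. exact: powR_ge0. Qed.

Lemma wsup_ge0 (a : R) g : (0 <= wsup a g)%E.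
Proof.
apply: (@le_trans _ _ (wt a 0 * cabs (g 0))%:E); last first.
  by apply: ereal_sup_ubound; exists 0 => //; exact: disk0.
by rewrite lee_fin mulr_ge0 ?wt_ge0 ?cabs_ge0.
Qed.

Lemma wsup_finP (a : R) g : (wsup a g < +oo)%E <->
  exists2 M : R, 0 <= M & forall z, disk z -> wt a z * cabs (g z) <= M.
Proof.
split=> [H|[M _ /wsup_leP H]]; last exact: le_lt_trans H (ltry _).
have fn : (wsup a g \is a fin_num)%E by rewrite ge0_fin_numE ?wsup_ge0.
exists (fine (wsup a g)); first by rewrite fine_ge0 ?wsup_ge0.
by apply/wsup_leP; rewrite fineK.
Qed.

Lemma normB_leP (a M : R) f : (normB a f <= M%:E)%E ->
  cabs (f 0) <= M /\ forall z, disk z -> wt a z * cabs (cder f z) <= M.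
Proof.
rewrite /normB => H; split.
  rewrite -lee_fin; apply: le_trans H; rewrite leeDl // wsup_ge0 //.
by apply/wsup_leP; apply: le_trans H; rewrite leeDr // lee_fin cabs_ge0.
Qed.

Lemma normB_le (a M N : R) f : cabs (f 0) <= M ->
  (forall z, disk z -> wt a z * cabs (cder f z) <= N) -> (normB a f <= (M + N)%:E)%E.
Proof.
by move=> h0 h1; rewrite /normB EFinD; apply: leeD; [rewrite lee_fin|apply/wsup_leP].
Qed.

Lemma normZ_le (a M N K : R) f : cabs (f 0) <= M -> cabs (cder f 0) <= N ->
  (forall z, disk z -> wt a z * cabs (cder (cder f) z) <= K) -> (normZ a f <= (M + N + K)%:E)%E.
Proof.
by move=> h0 h1 h2; rewrite /normZ !EFinD; apply: leeD; [rewrite -EFinD lee_fin lerD|apply/wsup_leP].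
Qed.

Lemma normZ_leP (a M : R) f : (normZ a f <= M%:E)%E ->
  [/\ cabs (f 0) <= M, cabs (cder f 0) <= M &
   forall z, disk z -> wt a z * cabs (cder (cder f) z) <= M].
Proof.
rewrite /normZ => H.
have w0 := wsup_ge0 a (cder (cder f)).
have c0 : (0 <= (cabs (f 0))%:E)%E by rewrite lee_fin cabs_ge0.
have c1 : (0 <= (cabs (cder f 0))%:E)%E by rewrite lee_fin cabs_ge0.
split.
- by rewrite -lee_fin; apply: le_trans H; rewrite -addeA leeDl // adde_ge0.
- by rewrite -lee_fin; apply: le_trans H; rewrite -addeA addeCA leeDl // adde_ge0.
- by apply/wsup_leP; apply: le_trans H; rewrite leeDr // adde_ge0.
Qed.

Lemma normZ_ge0 (a : R) f : (0 <= normZ a f)%E.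
Proof. by rewrite /normZ !adde_ge0 ?wsup_ge0 ?lee_fin ?cabs_ge0. Qed.

(** From 1 - |z| <= 1 - |z|^2 <= 2 (1 - |z|), here and in [wt_ub]; growth is then measured by powers
    of 1 - |z|. *)
Lemma wt_lb (a : R) z : 0 <= a -> disk z -> (1 - cabs z) `^ a <= wt a z.
Proof.
move=> a0; rewrite /disk /= => hz; have z0 := cabs_ge0 z.
by apply: ge0_ler_powR; rewrite ?nnegrE; nra.
Qed.

Lemma wt_ub (a : R) z : 0 <= a -> disk z -> wt a z <= 2 `^ a * (1 - cabs z) `^ a.
Proof.
move=> a0; rewrite /disk /= => hz; have z0 := cabs_ge0 z.
rewrite -powRM; [|lra|lra].
by apply: ge0_ler_powR; rewrite ?nnegrE; nra.
Qed.

Lemma powRD_gt0 (x r s : R) : 0 < x -> x `^ (r + s) = x `^ r * x `^ s.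
Proof. by move=> x0; rewrite powRD // (gt_eqF x0) implybT. Qed.

Section Growth.
Context (al : R) (al1 : 1 < al).
Implicit Types F : cfun R.

Definition unitB F := inB al F /\ (normB al F <= 1)%E.

Lemma unitB_holo F : unitB F -> holo F. Proof. by case=> -[]. Qed.

Lemma unitB0 F : unitB F -> cabs (F 0) <= 1.
Proof. by case=> _ /normB_leP[]. Qed.

Lemma unitB1 F z : unitB F -> disk z -> (1 - cabs z) `^ al * cabs (cder F z) <= 1.
Proof.
case=> _ /normB_leP[_ h] hz; apply: le_trans (h z hz).
apply: ler_wpM2r; first exact: cabs_ge0.
by apply: wt_lb => //; apply: ltW; apply: lt_trans al1.
Qed.

Lemma unitB1_ball F (q : R) z : unitB F -> q < 1 -> cabs z <= q ->
  cabs (cder F z) <= ((1 - q) `^ al)^-1.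
Proof.
have al1' := al1.
move=> hF q1 hz; have p0 : 0 < (1 - q) `^ al by apply: powR_gt0; lra.
rewrite -[leRHS]mul1r ler_pdivlMr // mulrC.
have hd : disk z by rewrite /disk /=; lra.
apply: le_trans (unitB1 hF hd); apply: ler_wpM2r; first exact: cabs_ge0.
by apply: ge0_ler_powR; rewrite ?nnegrE; lra.
Qed.

(** The solution of G (1 - k) = 2 for k = 2^(1 - al), which is below 1 exactly because al > 1. It
    gives 1 + k G <= G for the inductive step and G >= 2 for its start. *)
Definition growth0 : R := 2 / (1 - 2 `^ (1 - al)).

Lemma growth0P : 2 <= growth0 /\ 1 + 2 `^ (1 - al) * growth0 <= growth0.
Proof.
have al1' := al1.
have k0 : 0 < 2 `^ (1 - al) :> R by apply: powR_gt0.
have k1 : 2 `^ (1 - al) < 1 :> R.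
  have : 1 `^ (al - 1) < 2 `^ (al - 1) by apply: gt0_ltr_powR; rewrite ?nnegrE; lra.
  by rewrite powR1 (_ : 1 - al = - (al - 1)); [rewrite powRN invf_lt1 ?powR_gt0|rewrite opprB].
rewrite /growth0; set k := 2 `^ _ in k0 k1 *.
have E : 2 / (1 - k) * (1 - k) = 2 by field; lra.
have p : 0 < 2 / (1 - k) by rewrite divr_gt0 //; lra.
split; nra.
Qed.

(* Induction on the dyadic distance to the circle: moving towards 0 by 1 - |z|
   doubles that distance. *)
Lemma growth0_bound F z : unitB F -> disk z -> (1 - cabs z) `^ (al - 1) * cabs (F z) <= growth0.
Proof.
have al1' := al1.
move=> hF hz; have [G2 GG] := growth0P.
have [k hk] : exists k, 2^-1 ^+ k < 1 - cabs z.
  have q0 : 0 < 1 - cabs z by move: hz; rewrite /disk /=; lra.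
  have : ((fun k => 2^-1 ^+ k : R) @ \oo --> (0 : R))%classic.
    by apply: cvg_expr; rewrite gtr0_norm; lra.
  move=> /cvgrPdist_lt /(_ _ q0)[k _ hk]; exists k.
  by have := hk k (leqnn k); rewrite /= sub0r normrN ger0_norm // exprn_ge0.
elim: k z hz hk => [|k IH] z hz hk.
  by have := cabs_ge0 z; rewrite expr0 in hk; lra.
have z1 : cabs z < 1 by [].
have z0 := cabs_ge0 z.
set t := 1 - cabs z in hk *; have t0 : 0 < t by rewrite /t; lra.
have tE : t `^ al = t `^ (al - 1) * t.
  by rewrite -{3}(powRr1 (ltW t0)) -powRD_gt0 // subrK.
have p0 : 0 <= t `^ (al - 1) by exact: powR_ge0.
have incr z' : cabs z' <= cabs z -> cabs (z - z') <= t -> t `^ (al - 1) * cabs (F z - F z') <= 1.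
  move=> h1 h2; have pt : 0 < t `^ al by exact: powR_gt0.
  have := @mean_value_disk _ F z' z (cabs z) (t `^ al)^-1 (unitB_holo hF) z1 h1 (lexx _)
    (fun w => unitB1_ball hF z1).
  move=> h; apply: (@le_trans _ _ (t `^ (al - 1) * ((t `^ al)^-1 * t))).
    apply: ler_wpM2l => //; apply: le_trans h _; apply: ler_wpM2l => //.
    by rewrite invr_ge0 ltW.
  by rewrite mulrCA -tE mulVf ?gt_eqF.
(* At distance at least 1/2 from the circle a single application of [incr] reaches 0. *)
have [th|th] := leP (1 / 2) t.
  have h := incr 0; rewrite subr0 cabs0 in h; have {}h := h z0 ltac:(rewrite /t in th *; lra).
  have F0 := unitB0 hF.
  have pl1 : t `^ (al - 1) <= 1.
    have : t `^ (al - 1) <= 1 `^ (al - 1) by apply: ge0_ler_powR; rewrite ?nnegrE /t; lra.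
    by rewrite powR1.
  have : cabs (F z) <= cabs (F z - F 0) + cabs (F 0) by have := cabsD (F z - F 0) (F 0); rewrite subrK.
  have := cabs_ge0 (F 0); have := cabs_ge0 (F z - F 0); nra.
pose x := (1 - 2 * t) / (1 - t).
have xE : x * (1 - t) = 1 - 2 * t by rewrite /x; field; lra.
have x0 : 0 <= x by rewrite divr_ge0 //; lra.
have x1 : x <= 1 by rewrite ler_pdivrMr; lra.
pose z' : C := (x%:C)%C * z.
have cz' : cabs z' = 1 - 2 * t by rewrite /z' cabsM cabs_real ger0_norm // -xE /t; congr (_ * _); ring.
have dz' : disk z' by rewrite /disk /= cz'; lra.
have h1 : t `^ (al - 1) * cabs (F z - F z') <= 1.
  apply: incr; first by rewrite cz'; rewrite /t in t0 *; lra.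
  have -> : z - z' = ((1 - x)%:C)%C * z by rewrite rmorphB /= rmorph1 /z'; ring.
  rewrite cabsM cabs_real ger0_norm; last lra.
  by rewrite /t in xE *; nra.
have h2 : (2 * t) `^ (al - 1) * cabs (F z') <= growth0.
  have := IH z' dz'; rewrite cz' (_ : 1 - (1 - 2 * t) = 2 * t); last by ring.
  by apply; move: hk; rewrite exprS; lra.
have h3 : t `^ (al - 1) = 2 `^ (1 - al) * (2 * t) `^ (al - 1).
  rewrite powRM; [|lra|lra].
  by rewrite mulrA -powRD_gt0 // (_ : 1 - al + (al - 1) = 0) ?powRr0 ?mul1r //; ring.
have : cabs (F z) <= cabs (F z - F z') + cabs (F z') by have := cabsD (F z - F z') (F z'); rewrite subrK.
move=> /(ler_wpM2l p0); rewrite mulrDr => h4; apply: le_trans h4 _.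
apply: le_trans GG; apply: lerD => //.
by rewrite h3 -mulrA; apply: ler_wpM2l; rewrite ?powR_ge0.
Qed.

Lemma unitB0_ball F (q : R) z : unitB F -> q < 1 -> cabs z <= q ->
  cabs (F z) <= growth0 / (1 - q) `^ (al - 1).
Proof.
have al1' := al1.
move=> hF q1 hz; have p0 : 0 < (1 - q) `^ (al - 1) by apply: powR_gt0; lra.
rewrite ler_pdivlMr // mulrC.
have hd : disk z by rewrite /disk /=; lra.
apply: le_trans (growth0_bound hF hd); apply: ler_wpM2r; first exact: cabs_ge0.
by apply: ge0_ler_powR; rewrite ?nnegrE; lra.
Qed.

(** The Cauchy estimate for F' with radius t/2, where t = 1 - |z|, gives 4 pi (t/2)^(-al) /
    (t/2). *)
Definition growth2 : R := 8 * pi * 2 `^ al.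

Lemma growth2_bound F z : unitB F -> disk z ->
  (1 - cabs z) `^ (al + 1) * cabs (cder (cder F) z) <= growth2.
Proof.
have al1' := al1.
move=> hF hz; have z1 : cabs z < 1 by [].
set t := 1 - cabs z; have t0 : 0 < t by rewrite /t; lra.
have t20 : 0 < t / 2 by lra.
have := @cauchy_estimate _ (cder F) z (t / 2) ((t / 2) `^ al)^-1 (holo_cder (unitB_holo hF)) t20
  ltac:(rewrite /t; lra).
move=> /(_ _)/wrap[w hw|h].
  have := @unitB1_ball F (1 - t / 2) w hF ltac:(lra).
  rewrite (_ : 1 - (1 - t / 2) = t / 2); last by ring.
  by apply; have := cabsD (w - z) z; rewrite subrK; rewrite /t in hw *; lra.
have p0 : 0 < t `^ al by exact: powR_gt0.
have p2 : 0 < 2 `^ al :> R by exact: powR_gt0.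
have E : (t / 2) `^ al = t `^ al / 2 `^ al.
  apply: (canRL (mulfK _)); first by rewrite gt_eqF.
  rewrite -powRM ?divfK //; lra.
apply: le_trans (ler_wpM2l (powR_ge0 _ _) h) _.
rewrite powRD_gt0 // powRr1 ?(ltW t0) // E /growth2.
by rewrite le_eqVlt; apply/orP; left; apply/eqP; field; rewrite !gt_eqF.
Qed.

End Growth.

(** * Second derivative of a weighted composition *)

Section SecondDerivative.
Implicit Types F : cfun R.

(** The index of a coefficient is the order of the derivative of F that it multiplies in the second
    derivative of u F(phi). *)
Definition coef1 u phi : cfun R := fun z => 2 * cder u z * cder phi z + u z * cder (cder phi) z.
Definition coef2 u phi : cfun R := fun z => u z * cder phi z ^+ 2.
Definition coef0 u : cfun R := cder (cder u).

Context (u phi : cfun R) (hu : holo u) (hphi : selfmap phi).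

Lemma wco_holo F : holo F -> holo (wco u phi F).
Proof. by move=> hF; exact: (holoM hu (holo_comp hF hphi)). Qed.

Lemma cder_wco F z : holo F -> disk z ->
  cder (wco u phi F) z = cder u z * F (phi z) + u z * (cder F (phi z) * cder phi z).
Proof.
move=> hF hz; case: hphi => hp hs; apply: cdiff_cder.
exact: (cdiffM (holo_cdiff hu hz) (cdiff_comp (holo_cdiff hp hz) (holo_cdiff hF (hs _ hz)))).
Qed.

Lemma cder2_wco F z : holo F -> disk z -> cder (cder (wco u phi F)) z =
  coef0 u z * F (phi z) + coef1 u phi z * cder F (phi z) + coef2 u phi z * cder (cder F) (phi z).
Proof.
move=> hF hz; have [hp hs] := hphi.
have hu' := holo_cder hu; have hF' := holo_cder hF; have hp' := holo_cder hp.
have hpz := hs _ hz.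
have H : cdiff (fun z => cder u z * F (phi z) + u z * (cder F (phi z) * cder phi z)) z
  (coef0 u z * F (phi z) + coef1 u phi z * cder F (phi z) + coef2 u phi z * cder (cder F) (phi z)).
  have := cdiffD (cdiffM (holo_cdiff hu' hz) (cdiff_comp (holo_cdiff hp hz) (holo_cdiff hF hpz)))
    (cdiffM (holo_cdiff hu hz) (cdiffM (cdiff_comp (holo_cdiff hp hz) (holo_cdiff hF' hpz)) (holo_cdiff hp' hz))).
  rewrite [X in cdiff _ z X -> _](_ : _ = coef0 u z * F (phi z) + coef1 u phi z * cder F (phi z) + coef2 u phi z * cder (cder F) (phi z)); last first.
    rewrite /coef0 /coef1 /coef2.
    generalize (cder (cder u) z) (cder u z) (cder (cder phi) z) (cder phi z).
    generalize (cder (cder F) (phi z)) (cder F (phi z)) (F (phi z)) (u z).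
    by move=> *; ring.
  exact.
apply: cdiff_cder; have [r r0 h] := disk_open hz.
by apply: (cdiff_ext r0 _ H) => w /h hw; rewrite cder_wco.
Qed.

End SecondDerivative.

(** The p-th power of 1 + x <= p (1 + x/p) <= p exp(x/p), where p >= 1 gives the first
    inequality. *)
Lemma powR_expR_bound (p x : R) : 1 <= p -> 0 <= x -> (1 + x) `^ p <= p `^ p * expR x.
Proof.
move=> p1 x0; have p0 : 0 < p by lra.
have E : expR x = expR (x / p) `^ p by rewrite -expRM divfK ?gt_eqF.
rewrite E -powRM ?expR_ge0 //; last lra.
apply: ge0_ler_powR; rewrite ?nnegrE ?mulr_ge0 ?expR_ge0 //; try lra.
have := expR_ge1Dx (x / p); move=> /(ler_wpM2l (ltW p0)).
rewrite mulrDr mulr1 mulrCA mulfV ?gt_eqF // mulr1; lra.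
Qed.

Lemma exprB_le_expR (t : R) n : t <= 1 -> (1 - t) ^+ n <= expR (- (n%:R * t)).
Proof.
move=> t1; rewrite -mulrN expRM_natl; apply: lerXn2r; rewrite ?nnegrE ?expR_ge0 //; try lra.
by have := expR_ge1Dx (- t).
Qed.

End Norms.

(** * Integer frequencies adapted to the distance from the circle *)

Section Frequencies.
Context {R : realType}.
Implicit Types (x t a p : R).

Lemma bernoulli t n : 0 <= t <= 1 -> 1 - n%:R * t <= (1 - t) ^+ n.
Proof.
move=> ht; elim: n => [|n IH]; first by rewrite expr0; lra.
rewrite exprS -natr1; have n0 : 0 <= n%:R :> R by [].
have : 0 <= n%:R * t by rewrite mulr_ge0 //; lra.
nra.
Qed.

(* The integer m with m (1 - x) close to 1/2, so that x ^ m stays away from 0. *)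
Definition freq x : nat := Num.truncn (1 / (2 * (1 - x))).

(** Truncation gives m (1 - x) <= 1/2, whence x^m >= 1/2 by Bernoulli, and (m + 1)(1 - x) > 1/2,
    whence m (1 - x) >= 1/4 as m + 1 <= 2m. *)
Lemma freqP x : 1 / 2 <= x < 1 ->
  [/\ (1 <= freq x)%N, 1 / 4 <= (freq x)%:R * (1 - x) & 1 / 2 <= x ^+ freq x].
Proof.
move=> hx; have p0 : 0 <= 1 / (2 * (1 - x)) by rewrite divr_ge0 //; lra.
have /andP[h1 h2] := truncn_itv p0; rewrite -/(freq x) in h1 h2.
have h3 : (freq x)%:R * (1 - x) <= 1 / 2.
  by move: h1; rewrite ler_pdivlMr; lra.
have h4 : 1 / 2 < (freq x).+1%:R * (1 - x).
  by move: h2; rewrite ltr_pdivrMr; lra.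
have m1 : (1 <= freq x)%N by rewrite truncn_ge_nat // ler_pdivlMr; lra.
have m1' : 1 <= (freq x)%:R :> R by rewrite ler1n.
have q : 0 <= ((freq x)%:R - 1) * (1 - x) by rewrite mulr_ge0 //; lra.
split => //; first by move: h4; rewrite -[(freq x).+1%:R]natr1; lra.
have := @bernoulli (1 - x) (freq x) ltac:(lra).
by rewrite (_ : 1 - (1 - x) = x); [lra|ring].
Qed.

Lemma freq_ge x (n : nat) : 1 / 2 <= x < 1 -> 1 - x <= (4 * n.+1%:R)^-1 -> (n < freq x)%N.
Proof.
move=> hx; have [_ h _] := freqP hx => h1.
have n0 : 0 < 4 * n.+1%:R :> R by rewrite mulr_gt0.
have : n.+1%:R <= (freq x)%:R :> R; last by rewrite ler_nat.
have : (freq x)%:R * (1 - x) <= (freq x)%:R * (4 * n.+1%:R)^-1 by apply: ler_wpM2l.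
move=> h2; have : 1 / 4 <= (freq x)%:R / (4 * n.+1%:R) := le_trans h h2.
by rewrite ler_pdivlMr //; lra.
Qed.

(** The exponent p + 1 keeps [powR_expR_bound] applicable when p < 1, as may happen for p = al - 1;
    the factor e comes from (1 - t)^n <= e exp(-(n + 1) t). *)
Definition decay p : R := (p + 1) `^ (p + 1) * expR 1.

Lemma decay_gt0 p : 0 <= p -> 0 < decay p.
Proof. by move=> p0; rewrite mulr_gt0 ?expR_gt0 ?powR_gt0 //; lra. Qed.

Lemma decay_bound p t n : 0 <= p -> 0 <= t <= 1 ->
  n.+1%:R `^ p * t `^ p * (1 - t) ^+ n <= decay p.
Proof.
move=> p0 ht; rewrite -powRM //; last by case/andP: ht.
set y := n.+1%:R * t; have y0 : 0 <= y by rewrite mulr_ge0 //; lra.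
have h1 : y `^ p <= (p + 1) `^ (p + 1) * expR y.
  apply: le_trans (powR_expR_bound _ y0); last lra.
  apply: le_trans (_ : (1 + y) `^ p <= _); first by apply: ge0_ler_powR; rewrite ?nnegrE; lra.
  by apply: ler_powR; lra.
have h2 : (1 - t) ^+ n <= expR 1 * expR (- y).
  rewrite -expRD; apply: le_trans (exprB_le_expR _ _) _; first lra.
  by rewrite ler_expR /y -natr1; lra.
apply: le_trans (ler_pM _ _ h1 h2) _; rewrite ?powR_ge0 ?exprn_ge0 //; first lra.
rewrite /decay expRN le_eqVlt; apply/orP; left; apply/eqP; field.
by rewrite gt_eqF ?expR_gt0.
Qed.

Lemma eventually_small (c e : R) : 0 <= c -> 0 < e ->
  exists N, forall n, (N <= n)%N -> c / n.+1%:R <= e.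
Proof.
move=> c0 e0; have ce : 0 <= c / e by rewrite divr_ge0 // ltW.
exists (Num.bound (c / e)) => n hn; rewrite ler_pdivrMr // mulrC -ler_pdivrMr //.
apply/ltW; apply: lt_le_trans (archi_boundP ce) _; rewrite ler_nat; exact: leqW.
Qed.

End Frequencies.

(** * Powers of phi against behaviour near the boundary *)

Section Asymptotics.
Context {R : realType}.
Implicit Types (w phi : cfun R) (a be M lam s : R).

Definition near_boundary be w phi a lam s := forall z, disk z -> s < cabs (phi z) ->
  wt be z * cabs (w z) <= lam * (1 - cabs (phi z)) `^ a.

(** At z the power n = [freq] |phi z| is tested: |phi z|^n >= 1/2 costs the factor 2, and 4 (n +
    1)(1 - |phi z|) >= 1 costs 4^a. The threshold s is so close to 1 that n >= N. *)
Lemma powers_near_boundary be w phi a lam (N : nat) : selfmap phi -> 0 <= a ->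
  (forall n z, (N <= n)%N -> disk z ->
     n.+1%:R `^ a * (wt be z * cabs (w z * phi z ^+ n)) <= lam) ->
  exists s : R, 1 / 2 <= s < 1 /\ near_boundary be w phi a (2 * 4 `^ a * lam) s.
Proof.
move=> [_ hs] a0 H.
have n0 : 1 <= N.+1%:R :> R by rewrite ler1n.
pose q : R := (4 * N.+1%:R)^-1; exists (1 - q).
have i0 : 0 < q by rewrite invr_gt0 mulr_gt0.
have i1 : q <= 1 / 2 by rewrite /q -[leLHS]mul1r ler_pdivrMr ?mulr_gt0 //; lra.
split=> [|z hz sz]; first by apply/andP; split; lra.
set x := cabs (phi z) in sz *; have x1 : x < 1 by exact: hs.
have hx : 1 / 2 <= x < 1 by lra.
have [m1 m4 mx] := freqP hx; set m := freq x in m1 m4 mx.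
have Nm : (N <= m)%N by apply/ltnW; apply: freq_ge => //; rewrite -/q; lra.
have := H m z Nm hz; rewrite cabsM cabsX -/x => h.
have W0 : 0 <= wt be z * cabs (w z) by rewrite mulr_ge0 ?wt_ge0 ?cabs_ge0.
have h1 : 1 <= m.+1%:R `^ a * (4 `^ a * (1 - x) `^ a).
  rewrite -!powRM //; try lra.
  have : 1 `^ a <= (m.+1%:R * (4 * (1 - x))) `^ a; last by rewrite powR1.
  apply: ge0_ler_powR; rewrite ?nnegrE //; first by rewrite !mulr_ge0 //; lra.
  by rewrite -[m.+1%:R]natr1; lra.
have t0 : 0 <= 4 `^ a * (1 - x) `^ a by rewrite mulr_ge0 ?powR_ge0.
have p0 : 0 <= m.+1%:R `^ a :> R by exact: powR_ge0.
have h2 : m.+1%:R `^ a * (wt be z * cabs (w z)) <= 2 * lam.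
  have q0 : 0 <= m.+1%:R `^ a * (wt be z * cabs (w z)) by rewrite mulr_ge0.
  by nra.
apply: (@le_trans _ _ (m.+1%:R `^ a * (wt be z * cabs (w z)) * (4 `^ a * (1 - x) `^ a))).
  by rewrite mulrAC -[leLHS]mul1r ler_wpM2r.
rewrite (_ : 2 * 4 `^ a * lam * _ = 2 * lam * (4 `^ a * (1 - x) `^ a)); last by ring.
by apply: ler_wpM2r.
Qed.

(** Where |phi z| > s, [decay_bound] with exponent a absorbs the power of n. Elsewhere the bound M
    is used, and [decay_bound] with exponent a + 1 leaves a spare factor 1 / (n + 1), which is
    eventually small. *)
Lemma near_boundary_powers be w phi a lam M s : selfmap phi -> 0 < a -> 0 < lam -> 0 <= s < 1 ->
  (forall z, disk z -> wt be z * cabs (w z) <= M) -> near_boundary be w phi a lam s ->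
  exists N, forall n z, (N <= n)%N -> disk z ->
     n.+1%:R `^ a * (wt be z * cabs (w z * phi z ^+ n)) <= decay a * lam.
Proof.
move=> [_ hs] a0 l0 hs01 HM Hnb.
have M0 : 0 <= M by apply: le_trans (HM 0 disk0); rewrite mulr_ge0 ?wt_ge0 ?cabs_ge0.
have da := decay_gt0 (ltW a0).
have da1 : 0 < decay (a + 1) by apply: decay_gt0; lra.
have ps : 0 < (1 - s) `^ (a + 1) by apply: powR_gt0; lra.
have c0 : 0 <= decay (a + 1) / (1 - s) `^ (a + 1) * M by rewrite mulr_ge0 // divr_ge0 // ltW.
have e0 : 0 < decay a * lam by rewrite mulr_gt0.
have [N hN] := eventually_small c0 e0.
exists N => n z Nn hz; set x := cabs (phi z); have x1 : x < 1 by exact: hs.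
have x0 : 0 <= x by exact: cabs_ge0.
have n0 : 0 < n.+1%:R :> R by [].
rewrite cabsM cabsX -/x.
have W0 : 0 <= wt be z * cabs (w z) by rewrite mulr_ge0 ?wt_ge0 ?cabs_ge0.
have [sx|xs] := ltP s x.
  have := Hnb z hz sx; rewrite -/x => h.
  have := @decay_bound _ a (1 - x) n (ltW a0) ltac:(lra).
  rewrite (_ : 1 - (1 - x) = x); last by ring.
  move=> hd; rewrite (_ : _ * _ = n.+1%:R `^ a * x ^+ n * (wt be z * cabs (w z))); last by ring.
  apply: (@le_trans _ _ (n.+1%:R `^ a * x ^+ n * (lam * (1 - x) `^ a))).
    by apply: ler_wpM2l => //; rewrite mulr_ge0 ?powR_ge0 ?exprn_ge0.
  rewrite (_ : _ * _ = n.+1%:R `^ a * (1 - x) `^ a * x ^+ n * lam); last by ring.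
  by apply: ler_wpM2r => //; exact: ltW.
apply: le_trans (hN n Nn).
have := @decay_bound _ (a + 1) (1 - s) n ltac:(lra) ltac:(lra).
rewrite (_ : 1 - (1 - s) = s); last by ring.
rewrite powRD_gt0 // powRr1; last exact: ltW.
move=> hd; rewrite ler_pdivlMr //.
rewrite (_ : _ * n.+1%:R = n.+1%:R `^ a * n.+1%:R * x ^+ n * (wt be z * cabs (w z))); last by ring.
apply: ler_pM; rewrite ?HM //.
  by rewrite !mulr_ge0 ?powR_ge0 ?exprn_ge0.
rewrite ler_pdivlMr //; apply: le_trans hd.
rewrite [leRHS]mulrAC; apply: ler_wpM2r; first exact: ltW.
apply: ler_wpM2l; first by rewrite mulr_ge0 ?powR_ge0.
by apply: lerXn2r; rewrite ?nnegrE //; lra.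
Qed.

End Asymptotics.

(** * Test polynomials concentrated near a point *)

Section TestFunctions.
Context {R : realType}.
Local Notation C := (CC R).
Implicit Types (z w a : C) (m : nat).

Definition mono a n (z : C) : C := (z / a) ^+ n.

Lemma cdiff_mono a n z : cdiff (mono a n) z (n%:R * mono a n.-1 z / a).
Proof.
have H : cdiff (fun w => w / a) z (a^-1).
  have := cdiffM (cdiff_id z) (cdiff_cst a^-1 z).
  by rewrite mulr0 addr0 mul1r.
exact: (cdiff_comp H (cdiff_pow n (z / a))).
Qed.

(* For |a| ^ m >= 1/2 these polynomials of degree 3 m concentrate near a; the
   three coefficients prescribe the 2-jet at a. *)
Definition tst (k : C) a m (d : C * C * C) : cfun R := fun z =>
  k * (d.1.1 * mono a m z + d.1.2 * mono a (2 * m) z + d.2 * mono a (3 * m) z).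

Definition tst1 (k : C) a m (d : C * C * C) : cfun R := fun z =>
  k / a * (d.1.1 * m%:R * mono a m.-1 z + d.1.2 * (2 * m)%:R * mono a (2 * m).-1 z
   + d.2 * (3 * m)%:R * mono a (3 * m).-1 z).

Definition tst2 (k : C) a m (d : C * C * C) : cfun R := fun z =>
  k / a ^+ 2 * (d.1.1 * m%:R * m.-1%:R * mono a m.-2 z
   + d.1.2 * (2 * m)%:R * (2 * m).-1%:R * mono a (2 * m).-2 z
   + d.2 * (3 * m)%:R * (3 * m).-1%:R * mono a (3 * m).-2 z).

Lemma cdiff_lin3 (c k1 k2 k3 : C) (f1 f2 f3 : C -> C) z D1 D2 D3 :
  cdiff f1 z D1 -> cdiff f2 z D2 -> cdiff f3 z D3 ->
  cdiff (fun w => c * (k1 * f1 w + k2 * f2 w + k3 * f3 w)) z (c * (k1 * D1 + k2 * D2 + k3 * D3)).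
Proof. by move=> h1 h2 h3; exact: (cdiffZ c (cdiffD (cdiffD (cdiffZ _ h1) (cdiffZ _ h2)) (cdiffZ _ h3))). Qed.

Lemma cdiff_tst k a m d z : cdiff (tst k a m d) z (tst1 k a m d z).
Proof.
have := @cdiff_lin3 k d.1.1 d.1.2 d.2 _ _ _ z _ _ _ (cdiff_mono a m z) (cdiff_mono a (2 * m) z) (cdiff_mono a (3 * m) z).
by rewrite (_ : k * _ = tst1 k a m d z) // /tst1; ring.
Qed.

Lemma cder_tst k a m d z : cder (tst k a m d) z = tst1 k a m d z.
Proof. exact: cdiff_cder (cdiff_tst k a m d z). Qed.

Lemma cder2_tst k a m d z : cder (cder (tst k a m d)) z = tst2 k a m d z.
Proof.
have -> : cder (tst k a m d) = tst1 k a m d by apply/funext => w; exact: cder_tst.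
apply: cdiff_cder.
have := @cdiff_lin3 (k / a) (d.1.1 * m%:R) (d.1.2 * (2 * m)%:R) (d.2 * (3 * m)%:R) _ _ _ z _ _ _
  (cdiff_mono a m.-1 z) (cdiff_mono a (2 * m).-1 z) (cdiff_mono a (3 * m).-1 z).
rewrite [X in cdiff _ z X -> _](_ : _ = tst2 k a m d z); first exact.
by rewrite /tst2 -exprVn; ring.
Qed.

Lemma holo_tst k a m d : holo (tst k a m d).
Proof. by move=> z _; exact: cdiff_derivable (cdiff_tst k a m d z). Qed.

Lemma mono_id a n : a != 0 -> mono a n a = 1.
Proof. by move=> a0; rewrite /mono divff // expr1n. Qed.

(** The 2-jet at a depends on the moments S0, S1, S2 of (d1, d2, d3), where Si is the sum of j^i dj.
    They are (1, 0, 0) for [jet0], (0, 0, 1) for [jet2] and (0, 1, 1/m) for [jet1]. The second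
    derivative is proportional to m S2 - S1, which the 1/m cancels in [jet1]. *)
Definition jet0 (m : nat) : C * C * C := (3, -3, 1).
Definition jet2 (m : nat) : C * C * C := (1 / 2, -1, 1 / 2).
Definition jet1 (m : nat) : C * C * C :=
  (- 5 / 2 + m%:R^-1 * (1 / 2), 4 - m%:R^-1, - 3 / 2 + m%:R^-1 * (1 / 2)).

Lemma tst_at k a m d : a != 0 -> (0 < m)%N ->
  [/\ tst k a m d a = k * (d.1.1 + d.1.2 + d.2),
      tst1 k a m d a = k / a * m%:R * (d.1.1 + 2 * d.1.2 + 3 * d.2) &
      tst2 k a m d a = k / a ^+ 2 * m%:R *
        (m%:R * (d.1.1 + 4 * d.1.2 + 9 * d.2) - (d.1.1 + 2 * d.1.2 + 3 * d.2))].
Proof.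
move=> a0 m0; rewrite /tst /tst1 /tst2 !mono_id //.
have P n : (0 < n)%N -> n.-1%:R = n%:R - 1 :> C.
  by case: n => // n _; rewrite -[n.+1%:R]natr1 addrK.
rewrite !P ?muln_gt0 // !natrM; split; ring.
Qed.

Lemma jet0_at k a m : a != 0 -> (0 < m)%N ->
  [/\ tst k a m (jet0 m) a = k, tst1 k a m (jet0 m) a = 0 & tst2 k a m (jet0 m) a = 0].
Proof. by move=> a0 m0; have [-> -> ->] := tst_at k (jet0 m) a0 m0; rewrite /jet0 /=; split; ring. Qed.

Lemma jet1_at k a m : a != 0 -> (0 < m)%N ->
  [/\ tst k a m (jet1 m) a = 0, tst1 k a m (jet1 m) a = k * (m%:R / a) & tst2 k a m (jet1 m) a = 0].
Proof.
move=> a0 m0; have [-> -> ->] := tst_at k (jet1 m) a0 m0; rewrite /jet1 /=.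
have m0' : m%:R != 0 :> C by rewrite pnatr_eq0 -lt0n.
by split; field; rewrite ?m0' ?a0.
Qed.

Lemma jet2_at k a m : a != 0 -> (0 < m)%N ->
  [/\ tst k a m (jet2 m) a = 0, tst1 k a m (jet2 m) a = 0 & tst2 k a m (jet2 m) a = k * (m%:R / a) ^+ 2].
Proof.
move=> a0 m0; have [-> -> ->] := tst_at k (jet2 m) a0 m0; rewrite /jet2 /=.
by split; field; rewrite ?a0.
Qed.

Definition small5 (d : C * C * C) := [/\ cabs d.1.1 <= 5, cabs d.1.2 <= 5 & cabs d.2 <= 5].

Lemma cabs_ratio (p q : nat) : cabs (p%:R / q%:R : C) = p%:R / q%:R.
Proof. by rewrite cabsM cabsV !cabs_nat. Qed.

Lemma jet0_small m : small5 (jet0 m).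
Proof.
by split; rewrite /= ?cabsN ?cabs_nat ?cabs1; lra.
Qed.

Lemma jet2_small m : small5 (jet2 m).
Proof.
by split; rewrite /= ?cabsN ?cabs1 ?(cabs_ratio 1 2); lra.
Qed.

Lemma jet1_small m : (0 < m)%N -> small5 (jet1 m).
Proof.
move=> m0; have m1 : cabs (m%:R^-1 : C) <= 1.
  by rewrite cabsV cabs_nat invf_le1 ?ltr0n // ler1n.
have h : cabs (1 / 2 : C) = 1 / 2 by exact: cabs_ratio 1 2.
have c0 : 0 <= cabs (m%:R^-1 : C) by exact: cabs_ge0.
split; rewrite /=.
- apply: le_trans (cabsD _ _) _; rewrite [X in _ + X]cabsM h mulNr cabsN (cabs_ratio 5 2); nra.
- by apply: le_trans (cabs_subl _ _) _; rewrite cabs_nat; lra.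
- apply: le_trans (cabsD _ _) _; rewrite [X in _ + X]cabsM h mulNr cabsN (cabs_ratio 3 2); nra.
Qed.

(** This is Phi(2x) - Phi(x) for Phi(y) = y / (1 + y), so sums along a sequence that at least
    doubles telescope below 1. *)
Definition hump (x : R) : R := x / ((1 + x) * (1 + 2 * x)).

(** 480 = 2 . 5 . 8 . (1 + 2 + 3): the 5 bounds the coefficients, the 8 bounds |a|^(-3m), 1 + 2 + 3
    comes from the degrees, and the 2 from (1 + x)(1 + 2x) <= 2 (1 + x)^2. *)
Definition tstC (al : R) : R := 480 * 2 `^ al * expR 1 * (al + 1) `^ (al + 1).

Definition tstK (al : R) (m : nat) : C := ((m%:R `^ (al - 1) / tstC al)%:C)%C.

Lemma tstC_gt0 al : 1 < al -> 0 < tstC al.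
Proof.
move=> h; apply: mulr_gt0; last by apply: powR_gt0; lra.
apply: mulr_gt0; last exact: expR_gt0.
by apply: mulr_gt0; rewrite ?powR_gt0 ?ltr0n.
Qed.

Lemma tst0 k a m d : (0 < m)%N -> tst k a m d 0 = 0.
Proof.
move=> m0; rewrite /tst /mono mul0r !expr0n !muln_eq0 /= (gtn_eqF m0).
by rewrite !mulr0 !addr0 mulr0.
Qed.

(** With x = m (1 - |z|), the weight, the normalisation and the degree combine to x^al, and |z|^(m -
    1) is at most e exp(-x). Since al > 1 near 0 and by exponential decay at infinity, x^al exp(-x)
    is dominated by a multiple of [hump x]. *)
Lemma tst_hump al a m d z : 1 < al -> (0 < m)%N -> small5 d -> 1 / 2 <= cabs a ^+ m -> cabs a < 1 ->
  disk z -> wt al z * cabs (cder (tst (tstK al m) a m d) z) <= hump (m%:R * (1 - cabs z)).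
Proof.
move=> al1 m0 [d1 d2 d3] am a1 hz; rewrite cder_tst.
have hz' : cabs z < 1 by [].
have z0 := cabs_ge0 z.
have a0 : 0 < cabs a.
  rewrite lt_neqAle cabs_ge0 andbT; apply/eqP => h.
  by move: am; rewrite -h expr0n (gtn_eqF m0) /=; lra.
have C0 := tstC_gt0 al1.
have m0' : 0 < m%:R :> R by rewrite ltr0n.
set t := 1 - cabs z; have t0 : 0 < t by rewrite /t; lra.
set x := m%:R * t; have x0 : 0 < x by rewrite mulr_gt0.
set k := m%:R `^ (al - 1) / tstC al; have k0 : 0 <= k by rewrite divr_ge0 ?powR_ge0 // ltW.
(* All three degrees are reduced to one: |a|^(-jm) <= 8 for j <= 3, and |z|^(jm - 1) <= |z|^(m -
   1). *)
have inv8 j : (0 < j <= 3)%N -> cabs (mono a (j * m).-1 z) / cabs a <= 8 * cabs z ^+ m.-1.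
  move=> /andP[j0 j3].
  have jm : (j * m = (j * m).-1.+1)%N by rewrite prednK // muln_gt0 j0.
  rewrite /mono cabsX cabsM cabsV expr_div_n -mulrA -invfM -exprSr -jm mulrC.
  apply: ler_pM; rewrite ?invr_ge0 ?exprn_ge0 ?(ltW a0) //; last first.
    apply: ler_wiXn2l; rewrite ?z0 ?ltW // -ltnS prednK // -jm.
    by rewrite -[leqLHS]mul1n leq_mul2r j0 orbT.
  rewrite -[leRHS]invrK lef_pV2 ?posrE ?exprn_gt0 ?invr_gt0 //.
  rewrite mulnC exprM; apply: (@le_trans _ _ ((1 / 2) ^+ 3)); first lra.
  apply: (@le_trans _ _ ((cabs a ^+ m) ^+ 3)).
    by apply: lerXn2r; rewrite ?nnegrE; lra.
  by apply: ler_wiXn2l => //; [lra | rewrite exprn_ile1 // ltW].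
have b1 : cabs (tst1 (tstK al m) a m d z) <= k * (240 * m%:R * cabs z ^+ m.-1).
  rewrite /tst1 /tstK -/k.
  have -> (X Y Z : C) : ((k%:C)%C / a * (X * m%:R * mono a m.-1 z + Y * (2 * m)%:R * mono a (2 * m).-1 z
   + Z * (3 * m)%:R * mono a (3 * m).-1 z)) =
     (k%:C)%C * ((X * (mono a (1 * m).-1 z / a) + 2 * Y * (mono a (2 * m).-1 z / a)
   + 3 * Z * (mono a (3 * m).-1 z / a)) * m%:R) by rewrite mul1n !natrM; ring.
  rewrite cabsM cabs_real ger0_norm //; apply: ler_wpM2l => //.
  rewrite cabsM cabs_nat [240 * _]mulrC -[leRHS]mulrA [leRHS]mulrC; apply: ler_wpM2r; first exact: ltW.
  apply: le_trans (cabsD _ _) _; apply: le_trans (lerD (cabsD _ _) (lexx _)) _.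
  have e j : (0 < j <= 3)%N -> forall D, cabs D <= 5 -> cabs (D * (mono a (j * m).-1 z / a)) <= 5 * (8 * cabs z ^+ m.-1).
    move=> hj D hD; rewrite cabsM; apply: ler_pM; rewrite ?cabs_ge0 //.
    by rewrite cabsM cabsV; exact: inv8.
  rewrite -[2 * _ * _]mulrA -[3 * _ * _]mulrA [cabs (2 * _)]cabsM [cabs (3 * _)]cabsM !cabs_nat.
  have := e 1%N isT _ d1; have := e 2%N isT _ d2; have := e 3%N isT _ d3; lra.
have b2 : cabs z ^+ m.-1 <= expR 1 * expR (- x).
  have := @exprB_le_expR _ t m.-1 ltac:(rewrite /t; lra).
  rewrite (_ : 1 - t = cabs z); last by rewrite /t; ring.
  move=> h; apply: le_trans h _; rewrite -expRD ler_expR /x.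
  have : m%:R = m.-1%:R + 1 :> R by rewrite natr1 prednK.
  move=> ->; have : t <= 1 by rewrite /t; lra.
  lra.
have b3 : wt al z <= 2 `^ al * t `^ al by apply: wt_ub => //; lra.
have P2 : 0 < 2 `^ al :> R by exact: powR_gt0.
have tp : 0 < t `^ al by exact: powR_gt0.
have cz : 0 <= cabs z ^+ m.-1 by rewrite exprn_ge0.
apply: (@le_trans _ _ (2 `^ al * t `^ al * (k * (240 * m%:R * (expR 1 * expR (- x)))))).
  apply: ler_pM; rewrite ?wt_ge0 ?cabs_ge0 //; apply: le_trans b1 _.
  by apply: ler_wpM2l => //; apply: ler_wpM2l => //; rewrite mulr_ge0 // ltW.
have xal : x `^ al = m%:R `^ (al - 1) * m%:R * t `^ al.
  rewrite /x powRM ?(ltW m0') ?(ltW t0) //; congr (_ * _).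
  by rewrite -{3}(powRr1 (ltW m0')) -powRD_gt0 // subrK.
have xal1 : x `^ al = x * x `^ (al - 1) by rewrite mulr_powRB1 // ?ltW //; lra.
have key : x `^ al * expR (- x) * ((1 + x) * (1 + 2 * x)) <= 2 * (al + 1) `^ (al + 1) * x.
  have h1 : x `^ (al - 1) <= (1 + x) `^ (al - 1) by apply: ge0_ler_powR; rewrite ?nnegrE; lra.
  have h2 : (1 + x) `^ (al + 1) = (1 + x) `^ (al - 1) * ((1 + x) * (1 + x)).
    rewrite (_ : al + 1 = al - 1 + 1 + 1); last by ring.
    by rewrite !powRD_gt0 ?powRr1; try lra.
  have h3 := @powR_expR_bound _ (al + 1) x ltac:(lra) (ltW x0).
  have h4 : 0 < (1 + x) `^ (al - 1) by apply: powR_gt0; lra.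
  have ex : 0 < expR x by exact: expR_gt0.
  rewrite expRN xal1 mulrAC ler_pdivrMr //.
  have : x `^ (al - 1) * ((1 + x) * (1 + 2 * x)) <= 2 * (1 + x) `^ (al + 1).
    apply: (@le_trans _ _ ((1 + x) `^ (al - 1) * ((1 + x) * (1 + 2 * x)))).
      by apply: ler_wpM2r => //; rewrite mulr_ge0; lra.
    rewrite h2 [leRHS]mulrCA; apply: ler_wpM2l; first exact: ltW.
    nra.
  have xl : 0 <= x by exact: ltW.
  move=> h5; have := ler_wpM2l xl h5; have := ler_wpM2l xl h3; lra.
rewrite /hump ler_pdivlMr; last by rewrite mulr_gt0; lra.
rewrite [leLHS](_ : _ = (240 * 2 `^ al * expR 1 / tstC al) * (x `^ al * expR (- x) * ((1 + x) * (1 + 2 * x)))); last first.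
  by rewrite xal /k; ring.
have c0 : 0 <= 240 * 2 `^ al * expR 1 / tstC al.
  apply: divr_ge0; last exact: ltW.
  apply: mulr_ge0; last exact: expR_ge0.
  by apply: mulr_ge0; [exact: ler0n|exact: powR_ge0].
apply: le_trans (ler_wpM2l c0 key) _.
rewrite le_eqVlt; apply/orP; left; apply/eqP; rewrite /tstC; field.
by rewrite !gt_eqF ?expR_gt0 ?powR_gt0 //; lra.
Qed.

Lemma hump_telescope (x : nat -> R) J : (forall j, 0 < x j) -> (forall j, 2 * x j <= x j.+1) ->
  \sum_(j < J) hump (x j) <= 1.
Proof.
move=> x0 x2; pose Phi (y : R) := y / (1 + y).
suff H : \sum_(j < J) hump (x j) <= Phi (x J).
  by apply: le_trans H _; have := x0 J => h; rewrite /Phi ler_pdivrMr; lra.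
elim: J => [|J IH].
  by rewrite big_ord0 divr_ge0 //; have := x0 0%N; lra.
rewrite big_ord_recr /=; have h := x0 J; have h2 := x2 J.
have E : hump (x J) = Phi (2 * x J) - Phi (x J).
  by rewrite /hump /Phi; field; rewrite !gt_eqF //; lra.
have M : Phi (2 * x J) <= Phi (x J.+1).
  by rewrite /Phi ler_pdivrMr; [rewrite mulrAC ler_pdivlMr; lra|lra].
lra.
Qed.

End TestFunctions.

(** * Lower bound for the essential norm *)

Section LowerBound.
Context {R : realType}.
Local Notation C := (CC R).
Implicit Types (al be lam : R) (u phi f g : cfun R) (K : cfun R -> cfun R).

Lemma unitBP al (f : cfun R) (M N : R) : holo f -> cabs (f 0) <= M ->
  (forall z, disk z -> wt al z * cabs (cder f z) <= N) -> M + N <= 1 -> unitB al f.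
Proof.
move=> hf h0 h1 MN; split; first split => //.
  apply/wsup_finP; exists N => //.
  by apply: le_trans (h1 0 disk0); rewrite mulr_ge0 ?wt_ge0 ?cabs_ge0.
by apply: le_trans (normB_le h0 h1) _; rewrite lee_fin.
Qed.

(** At each z the weighted derivatives are dominated by humps at the numbers m_j (1 - |z|), which at
    least double; the telescoped sum is below 1 for any number of terms. *)
Lemma tst_sum_unitB al (a : nat -> C) (m : nat -> nat) (d : nat -> C * C * C) (s : nat -> nat) J :
  1 < al -> (forall j, (0 < m j)%N) -> (forall i j, (i < j)%N -> (2 * m i <= m j)%N) ->
  (forall j, small5 (d j)) -> (forall j, 1 / 2 <= cabs (a j) ^+ m j) -> (forall j, cabs (a j) < 1) ->
  {homo s : i j / (i < j)%N >-> (i < j)%N} ->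
  unitB al (fun z => \sum_(j < J) tst (tstK al (m (s j))) (a (s j)) (m (s j)) (d (s j)) z).
Proof.
move=> al1 m0 m2 d5 am a1 hs.
pose F (j : nat) := tst (tstK al (m (s j))) (a (s j)) (m (s j)) (d (s j)).
have D z : cdiff (fun z => \sum_(j < J) F j z) z (\sum_(j < J) cder (F j) z).
  apply: (cdiff_sum (index_enum 'I_J) (F := fun j : 'I_J => F j) (D := fun j : 'I_J => cder (F j) z)) => j.
  by rewrite /F cder_tst; exact: cdiff_tst.
apply: (@unitBP _ _ 0 1).
- by move=> z _; exact: cdiff_derivable (D z).
- by rewrite big1 ?cabs0 // => j _; exact: tst0.
- move=> z hz; rewrite (cdiff_cder (D z)).
  have t0 : 0 < 1 - cabs z by move: hz; rewrite /disk /=; lra.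
  apply: le_trans (ler_wpM2l (wt_ge0 _ _) (cabs_sum _ _ _)) _.
  rewrite mulr_sumr.
  apply: le_trans (@hump_telescope _ (fun j => (m (s j))%:R * (1 - cabs z)) J _ _).
  + by apply: ler_sum => j _; exact: tst_hump.
  + by move=> j; rewrite mulr_gt0 // ltr0n.
  + move=> j; rewrite mulrA; apply: ler_wpM2r; first exact: ltW.
    by rewrite -natrM ler_nat m2 // hs.
- by rewrite add0r.
Qed.

Lemma cder2_sub f g (z : C) : holo f -> holo g -> disk z ->
  cder (cder (fun w => f w - g w)) z = cder (cder f) z - cder (cder g) z.
Proof.
move=> hf hg hz; have -> : (fun w => f w - g w) = (fun w => f w + (-1) * g w).
  by apply/funext => w; rewrite mulN1r.
by apply: (etrans (cder2_lin (-1) hf hg hz)); rewrite mulN1r.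
Qed.

(** With J + 1 terms the operator is never evaluated at an empty sum. Its linearity holds on the
    disk only, and [cder2_ext] transfers it to second derivatives. *)
Lemma compact_sum al be K (G : nat -> cfun R) J z : compact_op al be K ->
  (forall j, inB al (G j)) -> (forall J, inB al (fun z => \sum_(j < J) G j z)) -> disk z ->
  cder (cder (K (fun z => \sum_(j < J.+1) G j z))) z = \sum_(j < J.+1) cder (cder (K (G j))) z.
Proof.
move=> [lK [ZK _]] BG BS hz.
elim: J => [|J IH].
  rewrite big_ord1; congr (cder (cder (K _)) z).
  by apply/funext => w; rewrite big_ord1.
rewrite big_ord_recr /= -IH.
pose S := fun z => \sum_(j < J.+1) G j z.
have -> : (fun z => \sum_(j < J.+2) G j z) = (fun z => S z + 1 * G J.+1 z).
  by apply/funext => w; rewrite big_ord_recr mul1r.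
have E : forall w, disk w -> K S w + 1 * K (G J.+1) w = K (fun z => S z + 1 * G J.+1 z) w.
  by move=> w hw; rewrite (lK _ _ 1 (BS J.+1) (BG J.+1) w hw).
have h1 : holo (K S) by case: (ZK _ (BS J.+1)).
have h2 : holo (K (G J.+1)) by case: (ZK _ (BG J.+1)).
apply: (etrans (cder2_ext hz E (holo_lin (a := 1) h1 h2))).
by apply: (etrans (cder2_lin 1 h1 h2 hz)); rewrite mul1r.
Qed.

Lemma cvge0_small (x : nat -> \bar R) (e : R) : (x @ \oo --> 0%E)%classic -> 0 < e ->
  exists N, forall n, (N <= n)%N -> (x n <= e%:E)%E.
Proof.
move=> /fine_cvgP[[N1 _ h1] /cvgrPdist_le /(_ e) H] e0; have [N2 _ h2] := H e0.
exists (maxn N1 N2) => n; rewrite geq_max => /andP[/h1 a /h2].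
rewrite /= sub0r normrN => b; rewrite -(fineK a) lee_fin.
by apply: le_trans (ler_norm _) b.
Qed.

(* A compact operator cannot map all the F j far from 0, since their partial
   sums along subsequences stay in the unit ball. *)
Lemma compact_vanishing al be K (Q : R) (F : nat -> cfun R) : compact_op al be K ->
  (forall f z, unitB al f -> disk z -> wt be z * cabs (cder (cder (K f)) z) <= Q) ->
  (forall s J, {homo s : i j / (i < j)%N >-> (i < j)%N} -> unitB al (fun z => \sum_(j < J) F (s j) z)) ->
  forall e, 0 < e -> exists j, forall z, disk z -> wt be z * cabs (cder (cder (K (F j))) z) <= e.
Proof.
move=> cK HQ HS e e0; have [lK [ZK sK]] := cK.
have BF j : unitB al (F j).
  have := HS (addn j) 1%N _; rewrite (_ : (fun z => _) = F j).
    by apply; move=> m n mn; rewrite ltn_add2l.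
  by apply/funext => z; rewrite big_ord1 addn0.
have [sg [g [sgi [[hg _] cv]]]] := sK F BF.
have e3 : 0 < e / 3 by lra.
have [N hN] := cvge0_small cv e3.
exists (sg N) => z hz.
pose G j := F (sg (N + j)%N).
have hG j : holo (K (G j)) by case: (ZK _ (BF (sg (N + j)%N)).1).
have W0 : 0 <= wt be z by exact: wt_ge0.
pose A := cder (cder g) z; pose B j := cder (cder (K (F (sg j)))) z.
have near j : wt be z * cabs (B (N + j)%N - A) <= e / 3.
  have [_ _ /(_ z hz)] := normZ_leP (hN (N + j)%N (leq_addr _ _)).
  by rewrite (cder2_sub (hG j) hg hz).
have gi : {homo (fun j => sg (N + j)%N) : i j / (i < j)%N >-> (i < j)%N}.
  by move=> i j ij; apply: sgi; rewrite ltn_add2l.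
have BS J : inB al (fun z => \sum_(j < J) G j z) by case: (HS _ J gi).
have Q0 : 0 <= Q.
  by apply: le_trans (HQ (F 0%N) z (BF 0%N) hz); rewrite mulr_ge0 ?cabs_ge0.
(* The images of J + 1 summands add up to (J + 1) A within a weighted error (J + 1) e / 3, and that
   sum is at most [Q]. *)
have bound J : wt be z * cabs A <= e / 3 + Q / J.+1%:R.
  have J0 : 0 < J.+1%:R :> R by [].
  have h : wt be z * cabs (\sum_(j < J.+1) B (N + j)%N) <= Q.
    have uS : unitB al (fun z => \sum_(j < J.+1) G j z) := HS _ J.+1 gi.
    have BG j : inB al (G j) := (BF _).1.
    have := HQ _ z uS hz.
    by rewrite (compact_sum J cK BG BS hz).
  rewrite -(ler_pM2r J0) mulrDl divfK ?gt_eqF //.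
  have -> : wt be z * cabs A * J.+1%:R = wt be z * cabs (\sum_(j < J.+1) A).
    by rewrite sumr_const card_ord -[A *+ _]mulr_natr cabsM cabs_nat mulrA.
  have -> : \sum_(j < J.+1) A = \sum_(j < J.+1) B (N + j)%N - \sum_(j < J.+1) (B (N + j)%N - A).
    by rewrite -sumrB; apply: eq_bigr => j _; rewrite subKr.
  apply: le_trans (ler_wpM2l W0 (cabs_subl _ _)) _; rewrite mulrDr addrC; apply: lerD => //.
  apply: le_trans (ler_wpM2l W0 (cabs_sum _ _ _)) _; rewrite mulr_sumr.
  apply: (@le_trans _ _ (\sum_(j < J.+1) (e / 3))); first by apply: ler_sum => j _; exact: near.
  by rewrite sumr_const card_ord mulr_natr.
have [J hJ] := eventually_small Q0 e3.
have := hJ J (leqnn _); have := bound J; have := near 0%N.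
rewrite addn0 => n0 b j0.
change (wt be z * cabs (B N) <= e).
clearbody A B.
have : wt be z * cabs (B N) <= wt be z * (cabs (B N - A) + cabs A).
  by apply: ler_wpM2l => //; have := cabsD (B N - A) A; rewrite subrK.
rewrite mulrDr => h; apply: le_trans h _; apply: le_trans (lerD n0 b) _.
by move: j0; generalize (Q / J.+1%:R) => q; lra.
Qed.

Lemma bounded_unitB al be (T : cfun R -> cfun R) : bounded_op al be T ->
  exists2 M : R, 0 <= M & forall f, unitB al f -> (normZ be (T f) <= M%:E)%E.
Proof.
move=> [_ [M HM]]; exists `|M| => // f [Bf nf]; apply: le_trans (HM f Bf) _.
apply: (@le_trans _ _ (`|M|%:E * normB al f)%E).
  apply: lee_wpmul2r; last by rewrite lee_fin ler_norm.
  by rewrite /normB adde_ge0 ?lee_fin ?cabs_ge0 ?wsup_ge0.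
by rewrite -[leRHS]mule1; apply: lee_wpmul2l.
Qed.

(** By contradiction: violations with |phi| ever closer to 1 yield test functions with frequencies
    that at least double. For one of them the operator K contributes at most [lam], hence the
    isolated term of the second derivative is at most 2 [lam], against the violation. *)
Lemma lower_bound al be u phi K (w : cfun R) (i : nat) (D : nat -> C * C * C) lam :
  1 < al -> holo u -> selfmap phi -> bounded_op al be (wco u phi) -> compact_op al be K -> 0 < lam ->
  (forall f, unitB al f -> (normZ be (fun z => wco u phi f z - K f z)%R <= lam%:E)%E) ->
  (i <= 2)%N -> (forall m, (0 < m)%N -> small5 (D m)) ->
  (forall z m k, disk z -> phi z != 0 -> (0 < m)%N ->
    cder (cder (wco u phi (tst k (phi z) m (D m)))) z = w z * (k * (m%:R / phi z) ^+ i)) ->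
  exists s : R, 1 / 2 <= s < 1 /\
    near_boundary be w phi (al - 1 + i%:R) (2 * tstC al * 4 `^ (al + 1) * lam) s.
Proof.
move=> al1 hu hphi bT cK l0 HTK i2 D5 HT.
have [MT MT0 hMT] := bounded_unitB bT.
have hK f : unitB al f -> holo (K f) by case=> Bf _; case: cK => _ [/(_ f Bf)[]].
have Q f z X : unitB al f -> disk z -> cder (cder (wco u phi f)) z = X ->
   wt be z * cabs (X - cder (cder (K f)) z) <= lam.
  move=> uf hz EX; have [_ _ /(_ z hz) h] := normZ_leP (HTK f uf).
  have E := cder2_sub (wco_holo hu hphi (unitB_holo uf)) (hK f uf) hz.
  by rewrite -EX -E.
have QK f z : unitB al f -> disk z -> wt be z * cabs (cder (cder (K f)) z) <= MT + lam.
  move=> uf hz; have [_ _ /(_ z hz)] := normZ_leP (hMT f uf); have := Q f z _ uf hz erefl.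
  generalize (cder (cder (wco u phi f)) z) (cder (cder (K f)) z) => A B h1 h2.
  have : wt be z * cabs B <= wt be z * (cabs A + cabs (A - B)).
    apply: ler_wpM2l; first exact: wt_ge0.
    by have := cabs_subl A (A - B); rewrite subKr.
  by rewrite mulrDr; lra.
apply: contrapT => Hneg.
pose p := al - 1 + i%:R; pose Cst := 2 * tstC al * 4 `^ (al + 1) * lam.
(* Failure of the threshold 1 - q, for every n, provides violations of arbitrarily high
   frequency. *)
have /choice[Z hZ] : forall n : nat, exists z, [/\ disk z, 1 / 2 <= cabs (phi z) < 1,
    (n < freq (cabs (phi z)))%N & Cst * (1 - cabs (phi z)) `^ p < wt be z * cabs (w z)].
  move=> n; pose q : R := (4 * n.+1%:R)^-1.
  have q0 : 0 < q by rewrite invr_gt0 mulr_gt0.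
  have n1 : 1 <= n.+1%:R :> R by rewrite ler1n.
  have q1 : q <= 1 / 2 by rewrite /q -[leLHS]mul1r ler_pdivrMr ?mulr_gt0 //; lra.
  apply: contrapT => Hn; apply: Hneg; exists (1 - q); split; first by apply/andP; split; lra.
  move=> z hz sz; rewrite leNgt; apply/negP => h; apply: Hn; exists z.
  have x1 : cabs (phi z) < 1 by case: hphi => _ /(_ z hz).
  have hx : 1 / 2 <= cabs (phi z) < 1 by apply/andP; split; lra.
  by split => //; apply: freq_ge => //; rewrite -/q; lra.
(* Restarting the choice from twice the current frequency makes the frequencies at least double. *)
pose y (j : nat) : C := iter j (fun z => Z (2 * freq (cabs (phi z)))%N) (Z 0%N).
have hy j : [/\ disk (y j), 1 / 2 <= cabs (phi (y j)) < 1 &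
    Cst * (1 - cabs (phi (y j))) `^ p < wt be (y j) * cabs (w (y j))].
  by case: j => [|j] /=; [have [] := hZ 0%N | have [] := hZ (2 * freq (cabs (phi (y j))))%N].
pose m j := freq (cabs (phi (y j))).
have mS j : (2 * m j <= m j.+1)%N.
  by apply: ltnW; have [_ _ h _] := hZ (2 * m j)%N.
have m0 j : (0 < m j)%N by have [_ /freqP[]] := hy j.
have m2 a b : (a < b)%N -> (2 * m a <= m b)%N.
  elim: b => // b IH; rewrite ltnS leq_eqVlt => /orP[/eqP -> //|/IH h].
  by apply: leq_trans (mS b); rewrite leq_mul2l /= (leq_trans _ h) // mul2n -addnn leq_addr.
have am j : 1 / 2 <= cabs (phi (y j)) ^+ m j by have [_ /freqP[]] := hy j.
have a1 j : cabs (phi (y j)) < 1 by have [_ /andP[]] := hy j.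
pose F j := tst (tstK al (m j)) (phi (y j)) (m j) (D (m j)).
have HS s J : {homo s : i j / (i < j)%N >-> (i < j)%N} -> unitB al (fun z => \sum_(j < J) F (s j) z).
  move=> hs; apply: (@tst_sum_unitB al (fun j => phi (y j)) m (fun j => D (m j)) s J) => // j.
  exact: D5.
have [j hj] := compact_vanishing cK QK HS l0.
have [hyj /andP[h12 hx1] hviol] := hy j.
have uF : unitB al (F j).
  have := HS (addn j) 1%N; rewrite (_ : (fun z => _) = F j).
    by apply; move=> a b ab; rewrite ltn_add2l.
  by apply/funext => z; rewrite big_ord1 addn0.
have phi0 : phi (y j) != 0 by rewrite -cabs_gt0; lra.
pose B := cder (cder (K (F j))) (y j).
pose A := w (y j) * (tstK al (m j) * ((m j)%:R / phi (y j)) ^+ i).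
have hA : wt be (y j) * cabs (A - B) <= lam.
  exact: Q uF hyj (HT (y j) (m j) (tstK al (m j)) hyj phi0 (m0 j)).
have hB : wt be (y j) * cabs B <= lam := hj (y j) hyj.
clearbody B.
have W0 : 0 <= wt be (y j) by exact: wt_ge0.
have hAA : wt be (y j) * cabs A <= 2 * lam.
  have : wt be (y j) * cabs A <= wt be (y j) * (cabs (A - B) + cabs B).
    by apply: ler_wpM2l => //; have := cabsD (A - B) B; rewrite subrK.
  by rewrite mulrDr; lra.
have C0 := tstC_gt0 al1.
have mp : 0 < (m j)%:R :> R by rewrite ltr0n.
set x := cabs (phi (y j)) in h12 hx1 hviol.
have x0 : 0 < x by lra.
have cA : cabs A = cabs (w (y j)) * ((m j)%:R `^ (al - 1) / tstC al * ((m j)%:R / x) ^+ i).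
  rewrite /A !cabsM cabsX cabsM cabsV cabs_nat /tstK cabs_real ger0_norm //.
  by rewrite divr_ge0 ?powR_ge0 // ltW.
have mpE : (m j)%:R `^ p = (m j)%:R `^ (al - 1) * (m j)%:R ^+ i.
  by rewrite /p powRD_gt0 // powR_mulrn // ltW.
have wge0 : 0 <= wt be (y j) * cabs (w (y j)) by rewrite mulr_ge0 ?cabs_ge0.
have h1 : wt be (y j) * cabs (w (y j)) * (m j)%:R `^ p <= 2 * lam * tstC al.
  rewrite -ler_pdivrMr //; apply: le_trans hAA; rewrite cA mpE.
  rewrite -!mulrA; apply: ler_wpM2l => //; apply: ler_wpM2l; first exact: cabs_ge0.
  apply: ler_wpM2l; first exact: powR_ge0.
  rewrite mulrC; apply: ler_wpM2l; first by rewrite invr_ge0 ltW.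
  apply: lerXn2r; rewrite ?nnegrE ?divr_ge0 ?(ltW mp) ?(ltW x0) //.
  by rewrite ler_pdivlMr // -[leRHS]mulr1; apply: ler_wpM2l; lra.
have [_ h4 _] := @freqP _ x ltac:(lra).
have t0 : 0 < 1 - x by lra.
have pge : 0 <= p by rewrite /p addr_ge0 //; lra.
(* m (1 - x) >= 1/4 trades m^p for (1 - x)^(-p); the cost 4^p is then enlarged to 4^(al + 1), which
   serves every i <= 2. *)
have h5 : 1 <= (m j)%:R `^ p * (4 `^ p * (1 - x) `^ p).
  rewrite -!powRM ?mulr_ge0 //; try lra.
  have : 1 `^ p <= ((m j)%:R * (4 * (1 - x))) `^ p; last by rewrite powR1.
  apply: ge0_ler_powR; rewrite ?nnegrE //; first by rewrite !mulr_ge0 //; lra.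
  by rewrite -/(m j) in h4; lra.
have h6 : 4 `^ p <= 4 `^ (al + 1) :> R.
  apply: ler_powR; first lra.
  have : i%:R <= 2 :> R by rewrite (ler_nat R i 2).
  by rewrite /p; lra.
have tp : 0 < (1 - x) `^ p by exact: powR_gt0.
move: hviol; apply/negP; rewrite -leNgt.
apply: (@le_trans _ _ (wt be (y j) * cabs (w (y j)) * (m j)%:R `^ p * (4 `^ p * (1 - x) `^ p))).
  by rewrite -mulrA -[leLHS]mulr1; apply: ler_wpM2l.
apply: le_trans (ler_wpM2r _ h1) _; first by rewrite mulr_ge0 ?powR_ge0.
rewrite /Cst [leRHS](_ : _ = 2 * lam * tstC al * (4 `^ (al + 1) * (1 - x) `^ p)); last by ring.
apply: ler_wpM2l.
  by apply: mulr_ge0 (ltW C0); apply: mulr_ge0 (ltW l0); exact: ler0n.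
apply: ler_wpM2r h6; exact: ltW.
Qed.

Lemma lower_bounds al be u phi K lam :
  1 < al -> holo u -> selfmap phi -> bounded_op al be (wco u phi) -> compact_op al be K -> 0 < lam ->
  (forall f, unitB al f -> (normZ be (fun z => wco u phi f z - K f z)%R <= lam%:E)%E) ->
  let c := 2 * tstC al * 4 `^ (al + 1) in
  [/\ exists s : R, 1 / 2 <= s < 1 /\ near_boundary be (coef1 u phi) phi al (c * lam) s,
      exists s : R, 1 / 2 <= s < 1 /\ near_boundary be (coef2 u phi) phi (al + 1) (c * lam) s &
      exists s : R, 1 / 2 <= s < 1 /\ near_boundary be (coef0 u) phi (al - 1) (c * lam) s].
Proof.
move=> al1 hu hphi bT cK l0 HTK c.
have LB w i D := @lower_bound al be u phi K w i D lam al1 hu hphi bT cK l0 HTK.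
have E k (z : C) m d : disk z -> cder (cder (wco u phi (tst k (phi z) m d))) z =
    coef0 u z * tst k (phi z) m d (phi z) + coef1 u phi z * tst1 k (phi z) m d (phi z)
    + coef2 u phi z * tst2 k (phi z) m d (phi z).
  move=> hz; apply: (etrans (cder2_wco hu hphi (@holo_tst R k (phi z) m d) hz)).
  by rewrite cder2_tst cder_tst.
split.
- have [] := LB (coef1 u phi) 1%N jet1 isT (@jet1_small R) _.
    move=> z m k hz p0 m0; rewrite E //; have [-> -> ->] := jet1_at k p0 m0.
    by rewrite !mulr0 add0r addr0 expr1.
  by move=> s [hs hn]; exists s; rewrite subrK in hn.
- have [] := LB (coef2 u phi) 2%N jet2 isT (fun m _ => jet2_small m) _.
    move=> z m k hz p0 m0; rewrite E //; have [-> -> ->] := jet2_at k p0 m0.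
    by rewrite !mulr0 !add0r.
  by move=> s [hs hn]; exists s; rewrite (_ : al + 1 = al - 1 + 2%:R) //; ring.
- have [] := LB (coef0 u) 0%N jet0 isT (fun m _ => jet0_small m) _.
    move=> z m k hz p0 m0; rewrite E //; have [-> -> ->] := jet0_at k p0 m0.
    by rewrite !mulr0 !addr0 expr0 mulr1.
  by move=> s [hs hn]; exists s; rewrite addr0 in hn.
Qed.

End LowerBound.

(** * Rate of convergence of the discrete Cauchy formula *)

Section Refinement.
Context {R : realType}.
Local Notation C := (CC R).
Implicit Types (h F : C -> C) (z v : C).

(** A midpoint changes one trapezoid by products of an increment of h with one of y, hence by a
    multiple of the squared length; 2^n pieces of length l / 2^n give l^2 / 2^n. *)
Lemma seg_refine n h (y : R -> C) a l (H L : R) : 0 <= l -> 0 <= H -> 0 <= L ->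
  (forall s t, cabs (h (y s) - h (y t)) <= H * `|s - t|) ->
  (forall s t, cabs (y s - y t) <= L * `|s - t|) ->
  cabs (seg n.+1 h y a l - seg n h y a l) <= H * L * l ^+ 2 / 2 ^+ n.
Proof.
move=> l0 H0 L0 hH hL; elim: n a l l0 => [|n IH] a l l0.
  rewrite /= half_add /trap expr0 divr1.
  set p := y a; set m := y (a + l / 2); set q := y (a + l).
  have -> : (h p + h m) / 2 * (m - p) + (h m + h q) / 2 * (q - m) - (h p + h q) / 2 * (q - p) =
     - ((h q - h m) / 2 * (m - p) + (h p - h m) / 2 * (q - m)) by ring.
  rewrite cabsN; apply: le_trans (cabsD _ _) _; rewrite !cabsM cabsV cabs_nat.
  have l2 : `|l / 2| = l / 2 by rewrite ger0_norm //; lra.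
  have h1 := hH (a + l) (a + l / 2); have h2 := hH a (a + l / 2).
  have h3 := hL (a + l / 2) a; have h4 := hL (a + l) (a + l / 2).
  rewrite -/p -/m -/q in h1 h2 h3 h4.
  have e1 : a + l - (a + l / 2) = l / 2 by field.
  have e2 : a - (a + l / 2) = - (l / 2) by field.
  have e3 : a + l / 2 - a = l / 2 by field.
  rewrite e1 l2 in h1 h4; rewrite e2 normrN l2 in h2; rewrite e3 l2 in h3.
  have k1 : cabs (h q - h m) * cabs (m - p) <= H * (l / 2) * (L * (l / 2)) by apply: ler_pM; rewrite ?cabs_ge0.
  have k2 : cabs (h p - h m) * cabs (q - m) <= H * (l / 2) * (L * (l / 2)) by apply: ler_pM; rewrite ?cabs_ge0.
  have k3 : 0 <= H * L * l ^+ 2 by rewrite !mulr_ge0 ?exprn_ge0.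
  lra.
rewrite -[seg n.+2 h y a l]/(seg n.+1 h y a (l / 2) + seg n.+1 h y (a + l / 2) (l / 2)).
rewrite -[in X in _ - X]/(seg n h y a (l / 2) + seg n h y (a + l / 2) (l / 2)).
have -> (A B A' B' : C) : A + B - (A' + B') = (A - A') + (B - B') by ring.
apply: le_trans (cabsD _ _) _.
have l20 : 0 <= l / 2 by lra.
apply: le_trans (lerD (IH a _ l20) (IH (a + l / 2) _ l20)) _.
rewrite le_eqVlt; apply/orP; left; apply/eqP; rewrite [2 ^+ n.+1]exprS; field.
by rewrite expf_neq0.
Qed.

(** Goursat yields the limit 0 without a rate; the rate comes from summing the geometric tail of the
    increments. *)
Lemma vanishing_geometric (x : nat -> C) (c : R) : 0 <= c -> vanishes x ->
  (forall n, cabs (x n.+1 - x n) <= c / 2 ^+ n) -> forall n, cabs (x n) <= 2 * c / 2 ^+ n.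
Proof.
move=> c0 vx hx n.
have p k : 0 < 2 ^+ k :> R by rewrite exprn_gt0.
have H k : cabs (x n) <= cabs (x (n + k)%N) + 2 * c / 2 ^+ n - 2 * c / 2 ^+ (n + k).
  elim: k => [|k IH]; first by rewrite addn0 addrK.
  apply: le_trans IH _; rewrite addnS.
  have := hx (n + k)%N; have := cabsB (x (n + k)%N) (x (n + k).+1); rewrite cabs_distrC.
  have -> : 2 * c / 2 ^+ (n + k).+1 = c / 2 ^+ (n + k).
    by rewrite exprS; field; rewrite expf_neq0.
  have -> : 2 * c / 2 ^+ (n + k) = 2 * (c / 2 ^+ (n + k)) by rewrite mulrA.
  by generalize (c / 2 ^+ (n + k)) => b; lra.
apply/ler_addgt0Pl => e e0; have [N hN] := vx e e0.
have h1 := hN (n + N)%N (leq_addl _ _).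
apply: le_trans (H N) _.
have : 0 <= 2 * c / 2 ^+ (n + N) by rewrite divr_ge0 ?mulr_ge0 // ltW.
by lra.
Qed.

Lemma cint_rate h (H : R) : 0 <= H ->
  (forall v w, cabs v = 1 -> cabs w = 1 -> cabs (h v - h w) <= H * cabs (v - w)) ->
  vanishes (fun n => cint n h) -> forall n, cabs (cint n h) <= 2 * (H * eelip ^+ 2) / 2 ^+ n.
Proof.
move=> H0 hH vh; have L0 : 0 <= eelip :> R by rewrite ltW ?eelip_gt0.
apply: vanishing_geometric => //; first by rewrite mulr_ge0 ?exprn_ge0.
move=> n; have E : H * eelip * eelip * 1 ^+ 2 / 2 ^+ n = H * eelip ^+ 2 / 2 ^+ n by rewrite expr1n; ring.
rewrite -E; apply: (seg_refine _ _ ler01 (mulr_ge0 H0 L0) L0 _ (@ee_lip R)) => s t.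
apply: le_trans (hH _ _ (cabs_ee s) (cabs_ee t)) _; rewrite -mulrA.
by apply: ler_wpM2l => //; exact: ee_lip.
Qed.

(** The integrand [e] turns the whole error into a single trapezoid sum, as [cc n] is the sum for 1
    / w. Its Lipschitz constant on the circle involves F only through M and L, so the rate is common
    to all f in the unit ball. *)
Lemma approx_rate F z (q M L : R) : cdisk F -> 0 < q -> cabs z <= 1 - q -> 0 <= L ->
  (forall v, cabs v <= 1 -> cabs (F v) <= M) ->
  (forall v w, cabs v <= 1 -> cabs w <= 1 -> cabs (F v - F w) <= L * cabs (v - w)) ->
  forall n, (2 <= n)%N ->
  cabs (approx F n z - F z) <= 2 * ((L / q + 2 * M / q ^+ 2 + M * (1 / q ^+ 2 + 1)) * eelip ^+ 2) / 2 ^+ n.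
Proof.
move=> HF q0 hz L0 HM HL n n2.
have z1 : cabs z < 1 by lra.
have M0 : 0 <= M by apply: le_trans (HM 0 _); rewrite ?cabs_ge0 ?cabs0.
pose e w := slope F z w + F z * ((w - z)^-1 - w^-1).
have eE m : cint m e = cint m (slope F z) + F z * (cint m (fun w => (w - z)^-1) - cc m).
  by rewrite /e cintD cintZ cintB.
have ve : vanishes (fun m => cint m e).
  have := @vanishesD _ (fun m => cint m (slope F z)) (fun m => F z * (cint m (fun w => (w - z)^-1) - cc m)).
  move=> H; suff -> : (fun m => cint m e) = (fun m => cint m (slope F z) + F z * (cint m (fun w => (w - z)^-1) - cc m)).
    apply: H; first exact: cint_slope.
    apply: (@vanishes_le _ _ _ (cabs (F z)) 0 (cint_kernel z1)) => k _.
    by rewrite cabsM.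
  by apply/funext.
rewrite approx_split // -eE cabsM cabsV.
set Lam := L / q + 2 * M / q ^+ 2 + M * (1 / q ^+ 2 + 1).
have q2 : 0 < q ^+ 2 by rewrite exprn_gt0.
have iq0 : 0 < q^-1 by rewrite invr_gt0.
have Lam0 : 0 <= Lam.
  rewrite /Lam; apply: addr_ge0; first apply: addr_ge0.
  - by rewrite divr_ge0 // ltW.
  - by rewrite divr_ge0 ?mulr_ge0 // ltW.
  - by rewrite mulr_ge0 // addr_ge0 // divr_ge0 // ltW.
have lip v w : cabs v = 1 -> cabs w = 1 -> cabs (e v - e w) <= Lam * cabs (v - w).
  move=> v1 w1.
  have vz : q <= cabs (v - z) by have := circle_sub z v1; lra.
  have wz : q <= cabs (w - z) by have := circle_sub z w1; lra.
  have vz0 : v - z != 0 by rewrite -cabs_gt0; lra.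
  have wz0 : w - z != 0 by rewrite -cabs_gt0; lra.
  have v0 : v != 0 by rewrite -cabs_gt0; lra.
  have w0 : w != 0 by rewrite -cabs_gt0; lra.
  have -> : e v - e w = (F v - F w) * (v - z)^-1 + ((F w - F z) * (w - v) * ((v - z)^-1 * (w - z)^-1)
     + F z * (w - v) * ((v - z)^-1 * (w - z)^-1 - v^-1 * w^-1)).
    by rewrite /e /slope; field; rewrite vz0 wz0 v0 w0.
  have i1 : cabs (v - z)^-1 <= q^-1 by rewrite cabsV lef_pV2 ?posrE //; lra.
  have i2 : cabs (w - z)^-1 <= q^-1 by rewrite cabsV lef_pV2 ?posrE //; lra.
  have i3 : cabs ((v - z)^-1 * (w - z)^-1) <= q^-1 ^+ 2.
    by rewrite cabsM expr2; apply: ler_pM; rewrite ?cabs_ge0.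
  have i4 : cabs ((v - z)^-1 * (w - z)^-1 - v^-1 * w^-1) <= q^-1 ^+ 2 + 1.
    apply: le_trans (cabs_subl _ _) _; apply: lerD => //.
    by rewrite cabsM !cabsV v1 w1 invr1 mulr1.
  have D0 := cabs_ge0 (v - w).
  apply: le_trans (cabsD _ _) _; apply: le_trans (lerD (lexx _) (cabsD _ _)) _.
  have t1 : cabs ((F v - F w) * (v - z)^-1) <= L * cabs (v - w) * q^-1.
    by rewrite cabsM; apply: ler_pM; rewrite ?cabs_ge0 // HL ?v1 ?w1.
  have t2 : cabs ((F w - F z) * (w - v) * ((v - z)^-1 * (w - z)^-1)) <= 2 * M * cabs (v - w) * q^-1 ^+ 2.
    rewrite cabsM; apply: ler_pM; rewrite ?cabs_ge0 // cabsM (cabs_distrC w v).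
    apply: ler_wpM2r => //; apply: le_trans (cabs_subl _ _) _.
    have := HM w; have := HM z; rewrite w1 (ltW z1) => /(_ isT) ? /(_ (lexx _)) ?; lra.
  have t3 : cabs (F z * (w - v) * ((v - z)^-1 * (w - z)^-1 - v^-1 * w^-1)) <= M * cabs (v - w) * (q^-1 ^+ 2 + 1).
    rewrite cabsM; apply: ler_pM; rewrite ?cabs_ge0 // cabsM (cabs_distrC w v).
    by apply: ler_wpM2r => //; apply: HM; exact: ltW.
  apply: le_trans (lerD t1 (lerD t2 t3)) _.
  by rewrite /Lam !div1r exprVn le_eqVlt; apply/orP; left; apply/eqP; ring.
have := cint_rate Lam0 lip ve n => h.
apply: le_trans h; rewrite -[leRHS]mulr1; apply: ler_wpM2l; first exact: cabs_ge0.
by have := @cc_ge4 R _ n2 => c4; rewrite invf_le1; lra.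
Qed.

(** Nodes and weights are independent of h; this is the source of finite rank. *)
Lemma cint_nodes n : exists s : seq (R * C), forall h,
  cint n h = \sum_(x <- s) x.2 * h (ee x.1).
Proof.
suff H (a l : R) : exists s : seq (R * C), forall h, seg n h ee a l = \sum_(x <- s) x.2 * h (ee x.1).
  exact: H.
elim: n a l => [|n IH] a l.
  exists [:: (a, (ee (a + l) - ee a) / 2); (a + l, (ee (a + l) - ee a) / 2)] => h.
  by rewrite !big_cons big_nil /= /trap; ring.
have [s1 h1] := IH a (l / 2); have [s2 h2] := IH (a + l / 2) (l / 2).
by exists (s1 ++ s2) => h; rewrite big_cat /= h1 h2.
Qed.

End Refinement.

(** * Finite rank truncations *)

Section FiniteRank.
Context {R : realType}.
Local Notation C := (CC R).
Implicit Types (al be tau : R) (u phi f g : cfun R) (n : nat) (s : seq (R * C)) (dl : R * C -> C).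

(** As [tau] < 1, the point [tau] z stays at distance at least 1 - [tau] from the circle, so each
    kernel is holomorphic on the disk with bounded derivative. *)
Definition nodesum n tau s dl : cfun R := fun z =>
  \sum_(x <- s) dl x * (x.2 / cc n * (ee x.1 - (tau%:C)%C * z)^-1).

Definition nodesum' n tau s dl : cfun R := fun z =>
  \sum_(x <- s) dl x * (x.2 / cc n * ((tau%:C)%C * (ee x.1 - (tau%:C)%C * z)^-2)).

Lemma node_lb tau (t : R) (z : C) : 0 < tau < 1 -> disk z -> 1 - tau <= cabs (ee t - (tau%:C)%C * z).
Proof.
move=> ht hz; have := cabsB (ee t) ((tau%:C)%C * z).
have := cabs_ge0 z; have : cabs z < 1 by [].
by rewrite cabs_ee cabsM cabs_real gtr0_norm; [nra|lra].
Qed.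

Lemma cdiff_nodesum n tau s dl z : 0 < tau < 1 -> disk z ->
  cdiff (nodesum n tau s dl) z (nodesum' n tau s dl z).
Proof.
move=> ht hz; apply: (cdiff_sum s (F := fun x z => dl x * (x.2 / cc n * (ee x.1 - (tau%:C)%C * z)^-1))
  (D := fun x => dl x * (x.2 / cc n * ((tau%:C)%C * (ee x.1 - (tau%:C)%C * z)^-2)))) => x.
apply: cdiffZ; apply: cdiffZ.
have n0 : ee x.1 - (tau%:C)%C * z != 0.
  by rewrite -cabs_gt0; have := @node_lb tau x.1 z ht hz; lra.
have := cdiff_comp (cdiffB (cdiff_cst (ee x.1) z) (cdiffZ (tau%:C)%C (cdiff_id z))) (cdiff_inv n0).
by rewrite (_ : - _ * _ = (tau%:C)%C * (ee x.1 - (tau%:C)%C * z)^-2) //; ring.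
Qed.

Lemma nodesum_normB al n tau s dl : 0 <= al -> (2 <= n)%N -> 0 < tau < 1 ->
  inB al (nodesum n tau s dl) /\
  (normB al (nodesum n tau s dl) <=
    ((\sum_(x <- s) cabs (dl x) * cabs x.2) * (1 + 2 `^ al / (1 - tau) ^+ 2))%:E)%E.
Proof.
move=> al0 n2 ht; set S := \sum_(x <- s) _.
have S0 : 0 <= S by apply: sumr_ge0 => x _; rewrite mulr_ge0 ?cabs_ge0.
have c4 := @cc_ge4 R _ n2.
have t2 : 0 < (1 - tau) ^+ 2 by rewrite exprn_gt0 //; lra.
have ci : cabs (cc n)^-1 <= 1 :> R by rewrite cabsV invf_le1; lra.
have xc (x : R * C) : cabs (x.2 / cc n) <= cabs x.2.
  by rewrite cabsM -[leRHS]mulr1; apply: ler_wpM2l => //; exact: cabs_ge0.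
have h0 : cabs (nodesum n tau s dl 0) <= S.
  apply: le_trans (cabs_sum _ _ _) _; apply: ler_sum => x _.
  rewrite mulr0 subr0 cabsM; apply: ler_wpM2l; first exact: cabs_ge0.
  by rewrite cabsM cabsV cabs_ee invr1 mulr1.
have h1 z : disk z -> wt al z * cabs (cder (nodesum n tau s dl) z) <= S * (2 `^ al / (1 - tau) ^+ 2).
  move=> hz; rewrite (cdiff_cder (cdiff_nodesum n s dl ht hz)).
  have w2 : wt al z <= 2 `^ al.
    apply: le_trans (wt_ub al0 hz) _; rewrite -[leRHS]mulr1; apply: ler_wpM2l; first exact: powR_ge0.
    have : (1 - cabs z) `^ al <= 1 `^ al; last by rewrite powR1.
    by have := cabs_ge0 z; move: hz; rewrite /disk /= => *; apply: ge0_ler_powR; rewrite ?nnegrE; lra.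
  rewrite mulrCA; apply: ler_pM; rewrite ?wt_ge0 ?cabs_ge0 //.
  rewrite mulr_suml; apply: le_trans (cabs_sum _ _ _) _; apply: ler_sum => x _.
  rewrite cabsM -[leRHS]mulrA; apply: ler_wpM2l; first exact: cabs_ge0.
  rewrite cabsM; apply: ler_pM; rewrite ?cabs_ge0 //.
  have lb := @node_lb tau x.1 z ht hz.
  rewrite cabsM cabs_real cabsV cabsX gtr0_norm; last lra.
  rewrite -[leRHS]mul1r; apply: ler_pM; rewrite ?invr_ge0 ?exprn_ge0 ?cabs_ge0 //; try lra.
  rewrite lef_pV2 ?posrE ?exprn_gt0 //; try lra.
  by apply: lerXn2r; rewrite ?nnegrE; lra.
have hh : holo (nodesum n tau s dl) by move=> z hz; exact: cdiff_derivable (cdiff_nodesum n s dl ht hz).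
split; last by rewrite mulrDr mulr1; exact: normB_le h0 h1.
split => //; apply/wsup_finP; exists (S * (2 `^ al / (1 - tau) ^+ 2)) => //.
by rewrite mulr_ge0 // divr_ge0 ?powR_ge0 // ltW.
Qed.

(** Approximates f(tau^2 z): one factor [tau] makes f available on the closed disk, the other keeps
    the evaluation point away from the nodes. *)
Definition trunc_op n tau f : cfun R := fun z => approx (rescale f 0 tau) n ((tau%:C)%C * z).

Lemma trunc_opE n tau : exists s, forall f, trunc_op n tau f =
  nodesum n tau s (fun x => rescale f 0 tau (ee x.1)).
Proof.
have [s hs] := @cint_nodes R n; exists s => f; apply/funext => z.
rewrite /trunc_op /approx hs /nodesum mulr_suml; apply: eq_bigr => x _.
by rewrite -!mulrA; ring.
Qed.

Lemma small_cvge0 (x : nat -> \bar R) : (forall n, (0 <= x n)%E) ->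
  (forall e : R, 0 < e -> exists N, forall n, (N <= n)%N -> (x n <= e%:E)%E) -> (x @ \oo --> 0%E)%classic.
Proof.
move=> x0 H; apply/fine_cvgP; split.
  have [N hN] := H 1 ltr01; exists N => // n Nn /=.
  by rewrite ge0_fin_numE //; apply: le_lt_trans (hN n Nn) (ltry _).
apply/cvgrPdist_le => e e0; have [N hN] := H e e0; exists N => // n Nn /=.
have fn : (x n \is a fin_num)%E by rewrite ge0_fin_numE //; apply: le_lt_trans (hN n Nn) (ltry _).
rewrite sub0r normrN ger0_norm ?fine_ge0 //.
by rewrite -lee_fin fineK //; exact: hN.
Qed.

Lemma sum_small (T : eqType) (r : seq T) (dl : nat -> T -> C) (c : T -> R) :
  (forall x, x \in r -> vanishes (fun n => dl n x)) -> (forall x, 0 <= c x) ->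
  forall e, 0 < e -> exists N, forall n, (N <= n)%N -> \sum_(x <- r) cabs (dl n x) * c x <= e.
Proof.
move=> H c0; elim: r H => [|x r IH] H e e0; first by exists 0%N => n _; rewrite big_nil ltW.
have e2 : 0 < e / 2 by lra.
have H1 y : y \in r -> y \in x :: r by move=> hy; rewrite inE hy orbT.
have [N1 h1] := IH (fun y hy => H y (H1 y hy)) _ e2.
have p0 : 0 < c x + 1 by have := c0 x; lra.
have e3 : 0 < e / 2 / (c x + 1) by rewrite divr_gt0.
have [N2 h2] := H x (mem_head _ _) _ e3.
exists (maxn N1 N2) => n; rewrite geq_max big_cons => /andP[/h1 a /h2].
rewrite ler_pdivlMr // => b; have := c0 x; have := cabs_ge0 (dl n x); nra.
Qed.

(** Only finitely many values of f enter, and they are bounded over the unit ball. A subsequence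
    makes them converge, and boundedness of the weighted composition carries the convergence over to
    the target norm. *)
Lemma trunc_compact al be tau n u phi : 1 < al -> 0 < tau < 1 -> (2 <= n)%N -> selfmap phi ->
  bounded_op al be (wco u phi) -> compact_op al be (fun f => wco u phi (trunc_op n tau f)).
Proof.
move=> al1 ht n2 hphi bT; have al0 : 0 <= al by lra.
have [s sE] := trunc_opE n tau.
have [TZ [M HM]] := bT.
have NB dl := @nodesum_normB al n tau s dl al0 n2 ht.
split; [|split].
- move=> f g a _ _ z _; rewrite /wco !sE /nodesum.
  rewrite (_ : u z * _ + a * (u z * _) = u z * (\sum_(x <- s) rescale f 0 tau (ee x.1) *
    (x.2 / cc n * (ee x.1 - (tau%:C)%C * phi z)^-1) + a * (\sum_(x <- s) rescale g 0 tau (ee x.1) *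
    (x.2 / cc n * (ee x.1 - (tau%:C)%C * phi z)^-1)))); last by ring.
  congr (_ * _); rewrite mulr_sumr -big_split; apply: eq_bigr => x _ /=.
  by rewrite /rescale; ring.
- by move=> f _; rewrite sE; exact: TZ (NB (fun x => rescale f 0 tau (ee x.1))).1.
move=> fs hfs.
have bd k (x : R * C) : x \in s -> cabs (rescale (fs k) 0 tau (ee x.1)) <= growth0 al / (1 - tau) `^ (al - 1).
  move=> _; apply: (unitB0_ball al1 (hfs k)); first lra.
  by rewrite add0r cabsM cabs_real cabs_ee mulr1 gtr0_norm; lra.
have [sg [l [sgi hl]]] := bolzano_weierstrass_seq bd.
exists sg, (wco u phi (nodesum n tau s l)); split; first exact: sgi.
split; first exact: TZ (NB l).1.
apply: small_cvge0 => [k|e e0]; first exact: normZ_ge0.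
pose dl k x : C := rescale (fs (sg k)) 0 tau (ee x.1) - l x.
pose kap := 1 + 2 `^ al / (1 - tau) ^+ 2.
have kap0 : 0 < kap by rewrite ltr_pwDl // divr_ge0 ?powR_ge0 ?exprn_ge0 //; lra.
(* [bounded_op] does not fix the sign of M. *)
have M0 : 0 < `|M| + 1 by have := normr_ge0 M; lra.
have e1 : 0 < e / (kap * (`|M| + 1)) by rewrite divr_gt0 ?mulr_gt0.
have [N hN] := @sum_small _ s dl (fun x => cabs x.2) hl (fun x => cabs_ge0 _) _ e1.
exists N => k /hN; set S := \sum_(x <- s) _ => hS.
have -> : (fun z => wco u phi (trunc_op n tau (fs (sg k))) z - wco u phi (nodesum n tau s l) z)
   = wco u phi (nodesum n tau s (dl k)).
  apply/funext => z; rewrite /wco sE /nodesum -mulrBr -sumrB; congr (_ * _).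
  by apply: eq_bigr => x _; rewrite /dl mulrBl.
have [iB nB] := NB (dl k).
apply: le_trans (HM _ iB) _.
have nB0 : (0 <= normB al (nodesum n tau s (dl k)))%E.
  by rewrite /normB adde_ge0 ?lee_fin ?cabs_ge0 ?wsup_ge0.
apply: (@le_trans _ _ ((`|M| + 1)%:E * normB al (nodesum n tau s (dl k)))%E).
  by apply: lee_wpmul2r => //; rewrite lee_fin; have := ler_norm M; lra.
apply: (@le_trans _ _ ((`|M| + 1)%:E * (S * kap)%:E)%E).
  by apply: lee_wpmul2l => //; rewrite lee_fin ltW.
rewrite -EFinM lee_fin; move: hS; rewrite ler_pdivlMr ?mulr_gt0 //; lra.
Qed.

End FiniteRank.

(** * Upper bound for the essential norm *)

Section UpperBound.
Context {R : realType}.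
Local Notation C := (CC R).
Implicit Types (al be tau : R) (u phi f g : cfun R) (n : nat).

Lemma wt_le1 al (z : C) : 0 <= al -> disk z -> wt al z <= 1.
Proof.
move=> al0 hz; have z0 := cabs_ge0 z; have z1 : cabs z < 1 by [].
have : wt al z <= 1 `^ al; last by rewrite powR1.
by apply: ge0_ler_powR; rewrite ?nnegrE //; nra.
Qed.

Lemma wt_anti al (z w : C) : 0 <= al -> disk z -> cabs w <= cabs z -> wt al z <= wt al w.
Proof.
move=> al0 hz wz; have w0 := cabs_ge0 w; have z1 : cabs z < 1 by [].
by apply: ge0_ler_powR; rewrite ?nnegrE //; nra.
Qed.

Lemma cdiff_approx (F : C -> C) n (v : C) : cabs v < 1 -> exists d, cdiff (approx F n) v d.
Proof.
move=> v1; have [s hs] := @cint_nodes R n.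
pose D (x : R * C) := x.2 * F (ee x.1) / cc n * (- (ee x.1 - v) ^- 2 * (0 - 1)).
exists (\sum_(x <- s) D x).
have -> : approx F n = (fun v => \sum_(x <- s) x.2 * F (ee x.1) / cc n * (ee x.1 - v)^-1).
  apply/funext => w; rewrite /approx hs mulr_suml; apply: eq_bigr => x _.
  by rewrite !mulrA mulrAC.
apply: (cdiff_sum s (F := fun x v => x.2 * F (ee x.1) / cc n * (ee x.1 - v)^-1) (D := D)) => x.
apply: cdiffZ; have n0 : ee x.1 - v != 0.
  by rewrite -cabs_gt0; have := cabsB (ee x.1) v; rewrite cabs_ee; lra.
exact: (cdiff_comp (cdiffB (cdiff_cst (ee x.1) v) (cdiff_id v)) (cdiff_inv n0)).
Qed.

(** The factor 1/4 brings the difference back into the unit ball, where the growth bounds apply. *)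
Definition remainder n tau f : cfun R := fun z => 4^-1 * (f z - trunc_op n tau f z).

Lemma cabs_scale tau (w : C) : 0 < tau -> cabs (0 + (tau%:C)%C * w) = tau * cabs w.
Proof. by move=> t0; rewrite add0r cabsM cabs_real gtr0_norm. Qed.

(** The difference is f - f(tau^2 .) minus the quadrature error E at [tau] z. The first part has
    seminorm at most 2 and is small on compact sets for [tau] near 1. With [tau] fixed, a large n
    makes E and its derivative small, uniformly in f. *)
Lemma trunc_approximates al (eta s : R) : 1 < al -> 0 < eta -> 0 <= s < 1 ->
  exists tau n, [/\ 0 < tau < 1, (2 <= n)%N & forall f, unitB al f ->
    unitB al (remainder n tau f) /\ forall w, cabs w <= s -> cabs (remainder n tau f w) <= eta].
Proof.
move=> al1 eta0 hs; have p0 := pi_gt0 R.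
have al0 : 0 <= al by lra.
pose L := ((1 - s) `^ al)^-1.
have L0 : 0 < L by rewrite invr_gt0 powR_gt0; lra.
(* L bounds |f'| on the ball of radius s, and 1 - tau^2 <= 2 e, so f - f(tau^2 .) is at most 2 L e
   there. *)
pose e := Num.min (1 / 2) (eta / (2 * L)).
have e0 : 0 < e by rewrite lt_min; apply/andP; split; [lra|rewrite divr_gt0 // mulr_gt0].
have e1 : e <= 1 / 2 by rewrite ge_min lexx.
have eL : 2 * L * e <= eta.
  have : e <= eta / (2 * L) by rewrite ge_min lexx orbT.
  by rewrite ler_pdivlMr ?mulr_gt0 //; lra.
pose tau := 1 - e; have ht : 0 < tau < 1 by rewrite /tau; lra.
have t0 : 0 < tau by lra.
pose M := growth0 al / (1 - tau) `^ (al - 1); pose L2 := ((1 - tau) `^ al)^-1.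
have L20 : 0 <= L2 by rewrite invr_ge0 powR_ge0.
have M0 : 0 <= M by have [g2 _] := growth0P al1; rewrite divr_ge0 ?powR_ge0 //; lra.
pose q := (1 - tau) / 2; have q0 : 0 < q by rewrite /q; lra.
have q20 : 0 < q ^+ 2 by rewrite exprn_gt0.
pose c := 2 * ((L2 / q + 2 * M / q ^+ 2 + M * (1 / q ^+ 2 + 1)) * eelip ^+ 2).
have c0 : 0 <= c.
  have a1 : 0 <= L2 / q by rewrite divr_ge0 // ltW.
  have a2 : 0 <= M / q ^+ 2 by rewrite divr_ge0 // ltW.
  rewrite /c mulr_ge0 // mulr_ge0 ?exprn_ge0 ?(ltW eelip_gt0) //.
  have -> : L2 / q + 2 * M / q ^+ 2 + M * (1 / q ^+ 2 + 1) = L2 / q + (M / q ^+ 2) * 3 + M by ring.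
  by lra.
(* The last entry turns the Cauchy estimate with radius (1 - [tau])/4 into |E'| <= 1/2. *)
pose eta2 := Num.min (Num.min eta (1 / 2)) ((1 - tau) / (32 * pi)).
have eta20 : 0 < eta2.
  rewrite !lt_min; apply/andP; split; first by apply/andP; split; lra.
  by rewrite divr_gt0 ?mulr_gt0 //; lra.
have eta2a : eta2 <= eta by rewrite !ge_min lexx.
have eta2b : eta2 <= 1 / 2 by rewrite !ge_min lexx orbT.
have eta2c : eta2 * (32 * pi) <= 1 - tau.
  by rewrite -ler_pdivlMr ?mulr_gt0 // !ge_min lexx orbT.
have [N hN] := eventually_small c0 eta20.
pose n := maxn N 2.
have n2 : (2 <= n)%N by exact: leq_maxr.
have cn : c / 2 ^+ n <= eta2.
  apply: le_trans (hN n (leq_maxl _ _)); apply: ler_wpM2l => //.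
  rewrite lef_pV2 ?posrE ?exprn_gt0 //.
  by rewrite -natrX ler_nat ltn_expl.
exists tau, n; split; [exact: ht|exact: n2|move=> f uf].
have hf := unitB_holo uf.
pose F : C -> C := rescale f 0 tau.
have tz : cabs (0 : C) + tau < 1 by rewrite cabs0; lra.
have cF : cdisk F by exact: rescale_cdisk.
have FM v : cabs v <= 1 -> cabs (F v) <= M.
  move=> v1; apply: (unitB0_ball al1 uf); first lra.
  by rewrite cabs_scale //; nra.
have FL v w : cabs v <= 1 -> cabs w <= 1 -> cabs (F v - F w) <= L2 * cabs (v - w).
  move=> v1 w1.
  have := @mean_value_disk _ f (0 + (tau%:C)%C * w) (0 + (tau%:C)%C * v) tau L2 hf ltac:(lra).
  rewrite !cabs_scale // => /(_ _ _ _)/wrap[||z hz|h].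
  - by nra.
  - by nra.
  - by apply: (unitB1_ball al1 uf) => //; lra.
  apply: le_trans h _; apply: ler_wpM2l => //.
  have -> : 0 + (tau%:C)%C * v - (0 + (tau%:C)%C * w) = (tau%:C)%C * (v - w) by ring.
  by rewrite cabsM cabs_real gtr0_norm //; have := cabs_ge0 (v - w); nra.
pose E v := approx F n v - F v.
have hE v : cabs v <= 1 - q -> cabs (E v) <= eta2.
  move=> hv; apply: le_trans cn.
  exact: (approx_rate cF q0 hv L20 FM FL n2).
have E_holo : holo (E : cfun R).
  move=> v hv; have [d hd] := @cdiff_approx F n v hv.
  have [d' hd'] := cF v (ltW hv).
  exact: cdiff_derivable (cdiffB hd hd').
have E' v : cabs v <= tau -> cabs (cder (E : cfun R) v) <= 1 / 2.
  move=> hv; have r0 : 0 < (1 - tau) / 4 by lra.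
  have := @cauchy_estimate _ (E : cfun R) v ((1 - tau) / 4) eta2 E_holo r0 ltac:(lra).
  move=> /(_ _)/wrap[w hw|h].
    by apply: hE; have := cabsD (w - v) v; rewrite subrK /q; lra.
  apply: le_trans h _; rewrite ler_pdivrMr //; lra.
pose r := tau * tau.
have r0 : 0 < r by rewrite mulr_gt0.
have r1 : r < 1 by rewrite /r; nra.
have rz : cabs (0 : C) + r < 1 by rewrite cabs0; lra.
pose fr : cfun R := rescale f 0 r; pose Er : cfun R := rescale E 0 tau.
have remE z : remainder n tau f z = 4^-1 * ((f z - fr z) - Er z).
  rewrite /remainder /trunc_op -/F /fr /Er /rescale /E /F /rescale; congr (_ * _).
  have -> : (r%:C)%C = (tau%:C)%C * (tau%:C)%C :> C by rewrite /r rmorphM.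
  rewrite !add0r -[(tau%:C)%C * _ * z]mulrA; ring.
have D z : disk z -> cdiff (remainder n tau f) z (4^-1 * ((cder f z - cder f (0 + (r%:C)%C * z) * (r%:C)%C)
    - cder (E : cfun R) (0 + (tau%:C)%C * z) * (tau%:C)%C)).
  move=> hz; have -> : remainder n tau f = (fun z => 4^-1 * ((f z - fr z) - Er z)) by apply/funext.
  have z1 : cabs z <= 1 by exact: ltW.
  apply: cdiffZ; apply: cdiffB; first apply: cdiffB; first exact: holo_cdiff.
  - by apply: rescale_cdiff; apply: holo_cdiff => //; exact: rescale_disk.
  - by apply: rescale_cdiff; apply: holo_cdiff => //; exact: rescale_disk.
have q4 : cabs (4^-1 : C) = 4^-1 by rewrite cabsV cabs_nat.
split.
(* (1/2)/4 bounds the value at 0, and (1 + 1 + 1/2)/4 the seminorm. *)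
- apply: (@unitBP _ _ _ (1 / 8) (5 / 8)); last lra.
  + by move=> z hz; exact: cdiff_derivable (D z hz).
  + rewrite remE /fr /rescale mulr0 addr0 subrr sub0r cabsM cabsN q4.
    have : cabs (Er 0) <= eta2.
      by rewrite /Er /rescale mulr0 addr0; apply: hE; rewrite cabs0 /q; lra.
    lra.
  + move=> z hz; rewrite (cdiff_cder (D z hz)) cabsM q4.
    have z1 : cabs z < 1 by []. have z0 := cabs_ge0 z.
    have [_ w1] := normB_leP uf.2.
    have a1 := w1 z hz.
    have dr : disk (0 + (r%:C)%C * z) by apply: rescale_disk => //; exact: ltW.
    have a2 : wt al z * cabs (cder f (0 + (r%:C)%C * z) * (r%:C)%C) <= 1.
      rewrite cabsM cabs_real (gtr0_norm r0); apply: le_trans (w1 _ dr).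
      apply: ler_pM; [exact: wt_ge0|by rewrite mulr_ge0 ?cabs_ge0 // ltW|..].
        by apply: wt_anti => //; rewrite cabs_scale //; nra.
      by rewrite -[leRHS]mulr1; apply: ler_wpM2l; [exact: cabs_ge0|exact: ltW].
    have a3 : wt al z * cabs (cder (E : cfun R) (0 + (tau%:C)%C * z) * (tau%:C)%C) <= 1 * (1 / 2).
      apply: ler_pM; rewrite ?wt_ge0 ?cabs_ge0 ?wt_le1 //.
      rewrite cabsM cabs_real (gtr0_norm t0) -[leRHS]mulr1; apply: ler_pM; rewrite ?cabs_ge0 ?(ltW t0) //; last lra.
      by apply: E'; rewrite cabs_scale //; nra.
    move: a1 a2 a3; generalize (cder f z) (cder f (0 + (r%:C)%C * z) * (r%:C)%C)
      (cder (E : cfun R) (0 + (tau%:C)%C * z) * (tau%:C)%C) => X Y Z a1 a2 a3.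
    rewrite mulrCA; have : wt al z * cabs (X - Y - Z) <= wt al z * (cabs X + cabs Y + cabs Z).
      apply: ler_wpM2l; first exact: wt_ge0.
      apply: le_trans (cabs_subl _ _) _; apply: lerD => //; exact: cabs_subl.
    rewrite !mulrDr; lra.
- move=> w ws; rewrite remE cabsM q4.
  have k1 : cabs (Er w) <= eta2.
    by apply: hE; rewrite cabs_scale // /q; have := cabs_ge0 w; nra.
  have k2 : cabs (f w - fr w) <= eta.
    have := @mean_value_disk _ f (0 + (r%:C)%C * w) w s L hf ltac:(lra).
    rewrite cabs_scale // => /(_ _ _ _)/wrap[||z hz|h].
    + by have := cabs_ge0 w; nra.
    + exact: ws.
    + by apply: (unitB1_ball al1 uf) => //; lra.
    apply: le_trans h _; apply: le_trans eL; rewrite [2 * L]mulrC -mulrA; apply: ler_wpM2l; first exact: ltW.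
    have -> : w - (0 + (r%:C)%C * w) = ((1 - r)%:C)%C * w by rewrite rmorphB /= rmorph1; ring.
    rewrite cabsM cabs_real ger0_norm; last lra.
    have r2 : 1 - r <= 2 * e by rewrite /r /tau; nra.
    by have := cabs_ge0 w; nra.
  have := cabs_subl (f w - fr w) (Er w); lra.
Qed.

(** The operator applied to 1, z and z^2 bounds [coef0], [coef1] and [coef2] in turn, since |phi| <=
    1. *)
Lemma coef_bounded al be u phi : 1 < al -> holo u -> selfmap phi -> bounded_op al be (wco u phi) ->
  exists2 M : R, 0 <= M & forall z, disk z -> [/\ wt be z * cabs (coef0 u z) <= M,
    wt be z * cabs (coef1 u phi z) <= M & wt be z * cabs (coef2 u phi z) <= M].
Proof.
move=> al1 hu hphi [TZ _]; have al0 : 0 <= al by lra.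
pose P k : cfun R := fun z => z ^+ k.
have P1 k z : cder (P k) z = k%:R * z ^+ k.-1 by exact: cdiff_cder (cdiff_pow k z).
have P2 k z : cder (cder (P k)) z = k%:R * (k.-1%:R * z ^+ k.-2).
  have -> : cder (P k) = (fun z => k%:R * z ^+ k.-1) by apply/funext => w; exact: P1.
  exact: cdiff_cder (cdiffZ _ (cdiff_pow _ z)).
have hP k : holo (P k) by move=> z _; exact: cdiff_derivable (cdiff_pow k z).
have bP k : inB al (P k).
  split; first exact: hP.
  apply/wsup_finP; exists k%:R => // z hz; rewrite P1 cabsM cabs_nat.
  rewrite -[leRHS]mul1r; apply: ler_pM; rewrite ?wt_ge0 ?mulr_ge0 ?cabs_ge0 ?wt_le1 //.
  rewrite -[leRHS]mulr1; apply: ler_wpM2l => //.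
  by rewrite cabsX exprn_ile1 ?cabs_ge0 // ltW.
have hT k : exists2 M : R, 0 <= M & forall z, disk z -> wt be z *
    cabs (coef0 u z * phi z ^+ k + coef1 u phi z * (k%:R * phi z ^+ k.-1)
      + coef2 u phi z * (k%:R * (k.-1%:R * phi z ^+ k.-2))) <= M.
  have [_ /wsup_finP[M M0 HM]] := TZ _ (bP k); exists M => // z hz.
  rewrite -P1 -P2 -[phi z ^+ k]/(P k (phi z)) -(cder2_wco hu hphi (hP k) hz); exact: HM.
have [M0 M00 H0] := hT 0%N; have [M1 M10 H1] := hT 1%N; have [M2 M20 H2] := hT 2%N.
exists (M0 + (M1 + M0) + (M2 + M0 + 2 * (M1 + M0))); first lra.
move=> z hz; have := H0 z hz; have := H1 z hz; have := H2 z hz.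
have f1 : cabs (phi z) <= 1 by case: hphi => _ /(_ z hz)/ltW.
have W0 := wt_ge0 be z; have fc := cabs_ge0 (phi z).
move: f1 fc W0; generalize (coef0 u z) (coef1 u phi z) (coef2 u phi z) (phi z) (wt be z).
move=> a b c p W p1 p0 W0.
rewrite [X in cabs X](_ : _ = a * p ^+ 2 + b * (2 * p) + c * 2) => [h2|]; last by rewrite /=; ring.
rewrite [X in cabs X](_ : _ = a * p + b) => [h1|]; last by rewrite /=; ring.
rewrite [X in cabs X](_ : _ = a) => [h0|]; last by rewrite /=; ring.
have Wb (x : C) : 0 <= W * cabs x by rewrite mulr_ge0 ?cabs_ge0.
have hb : W * cabs b <= M1 + M0.
  have : W * cabs b <= W * (cabs (a * p + b) + cabs a * cabs p).
    apply: ler_wpM2l => //; rewrite -cabsM; have := cabs_subl (a * p + b) (a * p).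
    by rewrite [a * p + b]addrC addrK.
  have : W * cabs a * cabs p <= W * cabs a * 1 by apply: ler_wpM2l.
  by rewrite mulrDr; lra.
have hc : W * cabs c <= M2 + M0 + 2 * (M1 + M0).
  have E : c * 2 = (a * p ^+ 2 + b * (2 * p) + c * 2) - (a * p ^+ 2 + b * (2 * p)) by ring.
  have : W * cabs (c * 2) <= W * (cabs (a * p ^+ 2 + b * (2 * p) + c * 2) + (cabs a * cabs p ^+ 2 + cabs b * (2 * cabs p))).
    apply: ler_wpM2l => //; rewrite {1}E; apply: le_trans (cabs_subl _ _) _; apply: lerD => //.
    by apply: le_trans (cabsD _ _) _; rewrite -cabsX !cabsM cabs_nat.
  have : W * cabs a * cabs p ^+ 2 <= W * cabs a * 1 by apply: ler_wpM2l => //; rewrite exprn_ile1.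
  have : W * cabs b * cabs p <= W * cabs b * 1 by apply: ler_wpM2l.
  rewrite cabsM cabs_nat; have := Wb c; lra.
by split; lra.
Qed.

(** The 2 accounts for the function and its derivative at 0, and the 4 undoes the factor in
    [remainder]. In the bracket, the first 1 covers the points where |phi| is not close to 1, the
    other terms those where it is. *)
Definition upperC al : R := 2 + 4 * (1 + growth0 al + 1 + growth2 al).

Lemma near_boundary_le be w phi (a lam s s' : R) : s <= s' ->
  near_boundary be w phi a lam s -> near_boundary be w phi a lam s'.
Proof. by move=> ss H z hz sz; apply: H => //; exact: le_lt_trans ss sz. Qed.

Lemma near_boundary_mono be w phi (a lam lam' s : R) : lam <= lam' ->
  near_boundary be w phi a lam s -> near_boundary be w phi a lam' s.
Proof.
move=> ll H z hz sz; apply: le_trans (H z hz sz) _.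
by apply: ler_wpM2r => //; exact: powR_ge0.
Qed.

(** The truncation is chosen last: [eta] has to beat the data of u and phi at 0, the bound M and the
    Cauchy factor k. *)
Lemma small_eta (b0 b1 b2 M k lam : R) : 0 <= b0 -> 0 <= b1 -> 0 <= b2 -> 0 <= M -> 0 <= k -> 0 < lam ->
  exists2 eta, 0 < eta & [/\ 4 * (b0 * eta) <= lam, 4 * (b1 * eta + b0 * (k * eta * b2)) <= lam &
    M * eta + M * (k * eta) + M * (k ^+ 2 * eta) <= lam].
Proof.
move=> h0 h1 h2 M0 k0 l0.
have c0 : 0 <= b0 * b2 * k by rewrite !mulr_ge0.
have c1 : 0 <= M * (1 + k + k ^+ 2) by rewrite mulr_ge0 // !addr_ge0 // exprn_ge0.
pose A := 4 * (b0 + (b1 + b0 * b2 * k) + M * (1 + k + k ^+ 2)) + 1.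
have A0 : 0 < A by rewrite /A; lra.
have e0 : 0 < lam / A by rewrite divr_gt0.
have eA : lam / A * A = lam by rewrite divfK // gt_eqF.
exists (lam / A) => //; move: e0 eA; generalize (lam / A) => e e0 <-.
have := mulr_ge0 (ltW e0) h0; have := mulr_ge0 (ltW e0) h1; have := mulr_ge0 (ltW e0) c0.
by have := mulr_ge0 (ltW e0) c1; rewrite /A => ????; split; lra.
Qed.

Lemma weighted_sum_le (lam w0 w1 w2 P0 P1 P2 y0 y1 y2 Q0 Q2 : R) : 0 <= lam ->
  0 <= y0 -> 0 <= y1 -> 0 <= y2 -> w0 <= lam * P0 -> w1 <= lam * P1 -> w2 <= lam * P2 ->
  P0 * y0 <= Q0 -> P1 * y1 <= 1 -> P2 * y2 <= Q2 ->
  w0 * y0 + w1 * y1 + w2 * y2 <= (1 + Q0 + 1 + Q2) * lam.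
Proof.
move=> l0 p0 p1 p2 h0 h1 h2 g0 g1 g2.
have := ler_wpM2r p0 h0; have := ler_wpM2r p1 h1; have := ler_wpM2r p2 h2.
by have := ler_wpM2l l0 g0; have := ler_wpM2l l0 g1; have := ler_wpM2l l0 g2; lra.
Qed.

Lemma small_sum_le (lam M eta k w0 w1 w2 y0 y1 y2 Q0 Q2 : R) : 0 <= lam ->
  0 <= w0 -> 0 <= w1 -> 0 <= w2 -> 0 <= y0 -> 0 <= y1 -> 0 <= y2 ->
  w0 <= M -> w1 <= M -> w2 <= M -> y0 <= eta -> y1 <= k * eta -> y2 <= k ^+ 2 * eta ->
  M * eta + M * (k * eta) + M * (k ^+ 2 * eta) <= lam -> 0 <= Q0 -> 0 <= Q2 ->
  w0 * y0 + w1 * y1 + w2 * y2 <= (1 + Q0 + 1 + Q2) * lam.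
Proof.
move=> l0 a0 a1 a2 p0 p1 p2 h0 h1 h2 g0 g1 g2 hl q0 q2.
apply: le_trans (lerD (lerD (ler_pM a0 p0 h0 g0) (ler_pM a1 p1 h1 g1)) (ler_pM a2 p2 h2 g2)) _.
by have := mulr_ge0 q0 l0; have := mulr_ge0 q2 l0; lra.
Qed.

Lemma upper_bound al be u phi (lam s : R) : 1 < al -> holo u -> selfmap phi ->
  bounded_op al be (wco u phi) -> 0 < lam -> 0 <= s < 1 ->
  near_boundary be (coef0 u) phi (al - 1) lam s -> near_boundary be (coef1 u phi) phi al lam s ->
  near_boundary be (coef2 u phi) phi (al + 1) lam s ->
  (essnorm al be (wco u phi) <= (upperC al * lam)%:E)%E.
Proof.
move=> al1 hu hphi bT l0 hs nb0 nb1 nb2; have p0 := pi_gt0 R.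
have [hp hpd] := hphi.
have [M M0 HM] := coef_bounded al1 hu hphi bT.
have phi0 : cabs (phi 0) < 1 by exact: hpd disk0.
(* Including |phi 0| places the two terms of the norm at 0 in the region where [G] is small. *)
pose s0 := Num.max s (cabs (phi 0)).
have ss0 : s <= s0 by rewrite le_max lexx.
have ps0 : cabs (phi 0) <= s0 by rewrite le_max lexx orbT.
have s01 : s0 < 1 by rewrite gt_max phi0 andbT; lra.
(* Leaves room for two Cauchy estimates of radius [rho]: G is small up to s0 + 2 [rho] < 1, G' up to
   s0 + [rho], G'' up to s0. *)
pose rho := (1 - s0) / 4; have rho0 : 0 < rho by rewrite /rho; lra.
pose k := 4 * pi / rho; have k0 : 0 < k by rewrite divr_gt0 // mulr_gt0.
have hs' : 0 <= s0 + 2 * rho < 1 by apply/andP; split; rewrite /rho; lra.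
have s0rho : s0 <= s0 + rho by lra.
have rho1 w : cabs w <= s0 + rho -> cabs w + rho < 1 by rewrite /rho; lra.
have rho2 w : cabs w <= s0 -> cabs w + rho < 1 by rewrite /rho; lra.
have near1 (v w : C) : cabs w <= s0 + rho -> cabs (v - w) <= rho -> cabs v <= s0 + 2 * rho.
  by have := cabsD (v - w) w; rewrite subrK; lra.
have near2 (v w : C) : cabs w <= s0 -> cabs (v - w) <= rho -> cabs v <= s0 + rho.
  by have := cabsD (v - w) w; rewrite subrK; lra.
have s02 : s0 <= s0 + 2 * rho by lra.
have four : cabs (4 : C) = 4 by rewrite cabs_nat.
have [g02 _] := growth0P al1.
have g00 : 0 <= growth0 al by lra.
have g20 : 0 <= growth2 al by rewrite /growth2; apply: mulr_ge0 (powR_ge0 _ _); apply: mulr_ge0 (ltW p0).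
have [eta eta0 [eta1 eta2 eta3]] := small_eta (cabs_ge0 (u 0)) (cabs_ge0 (cder u 0)) (cabs_ge0 (cder phi 0)) M0 (ltW k0) l0.
have [tau [n [ht n2 HG]]] := trunc_approximates al1 eta0 hs'.
have ess : (essnorm al be (wco u phi) <=
    opnorm al be (fun f z => (wco u phi f z - wco u phi (trunc_op n tau f) z)%R))%E.
  apply: ereal_inf_lbound; exists (fun f => wco u phi (trunc_op n tau f)); last exact: erefl.
  exact: trunc_compact al1 ht n2 hphi bT.
apply: le_trans ess _.
apply: ge_ereal_sup => _ [f [Bf nf] <-].
have [uG sG] := HG f (conj Bf nf); set G := remainder n tau f in uG sG.
have hG := unitB_holo uG; have hG' := holo_cder hG.
have G1 w : cabs w <= s0 + rho -> cabs (cder G w) <= k * eta.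
  move=> hw; have := @cauchy_estimate _ G w rho eta hG rho0 (rho1 w hw).
  by rewrite mulrAC; apply => v hv; apply: sG; exact: near1 hw hv.
have G2 w : cabs w <= s0 -> cabs (cder (cder G) w) <= k ^+ 2 * eta.
  move=> hw; have := @cauchy_estimate _ (cder G) w rho (k * eta) hG' rho0 (rho2 w hw).
  have -> : 4 * pi * (k * eta) / rho = k ^+ 2 * eta by rewrite /k; ring.
  by apply => v hv; apply: G1; exact: near2 hw hv.
have G0 w : cabs w <= s0 -> cabs (G w) <= eta by move=> hw; apply: sG; exact: le_trans hw s02.
have -> : (fun z => wco u phi f z - wco u phi (trunc_op n tau f) z) = (fun z => 4 * wco u phi G z).
  by apply/funext => z; rewrite /wco /G /remainder; field.
have hT : holo (wco u phi G) by exact: wco_holo.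
have T1 z : disk z -> cder (fun z => 4 * wco u phi G z) z = 4 * (cder u z * G (phi z) + u z * (cder G (phi z) * cder phi z)).
  move=> hz; rewrite -(cder_wco hu hphi hG hz).
  exact: cdiff_cder (cdiffZ 4 (holo_cdiff hT hz)).
have T2 z : disk z -> cder (cder (fun z => 4 * wco u phi G z)) z =
    4 * (coef0 u z * G (phi z) + coef1 u phi z * cder G (phi z) + coef2 u phi z * cder (cder G) (phi z)).
  move=> hz; rewrite -(cder2_wco hu hphi hG hz).
  have E w : disk w -> (fun w => 4 * cder (wco u phi G) w) w = cder (fun z => 4 * wco u phi G z) w.
    by move=> hw; apply/esym; exact: cdiff_cder (cdiffZ 4 (holo_cdiff hT hw)).
  have D w : disk w -> cdiff (fun w => 4 * cder (wco u phi G) w) w (4 * cder (cder (wco u phi G)) w).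
    by move=> hw; exact: (cdiffZ 4 (holo_cdiff (holo_cder hT) hw)).
  exact: (etrans (cder_ext hz E (cdiff_holo D)) (cdiff_cder (D z hz))).
have n0 : cabs (4 * wco u phi G 0) <= lam.
  apply: le_trans eta1; rewrite /wco 2!cabsM four; apply: ler_wpM2l; first exact: ler0n.
  by apply: ler_wpM2l; [exact: cabs_ge0|exact: G0].
have n1 : cabs (cder (fun z => 4 * wco u phi G z) 0) <= lam.
  rewrite (T1 _ disk0) cabsM four; apply: le_trans eta2; apply: ler_wpM2l; first exact: ler0n.
  apply: le_trans (cabsD _ _) _; apply: lerD; rewrite cabsM; apply: ler_wpM2l; rewrite ?cabs_ge0 //.
    exact: G0.
  rewrite cabsM; apply: ler_wpM2r; first exact: cabs_ge0.
  by apply: G1; exact: le_trans ps0 s0rho.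
pose B := 1 + growth0 al + 1 + growth2 al.
have nn : forall z, disk z -> wt be z * cabs (cder (cder (fun z => 4 * wco u phi G z)) z) <= 4 * (B * lam).
  move=> z hz; rewrite (T2 z hz) cabsM four mulrCA; apply: ler_wpM2l; first exact: ler0n.
  have [m0 m1 m2] := HM z hz.
  have W0 := wt_ge0 be z; have hpz : disk (phi z) by exact: hpd.
  have tri (a b c x y t : C) : wt be z * cabs (a * x + b * y + c * t) <=
      wt be z * cabs a * cabs x + wt be z * cabs b * cabs y + wt be z * cabs c * cabs t.
    rewrite -!mulrA -!mulrDr -!cabsM; apply: ler_wpM2l; first exact: W0.
    by apply: le_trans (cabsD _ _) _; apply: lerD (lexx _); exact: cabsD.
  apply: le_trans (tri _ _ _ _ _ _) _.
  have [sz|zs] := ltP s0 (cabs (phi z)).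
    have ssz := le_lt_trans ss0 sz.
    exact: (weighted_sum_le (ltW l0) (cabs_ge0 _) (cabs_ge0 _) (cabs_ge0 _)
      (nb0 z hz ssz) (nb1 z hz ssz) (nb2 z hz ssz)
      (growth0_bound al1 uG hpz) (unitB1 al1 uG hpz) (growth2_bound al1 uG hpz)).
  have wp (x : C) : 0 <= wt be z * cabs x by exact: mulr_ge0 W0 (cabs_ge0 x).
  exact: (small_sum_le (ltW l0) (wp _) (wp _) (wp _) (cabs_ge0 _) (cabs_ge0 _) (cabs_ge0 _)
    m0 m1 m2 (G0 _ zs) (G1 _ (le_trans zs s0rho)) (G2 _ zs) eta3 g00 g20).
apply: le_trans (normZ_le n0 n1 nn) _.
rewrite lee_fin le_eqVlt; apply/orP; left; apply/eqP; rewrite /upperC -/B.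
by generalize B => b; ring.
Qed.

End UpperBound.

(** * Limits superior in the extended reals *)

Section LimitSuperior.
Context {R : realType}.
Implicit Types (x : nat -> \bar R) (a be : R) (g : cfun R).
Local Open Scope ereal_scope.

Lemma limn_esup_lt x (y : \bar R) : limn_esup x < y ->
  exists N, forall n, (N <= n)%N -> x n < y.
Proof.
move=> /ereal_inf_lt[_ [V [N _ HN] <-] h]; exists N => n Nn.
by apply: le_lt_trans h; apply: ereal_sup_ubound; exists n => //; exact: HN.
Qed.

Lemma limn_esup_le x (y : \bar R) N : (forall n, (N <= n)%N -> x n <= y) -> limn_esup x <= y.
Proof.
move=> H; apply: (@le_trans _ _ (ereal_sup [set x n | n in [set n | (N <= n)%N]])%classic).
  by apply: ereal_inf_lbound; exists [set n | (N <= n)%N]%classic => //; exists N.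
by apply: ge_ereal_sup => _ [n Nn <-]; exact: H.
Qed.

Lemma limn_esup_ge0 x : (forall n, 0 <= x n) -> 0 <= limn_esup x.
Proof.
move=> x0; rewrite leNgt; apply/negP => /limn_esup_lt[N /(_ N (leqnn N))].
by rewrite ltNge x0.
Qed.

Lemma scaled_wsup_leP (p a lam : R) g : (0 < p)%R ->
  p%:E * wsup a g <= lam%:E <-> (forall z, disk z -> p * (wt a z * cabs (g z)) <= lam)%R.
Proof.
move=> p0; have pE : 0 <= p%:E by rewrite lee_fin ltW.
split=> [H z hz|H].
  rewrite -lee_fin EFinM; apply: le_trans H; apply: lee_wpmul2l => //.
  by apply: ereal_sup_ubound; exists z.
have pn : (p != 0)%R by rewrite gt_eqF.
rewrite -(divfK pn lam) mulrC EFinM.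
apply: lee_wpmul2l => //; apply/wsup_leP => z hz.
by rewrite ler_pdivlMr // mulrC; exact: H.
Qed.

(** The estimates need a finite [lam] > 0, while Y may be 0 or infinite: approaching Y from above
    covers 0, and the infinite case is trivial. *)
Lemma le_scale (X Y : \bar R) (c : R) : (0 < c)%R -> 0 <= Y ->
  (forall lam : R, (0 < lam)%R -> Y < lam%:E -> X <= (c * lam)%:E) -> X <= c%:E * Y.
Proof.
move=> c0; case: Y => [y| |] // y0 H; last by rewrite gt0_muley ?lte_fin // leey.
apply/lee_addgt0Pr => e e0.
have ec : (0 < e / c)%R by rewrite divr_gt0.
rewrite -EFinM -EFinD (_ : (c * y + e = c * (y + e / c))%R); last first.
  by rewrite mulrDr mulrCA divff ?gt_eqF // mulr1.
by apply: H; rewrite ?lte_fin; rewrite lee_fin in y0; lra.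
Qed.

End LimitSuperior.

(** * Comparison of the essential norm with the symbol *)

Section EssentialNorm.
Context {R : realType}.
Implicit Types (al be lam a : R) (u phi w : cfun R).

Definition power_sup be w phi a : \bar R :=
  limn_esup (fun n : nat => ((n.+1%:R `^ a)%:E * wsup be (fun z => w z * phi z ^+ n)%R)%E).

Lemma power_sup_ge0 be w phi a : (0 <= power_sup be w phi a)%E.
Proof.
by apply: limn_esup_ge0 => n; rewrite mule_ge0 ?wsup_ge0 // lee_fin powR_ge0.
Qed.

Lemma power_sup_near_boundary be w phi a lam : selfmap phi -> 0 <= a ->
  (power_sup be w phi a < lam%:E)%E ->
  exists s : R, 1 / 2 <= s < 1 /\ near_boundary be w phi a (2 * 4 `^ a * lam) s.
Proof.
move=> hphi a0 /limn_esup_lt[N HN].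
apply: (@powers_near_boundary _ be w phi a lam N) => // n z Nn hz.
have p0 : 0 < n.+1%:R `^ a :> R by rewrite powR_gt0.
by have /(scaled_wsup_leP _ _ _ p0) := ltW (HN n Nn); exact.
Qed.

Lemma near_boundary_power_sup be w phi a lam M s : selfmap phi -> 0 < a -> 0 < lam -> 0 <= s < 1 ->
  (forall z, disk z -> wt be z * cabs (w z) <= M) -> near_boundary be w phi a lam s ->
  (power_sup be w phi a <= (decay a * lam)%:E)%E.
Proof.
move=> hphi a0 l0 hs HM Hnb.
have [N HN] := near_boundary_powers hphi a0 l0 hs HM Hnb.
apply: (@limn_esup_le _ _ _ N) => n Nn.
have p0 : 0 < n.+1%:R `^ a :> R by rewrite powR_gt0.
by apply/(scaled_wsup_leP _ _ _ p0) => z hz; exact: HN.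
Qed.

Lemma opnorm_ge0 al be (T : cfun R -> cfun R) : (0 <= opnorm al be T)%E.
Proof.
pose f0 : cfun R := fun=> 0.
have c0 z : cdiff f0 z 0 by exact: cdiff_cst.
have h0 : holo f0 by apply: (@cdiff_holo _ f0 (fun=> 0)) => z _; exact: c0.
have u0 : unitB al f0.
  apply: (unitBP (M := 0) (N := 0) h0); last by rewrite addr0.
    by rewrite /f0 cabs0.
  by move=> z _; rewrite (cdiff_cder (c0 z)) cabs0 mulr0.
apply: le_trans (normZ_ge0 be (T f0)) _.
by apply: ereal_sup_ubound; exists f0; first exact: u0.
Qed.

Lemma essnorm_ge0 al be (T : cfun R -> cfun R) : (0 <= essnorm al be T)%E.
Proof. by apply: le_ereal_inf_tmp => _ [K _ <-]; exact: opnorm_ge0. Qed.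

Definition symbol_sup al be u phi : \bar R :=
  maxe (power_sup be (coef1 u phi) phi al)
    (maxe (power_sup be (coef2 u phi) phi (al + 1)) (power_sup be (coef0 u) phi (al - 1))).

(** Adding the three values of [decay] gives a single constant that dominates each of them. *)
Definition lowerC al : R :=
  (decay al + decay (al + 1) + decay (al - 1)) * (2 * tstC al * 4 `^ (al + 1)).

Lemma lowerC_gt0 al : 1 < al -> 0 < lowerC al.
Proof.
move=> al1; have d0 := @decay_gt0 R al ltac:(lra); have d1 := @decay_gt0 R (al + 1) ltac:(lra).
have d2 := @decay_gt0 R (al - 1) ltac:(lra); have t0 := tstC_gt0 al1.
apply: mulr_gt0; first lra.
by apply: mulr_gt0 (powR_gt0 _ _) => //; rewrite mulr_gt0.
Qed.

Lemma symbol_le_essnorm al be u phi : 1 < al -> holo u -> selfmap phi ->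
  bounded_op al be (wco u phi) ->
  (symbol_sup al be u phi <= (lowerC al)%:E * essnorm al be (wco u phi))%E.
Proof.
move=> al1 hu hphi bT; apply: le_scale; [exact: lowerC_gt0|exact: essnorm_ge0|].
move=> lam l0 /ereal_inf_lt[_ [K cK <-] hK].
have HTK f : unitB al f -> (normZ be (fun z => wco u phi f z - K f z)%R <= lam%:E)%E.
  move=> uf; apply: le_trans (ltW hK); apply: ereal_sup_ubound.
  by exists f; first exact: uf.
have [[s1 [hs1 nb1]] [s2 [hs2 nb2]] [s0 [hs0 nb0]]] := lower_bounds al1 hu hphi bT cK l0 HTK.
have [M M0 HM] := coef_bounded al1 hu hphi bT.
set c := 2 * tstC al * 4 `^ (al + 1) in nb1 nb2 nb0.
have c0 : 0 < c by apply: mulr_gt0 (powR_gt0 _ _) => //; rewrite mulr_gt0 // tstC_gt0.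
have cl : 0 < c * lam by rewrite mulr_gt0.
have d0 := @decay_gt0 R al ltac:(lra); have d1 := @decay_gt0 R (al + 1) ltac:(lra).
have d2 := @decay_gt0 R (al - 1) ltac:(lra).
have E (d : R) : 0 < d -> d <= decay al + decay (al + 1) + decay (al - 1) ->
    ((d * (c * lam))%:E <= (lowerC al * lam)%:E)%E.
  move=> dp dd; rewrite lee_fin /lowerC -/c -mulrA; apply: ler_wpM2r dd; exact: ltW.
rewrite /symbol_sup !ge_max; apply/andP; split; last (apply/andP; split).
- apply: le_trans (E _ d0 _); last lra.
  apply: (@near_boundary_power_sup _ _ _ _ _ M s1) => //; try lra.
  by move=> z /HM[].
- apply: le_trans (E _ d1 _); last lra.
  apply: (@near_boundary_power_sup _ _ _ _ _ M s2) => //; try lra.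
  by move=> z /HM[].
- apply: le_trans (E _ d2 _); last lra.
  apply: (@near_boundary_power_sup _ _ _ _ _ M s0) => //; try lra.
  by move=> z /HM[].
Qed.

Lemma essnorm_le_symbol al be u phi : 1 < al -> holo u -> selfmap phi ->
  bounded_op al be (wco u phi) ->
  (essnorm al be (wco u phi) <= (upperC al * (2 * 4 `^ (al + 1)))%:E * symbol_sup al be u phi)%E.
Proof.
move=> al1 hu hphi bT.
have a1 : 0 <= al by lra.
have a2 : 0 <= al + 1 by lra.
have a0 : 0 <= al - 1 by lra.
have [g0 _] := growth0P al1.
have g2 : 0 <= growth2 al by rewrite /growth2; apply: mulr_ge0 (powR_ge0 _ _); apply: mulr_ge0 (pi_ge0 _).
have u0 : 0 < upperC al by rewrite /upperC; lra.
have p0 : 0 < 4 `^ (al + 1) :> R by rewrite powR_gt0.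
apply: le_scale; first by rewrite mulr_gt0 // mulr_gt0.
  by rewrite /symbol_sup le_max power_sup_ge0.
move=> lam l0; rewrite /symbol_sup !gt_max => /andP[h1 /andP[h2 h0]].
have [s1 [hs1 nb1]] := power_sup_near_boundary hphi a1 h1.
have [s2 [hs2 nb2]] := power_sup_near_boundary hphi a2 h2.
have [s0 [hs0 nb0]] := power_sup_near_boundary hphi a0 h0.
pose s := Num.max s1 (Num.max s2 s0).
have c0 : 0 < 2 * 4 `^ (al + 1) * lam by rewrite !mulr_gt0.
have E (a : R) : a <= al + 1 -> 2 * 4 `^ a * lam <= 2 * 4 `^ (al + 1) * lam.
  move=> aa; apply: ler_wpM2r; first exact: ltW.
  by apply: ler_wpM2l => //; apply: ler_powR => //; lra.
have hs : 0 <= s < 1.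
  apply/andP; split; last by rewrite !gt_max; apply/andP; split; [lra|apply/andP; split; lra].
  by rewrite le_max; apply/orP; left; lra.
have := @upper_bound R al be u phi (2 * 4 `^ (al + 1) * lam) s al1 hu hphi bT c0 hs.
rewrite mulrA; apply.
- apply: near_boundary_mono (E _ _) (near_boundary_le _ nb0); first lra.
  by rewrite /s !le_max lexx !orbT.
- apply: near_boundary_mono (E _ _) (near_boundary_le _ nb1); first lra.
  by rewrite /s !le_max lexx.
- apply: near_boundary_mono (E _ _) (near_boundary_le _ nb2); first lra.
  by rewrite /s !le_max lexx !orbT.
Qed.

End EssentialNorm.

Theorem theorem4p4 (R : realType) (al be : R) :
  1 < al -> 0 < be ->
  exists c : R, 0 < c /\
  forall u phi : cfun R, holo u -> selfmap phi ->
  bounded_op al be (wco u phi) ->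
  let E := maxe
    (limn_esup (fun n : nat => ((n.+1%:R `^ al)%:E *
       wsup be (fun z => (2 * cder u z * cder phi z + u z * cder (cder phi) z)
                          * phi z ^+ n)%R)%E))
    (maxe
    (limn_esup (fun n : nat => ((n.+1%:R `^ (al + 1))%:E *
       wsup be (fun z => u z * cder phi z ^+ 2 * phi z ^+ n)%R)%E))
    (limn_esup (fun n : nat => ((n.+1%:R `^ (al - 1))%:E *
       wsup be (fun z => cder (cder u) z * phi z ^+ n)%R)%E))) in
  ((c^-1)%:E * E <= essnorm al be (wco u phi) <= c%:E * E)%E.
Proof.
move=> al1 be0; pose up := upperC al * (2 * 4 `^ (al + 1)).
have [g0 _] := growth0P al1.
have g2 : 0 <= growth2 al by rewrite /growth2; apply: mulr_ge0 (powR_ge0 _ _); apply: mulr_ge0 (pi_ge0 _).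
have p0 : 0 < 4 `^ (al + 1) :> R by rewrite powR_gt0.
have up0 : 0 < up by apply: mulr_gt0; [rewrite /upperC; lra|rewrite mulr_gt0].
have lo0 := lowerC_gt0 al1.
have c0 : 0 < lowerC al + up by rewrite addr_gt0.
exists (lowerC al + up); split=> [|u phi hu hphi bT]; first exact: c0.
(* True by unfolding: [symbol_sup] lists the three coefficients in the order of the maximum in the
   statement. *)
change (((lowerC al + up)^-1%:E * symbol_sup al be u phi <= essnorm al be (wco u phi)
  <= (lowerC al + up)%:E * symbol_sup al be u phi)%E).
have s0 : (0 <= symbol_sup al be u phi)%E by rewrite /symbol_sup le_max power_sup_ge0.
apply/andP; split.
  rewrite lee_pdivrMl //; apply: le_trans (symbol_le_essnorm al1 hu hphi bT) _.
  by apply: lee_wpmul2r; [exact: essnorm_ge0|rewrite lee_fin lerDl ltW].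
apply: le_trans (essnorm_le_symbol al1 hu hphi bT) _.
by apply: lee_wpmul2r => //; rewrite lee_fin lerDr ltW.
Qed.
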